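(* (1) Let $X=X(N,\triangle)$ be a complete toric variety, with set of roots $\mathcal{R}$. The following conditions are equivalent: (a) $\triangle$ is semisimple, i.e., $\mathrm{Aut}(X)$ is reductive; (b) $\sum_{x\in\mathcal{R}} x=0$; (c) $\sum_{\tau\in\triangle(1)}\langle v_\tau,x\rangle=0$ for all $x\in\mathcal{R}$. Moreover, if $\sum_{\tau\in\triangle(1)} v_\tau=0$, then $\triangle$ is semisimple. (2) Let $X_P$ be a Gorenstein toric Fano variety, where $P\subseteq M_{\mathbb{R}}$ is a reflexive polytope with set of roots $\mathcal{R}$. The following conditions are equivalent: (a) $P$ is semisimple, i.e., $\mathrm{Aut}(X_P)$ is reductive; (b) $\sum_{x\in\mathcal{R}}x=0$; (c) $\sum_{v\in\mathcal{V}(P^* )}\langle v,x\rangle=0$ for all $x\in\mathcal{R}$; (d) $\sum_{y\in P^*\cap N}\langle y,x\rangle=0$ for all $x\in\mathcal{R}$; (e) $\langle b_{P^*},x\rangle=0$ for all $x\in\mathcal{R}$; (f) $\mathrm{rvol}(F')=\mathrm{rvol}(\mathcal{F}_x)$ for all $x\in\mathcal{R}$ and all facets $F'$ of $P$ with $\langle\eta_{F'},x\rangle>0$; (g) $|F'\cap M|=|\mathcal{F}_x\cap M|$ for all $x\in\mathcal{R}$ and all facets $F'$ of $P$ with $\langle\eta_{F'},x\rangle>0$. Any one of the following conditions is sufficient for $P$ to be semisimple: (i) $b_P=0$; (ii) $\sum_{m\in P\cap M}m=0$; (iii) $b_{P^*}=0$; (iv) $\sum_{y\in P^*\cap N}y=0$;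 (v) $\sum_{v\in\mathcal{V}(P^* )}v=0$; (vi) all facets of $P$ have the same relative lattice volume; (vii) all facets of $P$ have the same number of lattice points. Condition (vi) implies (v), e.g., if $P$ is a smooth Fano polytope.
   Context: $N\cong\mathbb{Z}^d$ is a lattice, $M=\mathrm{Hom}_{\mathbb{Z}}(N,\mathbb{Z})$ its dual with pairing $\langle\cdot,\cdot\rangle$, $N_{\mathbb{R}},M_{\mathbb{R}}$ the real extensions. For a complete fan $\triangle$ in $N_{\mathbb{R}}$, $\triangle(1)$ is its set of rays and $v_\tau$ is the primitive generator of $\tau\cap N$ for $\tau\in\triangle(1)$; $X(N,\triangle)$ is the corresponding toric variety over $\mathbb{C}$. The set of roots of $\triangle$ is $$\mathcal{R}=\{m\in M : \exists\,\tau\in\triangle(1):\ \langle v_\tau,m\rangle=-1\text{ and }\forall\,\tau'\in\triangle(1)\setminus\{\tau\}:\ \langle v_{\tau'},m\rangle\ge 0\}.$$ $\triangle$ is semisimple if $\mathcal{R}=-\mathcal{R}$. An algebraic group is reductive if its unipotent radical is trivial; for a complete toric variety $X(N,\triangle)$ it is known that $\mathrm{Aut}(X)$ is reductive if and only if $\triangle$ is semisimple. For a rational $d$-dimensional polytope $P\subseteq M_{\mathbb{R}}$ with $0\in\mathrm{int}\,P$, $P^*=\{y\in N_{\mathbb{R}}:\langle x,y\rangle\ge-1\ \forall x\in P\}$ is the dual polytope; $P$ is reflexive if $P$ and $P^*$ are both lattice polytopes. The normal fan $\mathcal{N}_P$ consists of the cones $\mathrm{pos}(F)$ over faces $F$ of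 $P^*$, and $X_P:=X(N,\mathcal{N}_P)$. For $P$ reflexive, the roots of $P$ are the roots of $\mathcal{N}_P$; these are exactly the lattice points in the relative interiors of facets of $P$, and $P$ is called semisimple if $\mathcal{N}_P$ is. For a root $x$ of $P$, $\mathcal{F}_x$ is the unique facet of $P$ containing $x$. For a facet $F$ of $P$, $\eta_F\in N$ is the unique inner normal with $\langle\eta_F,F\rangle=-1$. $\mathcal{V}(Q)$ is the set of vertices of a polytope $Q$ and $b_Q$ its barycenter. For a lattice polytope $Q$, $\mathrm{rvol}(Q)$ is the relative lattice volume, normalized so that a fundamental parallelepiped of the lattice $\mathrm{aff}(Q)\cap M$ has volume $1$. A $d$-dimensional lattice polytope $P$ with $0\in\mathrm{int}\,P$ is a smooth Fano polytope if the vertices of any facet of $P$ form a $\mathbb{Z}$-basis of $M$. *)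

(* Defs.v *)
From HB Require Import structures.
From mathcomp Require Import all_boot all_order all_algebra.
From mathcomp Require Import all_classical all_reals all_analysis.

Set Implicit Arguments.
Unset Strict Implicit.
Unset Printing Implicit Defensive.

Import Order.TTheory GRing.Theory Num.Theory.
Import numFieldNormedType.Exports.

Local Open Scope classical_set_scope.
Local Open Scope ring_scope.

(* A Z-basis of N and its dual basis of M are fixed throughout: both N and M
   become the lattice of integral vectors in 'rV[R]_d, both N_R and M_R become
   'rV[R]_d, and the pairing becomes the standard dot product. *)

Section Lattice.
Context {R : realType}.
Implicit Types d k : nat.

Definition lattice {d} : set 'rV[R]_d :=
  [set x | forall i, x 0 i \is a Num.int].

Definition pairing {d} (x y : 'rV[R]_d) : R := \sum_(i < d) x 0 i * y 0 i.

Definition is_Zbasis {k d} (L : set 'rV[R]_d) (B : 'M[R]_(k, d)) : Prop :=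
  row_free B /\ L = [set z *m B | z in lattice].

End Lattice.

Section Convex_geometry.
Context {R : realType} {d : nat}.
Implicit Types A F P s : set 'rV[R]_d.

Definition pos A : set 'rV[R]_d :=
  [set x | exists n (a : 'I_n -> R) (v : 'I_n -> 'rV[R]_d),
    [/\ forall i, 0 <= a i, forall i, A (v i) & x = \sum_i a i *: v i]].

Definition conv A : set 'rV[R]_d :=
  [set x | exists n (a : 'I_n -> R) (v : 'I_n -> 'rV[R]_d),
    [/\ forall i, 0 <= a i, \sum_i a i = 1, forall i, A (v i)
      & x = \sum_i a i *: v i]].

Definition aff A : set 'rV[R]_d :=
  [set x | exists n (a : 'I_n -> R) (v : 'I_n -> 'rV[R]_d),
    [/\ \sum_i a i = 1, forall i, A (v i) & x = \sum_i a i *: v i]].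

(* dimension of the linear span *)
Definition lin_dim A : nat :=
  \max_(k < d.+1 | `[< exists B : 'M[R]_(k, d),
                       row_free B /\ forall i, A (row i B) >]) k.

(* dimension of the affine hull, for A nonempty; 0 by convention for set0 *)
Definition aff_dim A : nat := lin_dim [set x - y | x in A & y in A].

(* The empty set and P itself are faces of P. *)
Definition is_face P F : Prop :=
  exists (u : 'rV[R]_d) (c : R),
    (forall x, P x -> c <= pairing u x) /\
    F = P `&` [set x | pairing u x = c].

Definition is_facet P F : Prop :=
  [/\ is_face P F, F !=set0 & (aff_dim F).+1 = d].

Definition vertices P : set 'rV[R]_d := [set v | is_face P [set v]].

Definition lattice_polytope P : Prop :=
  exists n (v : 'I_n -> 'rV[R]_d),
    (forall i, lattice (v i)) /\ P = conv (range v).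

Definition dual_polytope P : set 'rV[R]_d :=
  [set y | forall x, P x -> -1 <= pairing x y].

Definition reflexive_polytope P : Prop :=
  [/\ (interior P) 0, lattice_polytope P & lattice_polytope (dual_polytope P)].

Definition smooth_Fano_polytope P : Prop :=
  [/\ (interior P) 0, lattice_polytope P &
      forall F, is_facet P F ->
        exists B : 'M[R]_d,
          is_Zbasis lattice B /\ vertices F = range (fun i => row i B)].

(* eta_F, as an element of N; 0 if there is no such lattice vector *)
Definition inner_normal F : 'rV[R]_d :=
  xget 0 [set n | lattice n /\ forall x, F x -> pairing n x = -1].

(* the facet F_x of P containing x; set0 if there is none *)
Definition facet_at P (x : 'rV[R]_d) : set 'rV[R]_d :=
  xget set0 [set F | is_facet P F /\ F x].

End Convex_geometry.

Section Fans.
Context {R : realType} {d : nat}.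
Implicit Types (s t F : set 'rV[R]_d) (D : set (set 'rV[R]_d)).

Definition rational_cone s : Prop :=
  exists n (v : 'I_n -> 'rV[R]_d),
    (forall i, lattice (v i)) /\ s = pos (range v).

Definition strongly_convex s : Prop := forall x, s x -> s (- x) -> x = 0.

Definition is_cone_face s F : Prop :=
  exists u : 'rV[R]_d,
    (forall x, s x -> 0 <= pairing u x) /\
    F = s `&` [set x | pairing u x = 0].

Definition is_fan D : Prop :=
  [/\ finite_set D, D !=set0,
      forall s, D s -> rational_cone s /\ strongly_convex s,
      forall s F, D s -> is_cone_face s F -> D F &
      forall s t, D s -> D t ->
        is_cone_face s (s `&` t) /\ is_cone_face t (s `&` t)].

Definition complete_fan D : Prop :=
  is_fan D /\ \bigcup_(s in D) s = setT.

Definition rays D : set (set 'rV[R]_d) := [set t | D t /\ lin_dim t = 1%N].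

(* v_t : the generator of the monoid formed by the lattice points of t *)
Definition prim_gen t : 'rV[R]_d :=
  xget 0 [set v | t `&` lattice = range (fun k : nat => v *+ k)].

Definition fan_roots D : set 'rV[R]_d :=
  [set m | lattice m /\
    exists t, [/\ rays D t, pairing (prim_gen t) m = -1 &
      forall t', rays D t' -> t' <> t -> 0 <= pairing (prim_gen t') m]].

Definition semisimple D : Prop := fan_roots D = [set - m | m in fan_roots D].

(* Only proper faces F of the dual polytope span cones of the normal fan;
   F = set0 gives the cone {0}. *)
Definition normal_fan (P : set 'rV[R]_d) : set (set 'rV[R]_d) :=
  [set pos F | F in
    [set F | is_face (dual_polytope P) F /\ F <> dual_polytope P]].

End Fans.

Section Volume.
Context {R : realType}.
Local Open Scope ereal_scope.

(* Integration over R^n with respect to the n-fold product of the Lebesgue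
   measure on R, as an iterated integral. It is only used for functions that
   are bounded, Borel and vanish outside a compact set. *)
Fixpoint integral_rV (n : nat) : ('rV[R]_n -> \bar R) -> \bar R :=
  match n with
  | 0%N => fun f => f 0%R
  | n'.+1 => fun f =>
      \int[lebesgue_measure]_(t in [set: R])
        integral_rV (fun x : 'rV[R]_n' => f (row_mx t%:M x : 'rV[R]_(1 + n')))
  end.

Definition volume (n : nat) (A : set 'rV[R]_n) : \bar R :=
  integral_rV (fun x => (\1_A x)%:E).

(* meant for full-dimensional compact A *)
Definition barycenter (n : nat) (A : set 'rV[R]_n) : 'rV[R]_n :=
  \row_i (fine (integral_rV (fun x => (x 0 i * \1_A x)%:E)) /
          fine (volume A))%R.

Local Open Scope ring_scope.

(* p and the rows of B give affine lattice coordinates on aff Q *)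
Definition is_lattice_frame (d k : nat) (Q : set 'rV[R]_d)
    (pB : 'rV[R]_d * 'M[R]_(k, d)) : Prop :=
  (aff Q `&` lattice) pB.1 /\
  is_Zbasis [set m - pB.1 | m in aff Q `&` lattice] pB.2.

(* Lebesgue volume of Q in lattice coordinates on aff Q; two frames differ by
   an integral unimodular affine map, so the choice made by xget is
   immaterial. *)
Definition rvol (d : nat) (Q : set 'rV[R]_d) : \bar R :=
  let pB : 'rV[R]_d * 'M[R]_(aff_dim Q, d) :=
    xget (0, 0) [set pB | is_lattice_frame Q pB] in
  volume [set t : 'rV[R]_(aff_dim Q) | Q (pB.1 + t *m pB.2)].

End Volume.

(* Main.v *)
(* A root [x] pairs to -1 with exactly one normal [eta] and to nonnegative
   integers with all others, so that the pairings of [x] sum to zero exactly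
   when a single other one is nonzero and equals 1, i.e. when [- x] is a root.
   For a reflexive polytope, the criteria on lattice points and on barycenters
   compare the two sides of a hyperplane by a reflection along [x] (along a
   normal, for the dual polytope): one side is mapped into the other, and
   equality of the sums or integrals forces the same configuration of normals.
   The criterion on facet volumes reduces to the one on normals through
   Minkowski's relation [\sum_v rvol F_v *: v = 0]: almost every point of the
   projection of [P] along a coordinate axis lies under exactly one facet on
   each side, and the projection of [F_v] along axis [j] has volume
   [`|v_j| * rvol F_v]. *)

From HB Require Import structures.
Require Import Defs.
From mathcomp Require Import all_boot all_order all_algebra.
From mathcomp Require Import all_classical all_reals all_analysis.
From mathcomp Require Import measurable_realfun.
From mathcomp Require Import ring lra.
Set Implicit Arguments.
Unset Strict Implicit.
Unset Printing Implicit Defensive.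
Import Order.TTheory GRing.Theory Num.Theory.
Import numFieldNormedType.Exports.
Local Open Scope classical_set_scope.
Local Open Scope card_scope.
Local Open Scope ring_scope.
Local Notation conv := Defs.conv.

(** * The product Lebesgue measure on row vectors *)

(** Each of the conditions (c) to (g) is handled one root at a time, as equivalent to [- x] being a
    root; the vanishing of the sum of all roots is global and is handled by a chain of roots. The
    reflections come from two normals: [eta], and some [v] with [<v, x> > 0]. Moving along [x], a
    point of [P] is stopped by the wall of [eta] alone, whereas against [x] the wall of [v] competes
    with those of all other normals positive on [x]. Exchanging the distances to the two walls
    therefore maps the half nearer to [v] into [P], and equality makes the wall of [v] the only
    obstacle. This holds for whichever [v] was chosen, so there is just one. Volumes are iterated
    integrals, which see the coordinates one by one, while a reflection mixes them. A measure with
    the same integrals is therefore built first, and its change of variables follows by factoring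
    matrices into shears and diagonal blocks. *)

Section rV_measure.
Context {R : realType}.
Local Notation mR := (measurableTypeR R).
Local Notation leb := (@lebesgue_measure R).
Local Open Scope ereal_scope.

(** With the sigma-algebra generated by the coordinates, prepending a coordinate and its inverse are
    both measurable, so that iterated integrals can be read as integrals for a product measure. *)
Definition cylinders n : set (set 'rV[R]_n) :=
  [set A | exists i (B : set mR),
     measurable B /\ A = (fun x : 'rV[R]_n => x ord0 i) @^-1` B].

Definition mrV n := g_sigma_algebraType (@cylinders n).
HB.instance Definition _ n := Measurable.on (mrV n).

Lemma measurable_coord n i :
  measurable_fun setT (fun x : mrV n => (x : 'rV[R]_n) ord0 i : mR).
Proof.
move=> _ B mB; rewrite setTI; apply: sub_sigma_algebra.
by exists i, B.
Qed.

Lemma measurable_rVP d (T : measurableType d) n (f : T -> mrV n) :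
  (forall i, measurable_fun setT (fun t => (f t : 'rV[R]_n) ord0 i : mR)) ->
  measurable_fun setT f.
Proof.
move=> mf.
apply: (@measurability _ _ T (mrV n) setT f (@cylinders n)) => //.
move=> _ [_ [i [B [mB ->]]] <-].
exact: (mf i measurableT B mB).
Qed.

Definition consrV n (p : mR * mrV n) : mrV n.+1 :=
  row_mx (p.1)%:M p.2 : 'rV[R]_(1 + n).
Definition unconsrV n (x : mrV n.+1) : mR * mrV n :=
  ((x : 'rV[R]_n.+1) ord0 ord0, \row_i (x : 'rV[R]_n.+1) ord0 (lift ord0 i)).

Lemma consrV0 n (p : mR * mrV n) : (consrV p : 'rV[R]_n.+1) ord0 ord0 = p.1.
Proof.
rewrite /consrV (_ : ord0 = lshift n ord0 :> 'I_(1 + n)); last exact/val_inj.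
by rewrite (@row_mxEl _ 1 1 n) mxE eqxx mulr1n.
Qed.

Lemma consrVS n (p : mR * mrV n) i :
  (consrV p : 'rV[R]_n.+1) ord0 (lift ord0 i) = (p.2 : 'rV[R]_n) ord0 i.
Proof. 
rewrite /consrV (_ : lift ord0 i = rshift 1 i :> 'I_(1 + n)); last exact/val_inj.
by rewrite (@row_mxEr _ 1 1 n). Qed.

Lemma consrVK n : cancel (@consrV n) (@unconsrV n).
Proof.
move=> [t x]; rewrite /unconsrV consrV0; congr pair.
by apply/rowP => i; rewrite mxE consrVS.
Qed.

Lemma measurable_consrV n : measurable_fun setT (@consrV n).
Proof.
apply: measurable_rVP => i; case: (unliftP ord0 i) => [j|] ->.
  under eq_fun do rewrite consrVS.
  apply: (measurableT_comp (measurable_coord j)); exact: measurable_snd.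
under eq_fun do rewrite consrV0.
exact: measurable_fst.
Qed.

Lemma measurable_unconsrV n : measurable_fun setT (@unconsrV n).
Proof.
apply: measurable_fun_pair; first exact: measurable_coord.
apply: measurable_rVP => i.
under eq_fun do rewrite mxE.
exact: measurable_coord.
Qed.

Lemma integral_rVS n (f : 'rV[R]_n.+1 -> \bar R) :
  integral_rV f = \int[leb]_t integral_rV (fun x => f (consrV (t, x))).
Proof. by []. Qed.

Lemma product_sigma_finite d1 d2 (T1 : measurableType d1)
    (T2 : measurableType d2) (m1 : {sigma_finite_measure set T1 -> \bar R})
    (m2 : {sigma_finite_measure set T2 -> \bar R}) :
  sigma_finite setT (m1 \x m2).
Proof.
have /sigma_finiteP[F [TF ndF Foo]] := sigma_finiteT m1.
have /sigma_finiteP[G [TG ndG Goo]] := sigma_finiteT m2.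
exists (fun k => F k `*` G k).
  apply/seteqP; split => // -[x y] _.
  have [i _ Fx] : (\bigcup_i F i) x by rewrite -TF.
  have [j _ Gy] : (\bigcup_i G i) y by rewrite -TG.
  exists (maxn i j) => //; split.
    by move: x Fx; exact/subsetPset/ndF/leq_maxl.
  by move: y Gy; exact/subsetPset/ndG/leq_maxr.
move=> k; have [mF Fk] := Foo k; have [mG Gk] := Goo k.
split; first exact: measurableX.
by rewrite product_measure1E// lte_mul_pinfty// ge0_fin_numE.
Qed.

(** Each step takes the image of [leb \x m] under [consrV], and Tonelli turns its integral into the
    nested one. Sigma-finiteness is carried along because the next product needs it. *)
Lemma ex_rV_measure n : exists m : {sigma_finite_measure set (mrV n) -> \bar R},
  forall f : mrV n -> \bar R, measurable_fun setT f -> (forall x, 0 <= f x) ->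
  integral_rV f = \int[m]_x f x.
Proof.
elim: n => [|n [m IH]].
  exists (dirac (0%R : mrV 0)) => f mf f0.
  by rewrite integral_dirac//= diracT mul1e.
have mc := @measurable_consrV n.
pose M : {measure set (mrV n.+1) -> \bar R} :=
  measure_function_pushforward__canonical__measure_function_Measure (leb \x m) mc.
have sM : sigma_finite setT M.
  have [F TF Fm] := product_sigma_finite leb m.
  exists (fun k => @unconsrV n @^-1` F k).
    by rewrite -preimage_bigcup -TF preimage_setT.
  move=> k; have [mF Ff] := Fm k; split.
    rewrite -[X in measurable X]setTI.
    exact: measurable_unconsrV.
  rewrite /= /pushforward -comp_preimage (_ : _ \o _ = id) ?preimage_id//.
  by apply/funext => x /=; rewrite consrVK.
pose M' : {sigma_finite_measure set (mrV n.+1) -> \bar R} :=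
  HB.pack (M : set _ -> _) (Measure.class M) (Measure_isSigmaFinite.Build _ _ _ M sM).
exists M' => f mf f0.
rewrite integral_rVS.
rewrite (_ : \int[M']_x f x = \int[pushforward (leb \x m) (@consrV n)]_x f x)//.
rewrite (ge0_integral_pushforward mc)//.
rewrite preimage_setT.
have mfc : measurable_fun setT (f \o @consrV n) by exact: measurableT_comp.
rewrite (fubini_tonelli1 _ mfc (fun z => f0 (consrV z))).
apply: eq_integral => t _; rewrite IH//.
by apply: (measurableT_comp mfc); exact: measurable_pair1.
Qed.

Definition rV_measure n := sval (cid (ex_rV_measure n)).
Local Notation mu := rV_measure.

Lemma integral_rVE n (f : mrV n -> \bar R) :
  measurable_fun setT f -> (forall x, 0 <= f x) ->
  integral_rV f = \int[mu n]_x f x.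
Proof. exact: (svalP (cid (ex_rV_measure n))). Qed.

End rV_measure.

(** * Affine changes of variables *)

Section affine_lebesgue.
Context {R : realType}.
Local Notation mR := (measurableTypeR R).
Local Notation leb := (@lebesgue_measure R).
Local Open Scope ereal_scope.

Lemma measurable_affine (a b : R) :
  measurable_fun setT (fun t : mR => (a * t + b)%R : mR).
Proof. by apply: measurable_funD => //; apply: measurable_funM. Qed.

(** Lebesgue measure is determined by its values on the intervals []u, v]]. For negative [a] the
    preimage of such an interval is closed at the other end, which leaves its length unchanged. *)
Lemma lebesgue_measure_affine (a b : R) (A : set mR) : (a != 0)%R -> measurable A ->
  leb A = `|a|%:E * leb ((fun t => (a * t + b)%R) @^-1` A).
Proof.
move=> a0 mA.
have a_gt0 : (0 < `|a|)%R by rewrite normr_gt0.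
pose M : {measure set mR -> \bar R} :=
  measure_function_pushforward__canonical__measure_function_Measure
    leb (measurable_affine a b).
pose M' : {measure set mR -> \bar R} := mscale (NngNum (normr_ge0 a)) M.
rewrite [RHS](_ : _ = M' A)//; apply: lebesgue_measure_unique => // _ [[u v]] /= _ <-.
rewrite /M' /= /mscale /= /pushforward.
have [an|ap|a_0] := ltgtP a 0%R; last by rewrite a_0 eqxx in a0.
- rewrite (_ : _ @^-1` _ = `[((v - b) / a)%R, ((u - b) / a)%R[%classic); last first.
    apply/seteqP; split => x /=; rewrite !in_itv /= ler_ndivrMr// ltr_ndivlMr//
      [(x * a)%R]mulrC ltrBlDr lerBrDr.
      by move=> /andP[-> ->].
    by move=> /andP[-> ->].
  rewrite !lebesgue_measure_itv /= !lte_fin ltr_nM2r ?invr_lt0// ltrD2r.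
  case: ifPn => uv; last by rewrite mule0.
  rewrite -!EFinD -EFinM ltr0_norm//; congr EFin; by field.
- rewrite (_ : _ @^-1` _ = `]((u - b) / a)%R, ((v - b) / a)%R]%classic); last first.
    apply/seteqP; split => x /=; rewrite !in_itv /= ler_pdivlMr// ltr_pdivrMr//
      [(x * a)%R]mulrC ltrBlDr lerBrDr.
      by move=> /andP[-> ->].
    by move=> /andP[-> ->].
  rewrite !lebesgue_measure_itv /= !lte_fin ltr_pM2r ?invr_gt0// ltrD2r.
  case: ifPn => uv; last by rewrite mule0.
  rewrite -!EFinD -EFinM gtr0_norm//; congr EFin; by field.
Qed.

Lemma ge0_integral_affine (a b : R) (f : mR -> \bar R) : (a != 0)%R ->
  measurable_fun setT f -> (forall t, 0 <= f t) ->
  \int[leb]_t f t = `|a|%:E * \int[leb]_t f (a * t + b)%R.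
Proof.
move=> a0 mf f0.
pose M : {measure set mR -> \bar R} :=
  measure_function_pushforward__canonical__measure_function_Measure
    leb (measurable_affine a b).
pose M' : {measure set mR -> \bar R} := mscale (NngNum (normr_ge0 a)) M.
rewrite (eq_measure_integral M'); last first.
  by move=> A mA _; exact: (lebesgue_measure_affine b a0 mA).
rewrite ge0_integral_mscale//=; congr (_ * _).
by rewrite (ge0_integral_pushforward (measurable_affine a b))// preimage_setT.
Qed.

End affine_lebesgue.

Section rV_measure_theory.
Context {R : realType}.
Local Notation mR := (measurableTypeR R).
Local Notation leb := (@lebesgue_measure R).
Local Notation mu := (@rV_measure R).
Local Notation mrV := (@mrV R).
Local Open Scope ereal_scope.

Lemma ge0_integral_muS n (f : mrV n.+1 -> \bar R) :
  measurable_fun setT f -> (forall x, 0 <= f x) ->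
  \int[mu n.+1]_x f x = \int[leb]_t \int[mu n]_x f (consrV (t, x)).
Proof.
move=> mf f0; rewrite -integral_rVE// integral_rVS.
apply: eq_integral => t _; rewrite integral_rVE//.
apply: (measurableT_comp mf); apply: (measurableT_comp (@measurable_consrV R n)).
exact: measurable_pair1.
Qed.

(** Integrating over the first coordinate innermost is the order that suits [shear_out], where this
    coordinate is translated while the others stay fixed. *)
Lemma ge0_integral_muS2 n (f : mrV n.+1 -> \bar R) :
  measurable_fun setT f -> (forall x, 0 <= f x) ->
  \int[mu n.+1]_x f x = \int[mu n]_x \int[leb]_t f (consrV (t, x)).
Proof.
move=> mf f0; rewrite ge0_integral_muS//.
have mfc := measurableT_comp mf (@measurable_consrV R n).
exact: (fubini_tonelli (f \o @consrV R n) mfc (fun z => f0 (consrV z))).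
Qed.

Lemma measurable_mulmx n m (A : 'M[R]_(n, m)) :
  measurable_fun setT (fun x : mrV n => (x : 'rV_n) *m A : mrV m).
Proof.
apply: measurable_rVP => i; under eq_fun do rewrite mxE.
apply: measurable_sum => j; apply: measurable_funM => //.
exact: measurable_coord.
Qed.

Lemma measurable_translate n (c : 'rV[R]_n) :
  measurable_fun setT (fun x : mrV n => (x : 'rV_n) + c : mrV n)%R.
Proof.
apply: measurable_rVP => i; under eq_fun do rewrite mxE.
by apply: measurable_funD => //; exact: measurable_coord.
Qed.

Lemma measurable_comp_mulmx n m (A : 'M[R]_(n, m)) (f : mrV m -> \bar R) :
  measurable_fun setT f ->
  measurable_fun setT (fun x : mrV n => f ((x : 'rV_n) *m A)).
Proof. by move=> mf; exact: (measurableT_comp mf (@measurable_mulmx _ _ A)). Qed.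

Lemma measurable_comp_translate n (c : 'rV[R]_n) (f : mrV n -> \bar R) :
  measurable_fun setT f ->
  measurable_fun setT (fun x : mrV n => f ((x : 'rV_n) + c)%R).
Proof. by move=> mf; exact: (measurableT_comp mf (@measurable_translate _ c)). Qed.

Lemma measurable_pairing n (v : 'rV[R]_n) :
  measurable_fun setT (fun x : mrV n => pairing v x : mR).
Proof.
apply: measurable_sum => j; apply: measurable_funM => //.
exact: measurable_coord.
Qed.

Lemma ge0_integral_translate n (c : 'rV[R]_n) (f : mrV n -> \bar R) :
  measurable_fun setT f -> (forall x, 0 <= f x) ->
  \int[mu n]_x f x = \int[mu n]_x f ((x : 'rV_n) + c)%R.
Proof.
elim: n c f => [|n IH] c f mf f0.
  by apply: eq_integral => x _; congr f; apply/rowP => -[].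
rewrite (ge0_integral_muS mf f0).
rewrite (ge0_integral_muS (measurable_comp_translate c mf) (fun x => f0 _)).
have mfc := measurableT_comp mf (@measurable_consrV R n).
rewrite (ge0_integral_affine (c ord0 ord0) (oner_neq0 R)); last 2 first.
- exact: (measurable_fun_fubini_tonelli_F _ mfc (fun z => f0 (consrV z))).
- by move=> t; exact: integral_ge0.
rewrite normr1 mul1e; apply: eq_integral => t _.
rewrite (IH (\row_i c ord0 (lift ord0 i))%R)//; last first.
  by apply: (measurableT_comp mfc); exact: measurable_pair1.
apply: eq_integral => x _; congr f; apply/rowP => i.
rewrite [RHS]mxE; case: (unliftP ord0 i) => [j|] ->.
  by rewrite !consrVS !mxE.
by rewrite !consrV0 mul1r.
Qed.

Local Close Scope ereal_scope.
Local Open Scope ring_scope.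

(** Right multiplication by [shear_out w] translates the first coordinate by an amount depending on
    the others only; [shear_in] does the reverse. Once the parameter is fixed each is a translation,
    hence preserves the measure. *)
Definition shear_out n (w : 'cV[R]_n) : 'M[R]_n.+1 :=
  (block_mx 1%:M 0 w 1%:M : 'M[R]_(1 + n))%R.
Definition shear_in n (c : 'rV[R]_n) : 'M[R]_n.+1 :=
  (block_mx 1%:M c 0 1%:M : 'M[R]_(1 + n))%R.

Lemma consrVE n t (x : 'rV[R]_n) : consrV (t, x) = row_mx t%:M%R x :> 'rV_(1 + n).
Proof. by []. Qed.

Lemma consrV_shear_out n (w : 'cV[R]_n) t (x : 'rV[R]_n) :
  (consrV (t, x) : 'rV_n.+1) *m shear_out w =
  consrV ((t + (x *m w) ord0 ord0)%R, x).
Proof.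
rewrite consrVE /shear_out (@mul_row_block _ 1 1 n 1 n) consrVE !mulmx1 mulmx0.
by rewrite add0r [x *m w]mx11_scalar -raddfD/= -mx11_scalar.
Qed.

Lemma consrV_shear_in n (c : 'rV[R]_n) t (x : 'rV[R]_n) :
  (consrV (t, x) : 'rV_n.+1) *m shear_in c = consrV (t, (x + t *: c)%R).
Proof.
rewrite consrVE /shear_in (@mul_row_block _ 1 1 n 1 n) consrVE !mulmx1 mulmx0.
by rewrite addr0 mul_scalar_mx addrC.
Qed.

Lemma consrV_diag n (a : R) (A : 'M[R]_n) t (x : 'rV[R]_n) :
  (consrV (t, x) : 'rV_n.+1) *m (block_mx a%:M 0 0 A : 'M[R]_(1 + n))%R =
  consrV ((t * a)%R, x *m A).
Proof.
rewrite consrVE (@mul_row_block _ 1 1 n 1 n) consrVE !mulmx0 addr0 add0r.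
by rewrite -scalar_mxM.
Qed.

Local Open Scope ereal_scope.

Definition scales_measure n (A : 'M[R]_n) := forall f : mrV n -> \bar R,
  measurable_fun setT f -> (forall x, 0 <= f x) ->
  \int[mu n]_x f x = `|\det A|%:E * \int[mu n]_x f ((x : 'rV_n) *m A).

Lemma scales_measureM n (A B : 'M[R]_n) :
  scales_measure A -> scales_measure B -> scales_measure (A *m B).
Proof.
move=> hA hB f mf f0; rewrite hB// hA//; last first.
  exact: measurable_comp_mulmx.
rewrite det_mulmx normrM EFinM muleA [in LHS](muleC `|\det B|%:E).
by under [in RHS]eq_integral do rewrite mulmxA.
Qed.

Lemma det_shear_out n (w : 'cV[R]_n) : (\det (shear_out w) = 1)%R.
Proof. by rewrite /shear_out (@det_lblock _ 1 n) !det1 mulr1. Qed.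

Lemma det_shear_in n (c : 'rV[R]_n) : (\det (shear_in c) = 1)%R.
Proof. by rewrite /shear_in (@det_ublock _ 1 n) !det1 mulr1. Qed.

Lemma scales_shear_out n (w : 'cV[R]_n) : scales_measure (shear_out w).
Proof.
move=> f mf f0; rewrite det_shear_out normr1 mul1e.
have mfA := measurable_comp_mulmx (shear_out w) mf.
have mfc := measurableT_comp mf (@measurable_consrV R n).
rewrite (ge0_integral_muS2 mf f0) (ge0_integral_muS2 mfA (fun x => f0 _)).
apply: eq_integral => x _.
rewrite (ge0_integral_affine (((x : 'rV_n) *m w)%R ord0 ord0) (oner_neq0 R))//.
  rewrite normr1 mul1e; apply: eq_integral => t _.
  by rewrite consrV_shear_out mul1r.
exact: (measurableT_comp mfc (measurable_pair2 _)).
Qed.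

Lemma scales_shear_in n (c : 'rV[R]_n) : scales_measure (shear_in c).
Proof.
move=> f mf f0; rewrite det_shear_in normr1 mul1e.
have mfA := measurable_comp_mulmx (shear_in c) mf.
have mfc := measurableT_comp mf (@measurable_consrV R n).
rewrite (ge0_integral_muS mf f0) (ge0_integral_muS mfA (fun x => f0 _)).
apply: eq_integral => t _.
rewrite (ge0_integral_translate (t *: c)%R)//.
  by apply: eq_integral => x _; rewrite consrV_shear_in.
exact: (measurableT_comp mfc (measurable_pair1 _)).
Qed.

Definition diag1_block n (a : R) (A : 'M[R]_n) : 'M[R]_n.+1 :=
  (block_mx a%:M 0 0 A : 'M[R]_(1 + n))%R.

Lemma scales_diag n (a : R) (A : 'M[R]_n) : (a != 0)%R ->
  scales_measure A -> scales_measure (diag1_block a A).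
Proof.
move=> a0 sA f mf f0.
rewrite /diag1_block (@det_ublock _ 1 n) det_scalar1 -/(diag1_block a A).
have mfA := measurable_comp_mulmx (diag1_block a A) mf.
have mfc := measurableT_comp mf (@measurable_consrV R n).
have mfAc := measurableT_comp mfA (@measurable_consrV R n).
rewrite (ge0_integral_muS mf f0) (ge0_integral_muS mfA (fun x => f0 _)).
rewrite (ge0_integral_affine 0 a0); last 2 first.
- exact: (measurable_fun_fubini_tonelli_F _ mfc (fun z => f0 (consrV z))).
- by move=> t; exact: integral_ge0.
rewrite normrM EFinM -muleA; congr (_ * _).
rewrite -ge0_integralZl//=.
- apply: eq_integral => t _; rewrite sA//.
    by congr (_ * _); apply: eq_integral => x _; rewrite consrV_diag addr0 mulrC.
  exact: (measurableT_comp mfc (measurable_pair1 _)).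
- exact: (measurable_fun_fubini_tonelli_F _ mfAc (fun z => f0 _)).
- by move=> t _; exact: integral_ge0.
Qed.

Lemma scales1 n : scales_measure (1%:M%R : 'M[R]_n).
Proof.
by move=> f mf f0; rewrite det1 normr1 mul1e; under [RHS]eq_integral do rewrite mulmx1.
Qed.

Local Close Scope ereal_scope.
Local Open Scope ring_scope.

Lemma shear_outS n (w : 'cV[R]_n) i : shear_out w (lift ord0 i) ord0 = w i ord0.
Proof.
rewrite /shear_out !mxE; case: splitP => [j|k /=]; first by rewrite (ord1 j).
rewrite /bump leq0n !add1n => -[/val_inj <-]; rewrite !mxE.
by case: splitP => // j _; rewrite (ord1 j).
Qed.

(** Block elimination at the corner entry, [B] being the Schur complement of the pivot [a]. If the
    corner entry is zero, some other entry of the first row is not, and adding its column to the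
    first one, again a [shear_out], creates a pivot; this takes the place of a permutation. *)
Lemma shear_decomposition n (A : 'M[R]_n.+1) : \det A != 0 ->
  exists a (B : 'M[R]_n) (u w : 'cV[R]_n) (c : 'rV[R]_n),
    [/\ a != 0, \det B != 0 &
        A = shear_out u *m diag1_block a B *m shear_in c *m shear_out w].
Proof.
move=> dA.
have [w Aw] : exists w : 'cV[R]_n, (A *m shear_out w) ord0 ord0 != 0.
  have /rV0Pn[j Aj] : row ord0 A != 0.
    apply: contra_neq dA => A0; apply/eqP/det0P; exists (delta_mx ord0 ord0).
      by apply/rV0Pn; exists ord0; rewrite mxE !eqxx oner_eq0.
    by rewrite -rowE.
  have [A0|A0] := eqVneq (A ord0 ord0) 0; last first.
    by exists 0; rewrite /shear_out -(@scalar_mx_block _ 1 n) mulmx1.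
  have [i ji|j0] := unliftP ord0 j; last by rewrite mxE j0 A0 eqxx in Aj.
  exists (delta_mx i ord0); rewrite mxE big_ord_recl A0 mul0r add0r.
  rewrite (bigD1 i)//= big1 ?addr0.
    by rewrite shear_outS mxE !eqxx mulr1; move: Aj; rewrite ji mxE.
  by move=> k ki; rewrite shear_outS mxE (negbTE ki) mulr0.
set A' := A *m shear_out w in Aw.
have AE : A = A' *m shear_out (- w).
  rewrite /A' -mulmxA /shear_out (@mulmx_block _ 1 n 1 n 1 n).
  by rewrite !mulmx1 !mul1mx !mulmx0 !mul0mx !addr0 !add0r subrr -(@scalar_mx_block _ 1 n) mulmx1.
pose M : 'M[R]_(1 + n) := A'.
pose a := A' ord0 ord0.
have ulM : ulsubmx M = a%:M.
  rewrite [LHS]mx11_scalar; congr (_%:M); rewrite [LHS]mxE [LHS]mxE.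
  by congr (A' _ _); exact/val_inj.
exists a, (drsubmx M - a^-1 *: (dlsubmx M *m ursubmx M)), (a^-1 *: dlsubmx M), (- w), (a^-1 *: ursubmx M).
have A'E : A' = shear_out (a^-1 *: dlsubmx M) *m
   diag1_block a (drsubmx M - a^-1 *: (dlsubmx M *m ursubmx M)) *m shear_in (a^-1 *: ursubmx M).
  rewrite /shear_out /diag1_block /shear_in !(@mulmx_block _ 1 n 1 n 1 n).
  rewrite !mulmx1 !mul1mx !mulmx0 !mul0mx !addr0 !add0r.
  rewrite mul_mx_scalar mul_scalar_mx !scalerA divff// !scale1r.
  by rewrite -scalemxAr addrC subrK -ulM submxK.
split => //; last by rewrite -A'E.
have : \det A' != 0 by rewrite det_mulmx det_shear_out mulr1.
apply: contraNneq => B0; rewrite A'E !det_mulmx.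
by rewrite /diag1_block (@det_ublock _ 1 n) B0 mulr0 mulr0 mul0r.
Qed.

Local Open Scope ereal_scope.

Lemma ge0_integral_mulmx n (A : 'M[R]_n) : (\det A != 0)%R -> scales_measure A.
Proof.
elim: n A => [|n IH] A dA.
  rewrite (_ : A = 1%:M%R); first exact: scales1.
  by apply/matrixP => -[].
have [a [B [u [w [c [a0 dB ->]]]]]] := shear_decomposition dA.
do 3?[apply: scales_measureM].
- exact: scales_shear_out.
- exact: scales_diag (IH _ dB).
- exact: scales_shear_in.
- exact: scales_shear_out.
Qed.

Lemma ge0_integral_affine_mx n (A : 'M[R]_n) (c : 'rV[R]_n) (f : mrV n -> \bar R) :
  (\det A != 0)%R -> measurable_fun setT f -> (forall x, 0 <= f x) ->
  \int[mu n]_x f x = `|\det A|%:E * \int[mu n]_x f ((x : 'rV_n) *m A + c)%R.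
Proof.
move=> dA mf f0; rewrite (ge0_integral_translate c mf f0).
by rewrite (ge0_integral_mulmx dA (measurable_comp_translate c mf))//.
Qed.

End rV_measure_theory.

(** * Boxes, hyperplanes and integrals of signed functions *)

Section bounded_sets.
Context {R : realType}.
Local Notation mR := (measurableTypeR R).
Local Notation leb := (@lebesgue_measure R).
Local Notation mu := (@rV_measure R).
Local Notation mrV := (@mrV R).

Definition box n (c : 'rV[R]_n) (e : R) : set (mrV n) :=
  [set x : 'rV[R]_n | forall i, `|x ord0 i - c ord0 i| <= e].

Lemma measurable_ler_fun d (T : measurableType d) (f g : T -> mR) :
  measurable_fun setT f -> measurable_fun setT g ->
  measurable [set x | f x <= g x].
Proof.
move=> mf mg; rewrite -[X in measurable X]setTI.
have := measurable_fun_ler mf mg measurableT (Y := [set true]).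
by apply; exact: I.
Qed.

Lemma measurable_box n c e : measurable (@box n c e).
Proof.
rewrite (_ : box c e = \bigcap_(i in [set: 'I_n])
   [set x : mrV n | `|(x : 'rV_n) ord0 i - c ord0 i| <= e]); last first.
  by apply/seteqP; split => x /= h i; [move=> _; exact: h|exact: (h i)].
apply: fin_bigcap_measurable => // i _.
apply: measurable_ler_fun => //.
apply: measurableT_comp => //.
by apply: measurable_funB => //; exact: measurable_coord.
Qed.

Local Open Scope ereal_scope.

Lemma volumeE n (A : set (mrV n)) : measurable A -> volume A = mu n A.
Proof.
move=> mA; rewrite /volume integral_rVE//.
- by rewrite integral_indic// setIT.
- by apply/measurable_EFinP; exact: measurable_indic.
Qed.

Lemma measure_integral_indic n (A : set (mrV n)) : measurable A ->
  mu n A = \int[mu n]_x (\1_A x)%:E.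
Proof. by move=> mA; rewrite integral_indic// setIT. Qed.

Lemma measurable_indic_EFin n (A : set (mrV n)) : measurable A ->
  measurable_fun setT (fun x : mrV n => (\1_A x : R)%:E).
Proof. by move=> mA; apply/measurable_EFinP; exact: measurable_indic. Qed.

Lemma measure_box n (c : 'rV[R]_n) (e : R) : (0 <= e)%R ->
  mu n (box c e) = ((2 * e) ^+ n)%:E.
Proof.
move=> e0; elim: n c => [|n IH] c.
  rewrite -volumeE ?expr0; last exact: measurable_box.
  by rewrite /volume /= indicE mem_set ?mulr1n//; case.
rewrite measure_integral_indic; last exact: measurable_box.
rewrite (ge0_integral_muS (measurable_indic_EFin (@measurable_box _ c e)))//.
pose c' : 'rV[R]_n := (\row_i c ord0 (lift ord0 i))%R.
pose I := [set t : mR | (`|t - c ord0 ord0| <= e)%R].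
have mI : measurable I.
  apply: measurable_ler_fun => //; apply: measurableT_comp => //.
  exact: measurable_funB.
have boxE t (x : mrV n) : \1_(box c e) (consrV (t, x)) = (\1_I t * \1_(box c' e) x : R)%R.
  rewrite !indicE -natrM mulnb; congr (_%:R); congr nat_of_bool.
  apply/idP/andP.
    move=> /set_mem h; split; apply/mem_set => /=.
      by have := h ord0; rewrite consrV0.
    by move=> i; have := h (lift ord0 i); rewrite consrVS mxE.
  move=> [/set_mem h /set_mem h'].
  apply/mem_set => i; have [j ->|->] := unliftP ord0 i.
    by have := h' j; rewrite mxE consrVS.
  by rewrite consrV0.
transitivity (\int[leb]_t ((\1_I t)%:E * (((2 * e) ^+ n)%R)%:E)).
  apply: eq_integral => t _.
  under eq_integral do rewrite boxE EFinM.
  rewrite ge0_integralZl//; last by apply: measurable_indic_EFin; apply: measurable_box.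
  by rewrite -measure_integral_indic ?IH//; exact: measurable_box.
rewrite ge0_integralZr//; last 2 first.
- by apply/measurable_EFinP; exact: measurable_indic.
- by rewrite lee_fin exprn_ge0// mulr_ge0.
rewrite integral_indic// setIT.
rewrite (_ : I = `[(c ord0 ord0 - e)%R, (c ord0 ord0 + e)%R]%classic); last first.
  by apply/seteqP; split => t; rewrite /I /= in_itv/= ler_distl.
rewrite [X in X * _](_ : _ = leb `[(c ord0 ord0 - e)%R, (c ord0 ord0 + e)%R]%classic)//.
rewrite lebesgue_measure_itv/= lte_fin ltrBlDr -addrA -{1}(addr0 (c _ _)) ltrD2l.
rewrite exprS EFinM; congr (_ * _).
case: ltP => [_|]; first by rewrite -EFinD; congr EFin; ring.
by rewrite -[(e + e)%R]mulr2n pmulrn_lle0// => e0'; rewrite (@le_anti _ _ e 0%R) ?mulr0// e0 e0'.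
Qed.

Lemma measure_box_gt0 n (A : set (mrV n)) c e : measurable A -> (0 < e)%R ->
  box c e `<=` A -> 0 < mu n A.
Proof.
move=> mA e0 bA; apply: (@lt_le_trans _ _ (mu n (box c e))).
  by rewrite measure_box ?ltW// lte_fin exprn_gt0// mulr_gt0.
by apply: le_measure => //; rewrite inE//; exact: measurable_box.
Qed.

Lemma measure_box_lty n (A : set (mrV n)) c e : measurable A -> (0 <= e)%R ->
  A `<=` box c e -> mu n A < +oo.
Proof.
move=> mA e0 bA; apply: (@le_lt_trans _ _ (mu n (box c e))).
  by apply: le_measure => //; rewrite inE//; exact: measurable_box.
by rewrite measure_box// ltry.
Qed.

Lemma measurable_hyperplane n (v : 'rV[R]_n) b :
  measurable ([set x | pairing v x = b] : set (mrV n)).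
Proof.
rewrite -[X in measurable X]setTI.
exact: (measurable_pairing v measurableT (measurable_set1 b)).
Qed.

Lemma pairing_consrV n (v : 'rV[R]_n.+1) t (x : 'rV[R]_n) :
  pairing v (consrV (t, x)) =
  (v ord0 ord0 * t + pairing (\row_i v ord0 (lift ord0 i)) x)%R.
Proof.
rewrite /pairing big_ord_recl consrV0; congr (_ + _)%R.
by apply: eq_bigr => i _; rewrite consrVS mxE.
Qed.

(** If the first entry of [v] is nonzero, each line in the first direction meets the hyperplane in a
    single point; otherwise every slice is a hyperplane one dimension lower. *)
Lemma measure_hyperplane n (v : 'rV[R]_n) b : v != 0%R ->
  mu n [set x | pairing v x = b] = 0.
Proof.
elim: n v b => [|n IH] v b v0.
  by case/eqP: v0; apply/rowP => -[].
have mH := measurable_hyperplane v b.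
rewrite (measure_integral_indic mH).
have [v00|v00] := eqVneq (v ord0 ord0) 0%R.
- rewrite (ge0_integral_muS (measurable_indic_EFin mH))//.
  pose v' := (\row_i v ord0 (lift ord0 i))%R.
  have v'0 : v' != 0%R.
    apply: contra_neq v0 => /rowP v'0; apply/rowP => i.
    have [j ->|->] := unliftP ord0 i; last by rewrite v00 mxE.
    by have := v'0 j; rewrite !mxE.
  apply: integral0_eq => t _.
  transitivity (\int[mu n]_x (\1_[set x | pairing v' x = b] x)%:E).
    apply: eq_integral => x _; rewrite !indicE; congr (_%:R%:E); congr nat_of_bool.
    apply/idP/idP => /set_mem /=; rewrite ?pairing_consrV ?v00 ?mul0r ?add0r => h;
      by apply/mem_set; rewrite /= ?pairing_consrV ?v00 ?mul0r ?add0r.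
  rewrite -measure_integral_indic ?IH//; exact: measurable_hyperplane.
- rewrite (ge0_integral_muS2 (measurable_indic_EFin mH))//.
  apply: integral0_eq => x _.
  pose t0 := ((b - pairing (\row_i v ord0 (lift ord0 i)) (x : 'rV_n)) / v ord0 ord0)%R.
  transitivity (\int[leb]_t (\1_[set t0] t)%:E).
    apply: eq_integral => t _; rewrite !indicE; congr (_%:R%:E); congr nat_of_bool.
    apply/idP/idP => /set_mem /=; rewrite ?pairing_consrV => h; apply/mem_set => /=.
      by rewrite /t0 -h addrK mulrC mulKf.
    by rewrite pairing_consrV h /t0 mulrC divfK// subrK.
  rewrite integral_indic//.
  by rewrite setIT; exact: (lebesgue_measure_set1 t0).
Qed.

Lemma integral_affine_mx n (A : 'M[R]_n) (c : 'rV[R]_n) (f : mrV n -> \bar R) :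
  `|\det A|%R = 1%R -> measurable_fun setT f ->
  \int[mu n]_x f ((x : 'rV_n) *m A + c)%R = \int[mu n]_x f x.
Proof.
move=> dA mf.
have dA0 : (\det A != 0)%R by rewrite -normr_gt0 dA.
rewrite [LHS]integralE [RHS]integralE; congr (_ - _).
- rewrite (ge0_integral_affine_mx c dA0 (measurable_funepos mf))// dA mul1e.
  by apply: eq_integral => x _; rewrite !funeposE.
- rewrite (ge0_integral_affine_mx c dA0 (measurable_funeneg mf))// dA mul1e.
  by apply: eq_integral => x _; rewrite !funenegE.
Qed.

Lemma integral_muS n (f : mrV n.+1 -> \bar R) : measurable_fun setT f ->
  (mu n.+1).-integrable setT f ->
  \int[mu n.+1]_x f x = \int[leb]_t \int[mu n]_x f (consrV (t, x)).
Proof.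
move=> mf intf.
have ge0E (g : mrV n.+1 -> \bar R) : measurable_fun setT g -> (forall x, 0 <= g x) ->
    \int[mu n.+1]_x g x = \int[leb \x mu n]_z g (consrV z).
  move=> mg g0; rewrite (ge0_integral_muS mg g0).
  have mgc := measurableT_comp mg (@measurable_consrV R n).
  by rewrite (fubini_tonelli1 _ mgc (fun z => g0 (consrV z))).
have mfc := measurableT_comp mf (@measurable_consrV R n).
rewrite (@integral12_prod_meas1 _ _ _ _ _ _ _ (f \o @consrV R n)).
  rewrite [LHS]integralE [RHS]integralE; congr (_ - _).
    rewrite (ge0E _ (measurable_funepos mf))//.
    by apply: eq_integral => x _; rewrite !funeposE.
  rewrite (ge0E _ (measurable_funeneg mf))//.
  by apply: eq_integral => x _; rewrite !funenegE.
apply/integrableP; split => //.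
have /integrableP[_] := intf; rewrite ge0E//.
exact: measurableT_comp.
Qed.

End bounded_sets.

(** * Bounded functions of bounded support, barycenters, integrals under reflections *)

Section bounded_functions.
Context {R : realType}.
Local Notation mR := (measurableTypeR R).
Local Notation mu := (@rV_measure R).
Local Notation mrV := (@mrV R).
Local Notation box := (@box R).
Local Open Scope ereal_scope.

(** Unlike integrability, which Fubini gives for almost every slice only, this property passes to
    every slice, as the induction identifying the iterated integral requires. *)
Definition box_bounded n (f : mrV n -> mR) := exists C e : R,
  [/\ 0 <= C, 0 <= e & forall x, `|f x| <= C * \1_(box (0 : 'rV[R]_n) e) x]%R.

Lemma integrable_indic_box n (A : set (mrV n)) : measurable A -> mu n A < +oo ->
  (mu n).-integrable setT (fun x => (\1_A x)%:E).
Proof.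
move=> mA Aoo; apply/integrableP; split; first exact: measurable_indic_EFin.
under eq_integral do rewrite gee0_abs//.
by rewrite -measure_integral_indic.
Qed.

Lemma integrable_box_bounded n (f : mrV n -> mR) :
  measurable_fun setT f -> box_bounded f ->
  (mu n).-integrable setT (fun x => (f x)%:E).
Proof.
move=> mf [C [e [C0 e0 fC]]].
apply: (@le_integrable _ _ _ _ setT measurableT _
    (fun x => C%:E * (\1_(box (0 : 'rV[R]_n)%R e) x)%:E)).
- exact/measurable_EFinP.
- move=> x _ /=; rewrite lee_fin; apply: (le_trans (fC x)).
  by rewrite ler_norm.
- apply: integrableZl => //; apply: integrable_indic_box; first exact: measurable_box.
  by rewrite measure_box// ltry.
Qed.

Lemma box_consrV n (e : R) t (x : mrV n) :
  (box 0 e (consrV (t, x)) -> box 0 e x)%R.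
Proof. by move=> h i; have := h (lift ord0 i); rewrite consrVS !mxE. Qed.

Lemma integral_rV_box_bounded n (f : mrV n -> mR) :
  measurable_fun setT f -> box_bounded f ->
  integral_rV (fun x => (f x)%:E) = \int[mu n]_x (f x)%:E.
Proof.
elim: n f => [|n IH] f mf bf.
  have mF : measurable_fun setT (EFin \o f) by exact/measurable_EFinP.
  rewrite integralE.
  rewrite -(integral_rVE (measurable_funepos mF))//.
  rewrite -(integral_rVE (measurable_funeneg mF))//=.
  have := congr1 (fun h => h (0%R : mrV 0)) (funeposneg (EFin \o f)).
  by move=> /= ->.
rewrite integral_rVS integral_muS//; last 2 first.
- exact/measurable_EFinP.
- exact: integrable_box_bounded.
apply: eq_integral => t _; apply: (IH (fun x => f (consrV (t, x)))).
  apply: (measurableT_comp mf); apply: (measurableT_comp (@measurable_consrV R n)).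
  exact: measurable_pair1.
have [C [e [C0 e0 fC]]] := bf; exists C, e; split => // x.
apply: (le_trans (fC _)); apply: ler_wpM2l => //.
rewrite !indicE ler_nat; case: (boolP (_ \in _)) => // /set_mem/box_consrV/mem_set ->//.
Qed.

Lemma measurable_affine_indic n (u : 'rV[R]_n) (b : R) (Q : set (mrV n)) : measurable Q ->
  measurable_fun setT (fun x : mrV n => (pairing u x + b) * \1_Q x : mR)%R.
Proof.
move=> mQ; apply: measurable_funM; last exact: measurable_indic.
by apply: measurable_funD => //; exact: measurable_pairing.
Qed.

Lemma pairing_box n (u x : 'rV[R]_n) e : box 0%R e x ->
  (`|pairing u x| <= (\sum_i `|u ord0 i|) * e)%R.
Proof.
move=> bx; apply: (le_trans (ler_norm_sum _ _ _)); rewrite mulr_suml.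
apply: ler_sum => i _; rewrite normrM ler_wpM2l//.
by have := bx i; rewrite mxE subr0.
Qed.

Lemma box_bounded_affine_indic n (u : 'rV[R]_n) (b : R) (Q : set (mrV n)) e :
  (0 <= e)%R -> Q `<=` box 0%R e ->
  box_bounded (fun x : mrV n => (pairing u x + b) * \1_Q x : mR)%R.
Proof.
move=> e0 Qe; exists (((\sum_i `|u ord0 i|) * e) + `|b|)%R, e; split => //.
  by rewrite addr_ge0// mulr_ge0// sumr_ge0.
move=> x; rewrite normrM !indicE.
case: (boolP (x \in Q)) => [/set_mem Qx|_]; last first.
  by rewrite normr0 mulr0 mulr_ge0// addr_ge0// mulr_ge0// sumr_ge0.
rewrite mem_set; last exact: Qe.
rewrite normr1 !mulr1; apply: (le_trans (ler_normD _ _)); rewrite lerD2r.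
by apply: pairing_box; exact: Qe.
Qed.

Lemma integral_affine_barycenter n (u : 'rV[R]_n) (b : R) (Q : set (mrV n)) e :
  measurable Q -> (0 <= e)%R -> Q `<=` box 0%R e -> 0 < mu n Q ->
  \int[mu n]_x ((pairing u x + b) * \1_Q x)%:E =
  ((pairing u (barycenter Q) + b) * fine (mu n Q))%:E.
Proof.
move=> mQ e0 Qe Q0.
have Qoo : mu n Q < +oo by exact: measure_box_lty Qe.
have Qf : mu n Q \is a fin_num by rewrite ge0_fin_numE.
have coordE i : (fun x : mrV n => (x : 'rV_n) ord0 i * \1_Q x)%R =
    (fun x : mrV n => (pairing (delta_mx ord0 i) x + 0) * \1_Q x)%R.
  apply/funext => x; rewrite addr0; congr (_ * _)%R.
  rewrite /pairing (bigD1 i)//= big1 ?mxE ?eqxx ?mul1r ?addr0// => j ji.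
  by rewrite mxE (negbTE ji) andbF mul0r.
have mi i : measurable_fun setT (fun x : mrV n => (x : 'rV_n) ord0 i * \1_Q x : mR)%R.
  by rewrite coordE; exact: measurable_affine_indic.
have bi i : box_bounded (fun x : mrV n => (x : 'rV_n) ord0 i * \1_Q x : mR)%R.
  by rewrite coordE; exact: box_bounded_affine_indic Qe.
have inti i := integrable_box_bounded (mi i) (bi i).
have baryE i : \int[mu n]_x ((x : 'rV_n) ord0 i * \1_Q x)%:E =
    (barycenter Q ord0 i * fine (mu n Q))%:E.
  rewrite mxE volumeE// divfK; last by rewrite gt_eqF// fine_gt0// Q0 Qoo.
  rewrite fineK integral_rV_box_bounded//.
  exact: integrable_fin_num.
transitivity (\int[mu n]_x (\sum_(i < n) (u ord0 i)%:E * ((x : 'rV_n) ord0 i * \1_Q x)%:E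
                + b%:E * (\1_Q x)%:E)).
  apply: eq_integral => x _; rewrite mulrDl EFinD; congr (_ + _).
  rewrite /pairing mulr_suml -sumEFin; apply: eq_bigr => i _.
  by rewrite -mulrA EFinM.
rewrite integralD//; last 2 first.
- by apply: integrable_sum => // i _; exact: integrableZl.
- by apply: integrableZl => //; exact: integrable_indic_box.
rewrite integral_sum//; last by move=> i; exact: integrableZl.
rewrite integralZl//; last exact: integrable_indic_box.
rewrite -measure_integral_indic// mulrDl EFinD; congr (_ + _); last by rewrite EFinM fineK.
rewrite /pairing mulr_suml -sumEFin; apply: eq_bigr => i _.
by rewrite integralZl// baryE -EFinM mulrA.
Qed.

(* [phi] is odd under the volume-preserving involution [T], so twice the
   integral is that of [phi * (1_Q - 1_Q \o T)], which is nonnegative. *)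
Lemma integral_reflection n (u : 'rV[R]_n) (b : R) (A : 'M[R]_n) (c : 'rV[R]_n)
    (Q : set (mrV n)) e
    (phi := fun x : 'rV[R]_n => (pairing u x + b)%R)
    (T := fun x : 'rV[R]_n => (x *m A + c)%R) :
  measurable Q -> (0 <= e)%R -> Q `<=` box 0%R e ->
  `|\det A|%R = 1%R -> (forall x, phi (T x) = - phi x)%R ->
  (forall x, T (T x) = x) ->
  (forall x, (phi x < 0)%R -> Q x -> Q (T x)) ->
  0 <= \int[mu n]_x (phi x * \1_Q x)%:E /\
  (\int[mu n]_x (phi x * \1_Q x)%:E = 0 ->
   forall y d, (0 < d)%R -> (forall x, box y d x -> Q x /\ (d <= phi x)%R) ->
     exists2 x, box y d x & Q (T x)).
Proof.
move=> mQ e0 Qe dA phiT TT QT.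
set g := fun x : mrV n => (phi x * \1_Q x)%R : mR.
have mg : measurable_fun setT g by exact: measurable_affine_indic.
have ig : (mu n).-integrable setT (fun x => (g x)%:E).
  apply: integrable_box_bounded => //; exact: box_bounded_affine_indic Qe.
have mgE : measurable_fun setT (fun x => (g x)%:E) by exact/measurable_EFinP.
have gTE : \int[mu n]_x (g (T x))%:E = \int[mu n]_x (g x)%:E.
  exact: (integral_affine_mx c dA mgE).
have mT : measurable_fun setT (T : mrV n -> mrV n).
  exact: measurableT_comp (measurable_translate c) (measurable_mulmx A).
have mgT : measurable_fun setT (fun x : mrV n => g (T x)).
  exact: measurableT_comp mg mT.
have igT : (mu n).-integrable setT (fun x : mrV n => (g (T x))%:E).
  apply/integrableP; split; first exact/measurable_EFinP.
  have /integrableP[_] := ig.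
  rewrite -(integral_affine_mx c dA)//.
  exact: measurableT_comp.
have hE x : (g x + g (T x) = phi x * (\1_Q x - \1_Q (T x)))%R.
  by rewrite /g phiT mulNr -mulrBr.
have h0 x : (0 <= g x + g (T x))%R.
  rewrite hE !indicE; have [p0|p0|->] := ltgtP (phi x) 0%R; last by rewrite mul0r.
    case: (boolP (x \in Q)) => [/set_mem/(QT _ p0)/mem_set ->|_]; first by rewrite subrr mulr0.
    by rewrite sub0r mulr_le0// ?oppr_le0// ltW.
  case: (boolP (T x \in Q)) => [/set_mem QTx|_]; last by rewrite subr0 mulr_ge0// ltW.
  have : Q (T (T x)) by apply: QT => //; rewrite phiT oppr_lt0.
  by rewrite TT => /mem_set ->; rewrite subrr mulr0.
have sumE : \int[mu n]_x (g x)%:E + \int[mu n]_x (g x)%:E =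
    \int[mu n]_x (g x + g (T x))%:E.
  rewrite -{2}gTE -integralD//.
have gf : \int[mu n]_x (g x)%:E \is a fin_num by exact: integrable_fin_num.
have int0 : 0 <= \int[mu n]_x (g x)%:E.
  have : 0 <= \int[mu n]_x (g x + g (T x))%:E.
    by apply: integral_ge0 => x _; rewrite lee_fin.
  rewrite -sumE -(fineK gf) -EFinD !lee_fin; lra.
split => // I0 y d d0 yd; apply: contrapT => noT.
(* If no point of the box had its image in [Q], the nonnegative integrand would be at least [d] on
   the whole box, and its integral would be positive. *)
have : \int[mu n]_x (d * \1_(box y d) x)%:E <= \int[mu n]_x (g x + g (T x))%:E.
  apply: ge0_le_integral => //.
  - by move=> x _; rewrite lee_fin mulr_ge0// ltW.
  - apply/measurable_EFinP; apply: measurable_funM => //.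
    by apply: measurable_indic; exact: measurable_box.
  - by apply/measurable_EFinP; exact: measurable_funD.
  - move=> x _; rewrite lee_fin [X in (X <= _)%R]/= indicE.
    case: (boolP (x \in _)) => [/set_mem xb|_]; last by rewrite mulr0.
    have [Qx dx] := yd _ xb.
    rewrite hE !indicE (mem_set Qx) memNset ?subr0 ?mulr1// => QTx.
    by apply: noT; exists x.
rewrite -sumE I0 adde0.
have mb := @measurable_box R n y d.
have -> : \int[mu n]_x (d * \1_(box y d) x)%:E = d%:E * mu n (box y d).
  rewrite (measure_integral_indic mb) -ge0_integralZl//.
    exact: measurable_indic_EFin.
  by rewrite lee_fin ltW.
rewrite (measure_box y (ltW d0)) -EFinM lee_fin leNgt mulr_gt0// exprn_gt0//.
by rewrite mulr_gt0.
Qed.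

End bounded_functions.

(** * Pairings and finitely generated cones *)

Section pairing_theory.
Context {R : realType} {d : nat}.
Implicit Types x y z : 'rV[R]_d.

Lemma pairingC x y : pairing x y = pairing y x.
Proof. by apply: eq_bigr => i _; rewrite mulrC. Qed.

Lemma pairingDr x y z : pairing x (y + z) = pairing x y + pairing x z.
Proof. by rewrite -big_split; apply: eq_bigr => i _; rewrite mxE mulrDr. Qed.

Lemma pairingDl x y z : pairing (x + y) z = pairing x z + pairing y z.
Proof. by rewrite !(pairingC _ z) pairingDr. Qed.

Lemma pairingZr (a : R) x y : pairing x (a *: y) = a * pairing x y.
Proof. by rewrite /pairing mulr_sumr; apply: eq_bigr => i _; rewrite mxE mulrCA. Qed.

Lemma pairingZl (a : R) x y : pairing (a *: x) y = a * pairing x y.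
Proof. by rewrite pairingC pairingZr pairingC. Qed.

Lemma pairingNr x y : pairing x (- y) = - pairing x y.
Proof. by rewrite -scaleN1r pairingZr mulN1r. Qed.

Lemma pairingNl x y : pairing (- x) y = - pairing x y.
Proof. by rewrite pairingC pairingNr pairingC. Qed.

Lemma pairingBr x y z : pairing x (y - z) = pairing x y - pairing x z.
Proof. by rewrite pairingDr pairingNr. Qed.

Lemma pairingBl x y z : pairing (x - y) z = pairing x z - pairing y z.
Proof. by rewrite pairingDl pairingNl. Qed.

Lemma pairing0r x : pairing x 0 = 0.
Proof. by rewrite -(scale0r 0) pairingZr mul0r. Qed.

Lemma pairing0l x : pairing 0 x = 0.
Proof. by rewrite pairingC pairing0r. Qed.

Lemma pairing_sumr I (r : seq I) (P : pred I) (F : I -> 'rV[R]_d) x :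
  pairing x (\sum_(i <- r | P i) F i) = \sum_(i <- r | P i) pairing x (F i).
Proof. by apply: (big_morph _ (pairingDr x)); exact: pairing0r. Qed.

Lemma pairing_suml I (r : seq I) (P : pred I) (F : I -> 'rV[R]_d) x :
  pairing (\sum_(i <- r | P i) F i) x = \sum_(i <- r | P i) pairing (F i) x.
Proof. by rewrite pairingC pairing_sumr; apply: eq_bigr => i _; rewrite pairingC. Qed.

Lemma pairing_deltar x i : pairing x (delta_mx ord0 i) = x ord0 i.
Proof.
rewrite /pairing (bigD1 i)//= big1 ?addr0 ?mxE ?eqxx ?mulr1// => j ji.
by rewrite mxE (negbTE ji) andbF mulr0.
Qed.

Lemma pairing_mulmx x y : pairing x y = (x *m y^T) ord0 ord0.
Proof. by rewrite mxE; apply: eq_bigr => i _; rewrite mxE. Qed.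

Lemma pairingxx_gt0 x : x != 0 -> 0 < pairing x x.
Proof.
move=> x0; rewrite lt_neqAle sumr_ge0 ?andbT; last by move=> i _; rewrite -expr2 sqr_ge0.
apply: contra x0; rewrite eq_sym psumr_eq0; last by move=> i _; rewrite -expr2 sqr_ge0.
move=> /allP h; apply/eqP/rowP => i; rewrite mxE; apply/eqP.
by have := h i (mem_index_enum _); rewrite mulf_eq0 orbb.
Qed.

Lemma pairing_int x y : lattice x -> lattice y -> pairing x y \is a Num.int.
Proof. by move=> lx ly; apply: rpred_sum => i _; exact: rpredM. Qed.

Lemma lattice0 : lattice (0 : 'rV[R]_d).
Proof. by move=> i; rewrite mxE. Qed.

Lemma latticeD x y : lattice x -> lattice y -> lattice (x + y).
Proof. by move=> lx ly i; rewrite mxE rpredD. Qed.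

Lemma latticeZ (a : R) x : a \is a Num.int -> lattice x -> lattice (a *: x).
Proof. by move=> ia lx i; rewrite mxE rpredM. Qed.

Lemma latticeN x : lattice x -> lattice (- x).
Proof. by move=> lx i; rewrite mxE rpredN. Qed.

Lemma latticeB x y : lattice x -> lattice y -> lattice (x - y).
Proof. by move=> lx ly; apply: latticeD => //; exact: latticeN. Qed.

End pairing_theory.

Section pos_conv.
Context {R : realType} {d : nat}.
Implicit Types (x y z u v : 'rV[R]_d) (A B K : set 'rV[R]_d) (s : seq 'rV[R]_d).

Lemma pos_min A K : K 0 -> (forall x y, K x -> K y -> K (x + y)) ->
  (forall a x, 0 <= a -> K x -> K (a *: x)) -> A `<=` K -> pos A `<=` K.
Proof.
move=> K0 KD KZ AK x [n [a [v [a0 vA ->]]]].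
by apply: (big_ind K) => // i _; apply: KZ => //; exact: AK.
Qed.

Lemma sub_pos A : A `<=` pos A.
Proof.
move=> x Ax; exists 1%N, (fun=> 1), (fun=> x); split => //.
by rewrite big_ord1 scale1r.
Qed.

Lemma pos0 A : pos A 0.
Proof.
exists 0%N, (fun=> 0), (fun=> 0); split => //; last by rewrite big_ord0.
by case.
Qed.

Lemma posD A x y : pos A x -> pos A y -> pos A (x + y).
Proof.
move=> [n [a [v [a0 vA ->]]]] [m [b [w [b0 wA ->]]]].
exists (n + m)%N, (fun i => match fintype.split i with inl j => a j | inr j => b j end),
  (fun i => match fintype.split i with inl j => v j | inr j => w j end); split.
- by move=> i; case: fintype.split.
- by move=> i; case: fintype.split.
- rewrite big_split_ord /=; congr (_ + _); apply: eq_bigr => i _.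
    by have -> : fintype.split (lshift m i) = inl i by exact: (unsplitK (inl i)).
  by have -> : fintype.split (rshift n i) = inr i by exact: (unsplitK (inr i)).
Qed.

Lemma posZ A (c : R) x : 0 <= c -> pos A x -> pos A (c *: x).
Proof.
move=> c0 [n [a [v [a0 vA ->]]]]; exists n, (fun i => c * a i), v; split => //.
  by move=> i; rewrite mulr_ge0.
by rewrite scaler_sumr; apply: eq_bigr => i _; rewrite scalerA.
Qed.

Lemma pos_sub A B : A `<=` pos B -> pos A `<=` pos B.
Proof. by apply: pos_min; [exact: pos0|exact: posD|exact: posZ]. Qed.

Lemma pos1E v : pos [set v] = [set a *: v | a in [set a | 0 <= a]].
Proof.
apply/seteqP; split; last first.
  by move=> _ [a a0 <-]; apply: posZ => //; exact: sub_pos.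
apply: pos_min.
- by exists 0; rewrite /= ?scale0r.
- by move=> _ _ [a a0 <-] [b b0 <-]; exists (a + b); rewrite /= ?addr_ge0 ?scalerDl.
- by move=> c _ c0 [a a0 <-]; exists (c * a); rewrite /= ?mulr_ge0 ?scalerA.
- by move=> _ ->; exists 1; rewrite /= ?scale1r.
Qed.

Lemma pos_cons v s x :
  pos [set` v :: s] x <-> exists2 t, 0 <= t & pos [set` s] (x - t *: v).
Proof.
split; last first.
  move=> [t t0 sx]; rewrite -[x](subrK (t *: v)); apply: posD.
    by apply: pos_sub sx => y /= ys; apply: sub_pos; rewrite /= inE ys orbT.
  by apply: posZ => //; apply: sub_pos; rewrite /= mem_head.
apply: (@pos_min _ (fun x => exists2 t, 0 <= t & pos [set` s] (x - t *: v))).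
- by exists 0 => //; rewrite scale0r subr0; exact: pos0.
- move=> y z [a a0 ya] [b b0 zb]; exists (a + b); first exact: addr_ge0.
  by rewrite scalerDl opprD addrACA; exact: posD.
- move=> c y c0 [a a0 ya]; exists (c * a); first exact: mulr_ge0.
  by rewrite -scalerA -scalerBr; exact: posZ.
- move=> y /=; rewrite inE => /orP[/eqP ->|ys].
    by exists 1 => //; rewrite scale1r subrr; exact: pos0.
  by exists 0 => //; rewrite scale0r subr0; exact: sub_pos.
Qed.

Definition nonneg_on (l : seq 'rV[R]_d) : set 'rV[R]_d :=
  [set x | {in l, forall a, 0 <= pairing a x}].

(* Fourier-Motzkin elimination of the coefficient of one generator. *)
Lemma pos_finite_halfspaces s : exists l, pos [set` s] = nonneg_on l.
Proof.
elim: s => [|v s [l lE]].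
  exists ([seq delta_mx ord0 i | i : 'I_d] ++ [seq - delta_mx ord0 i | i : 'I_d]).
  apply/seteqP; split.
    apply: (@pos_min _ (nonneg_on _)) => //.
    - by move=> a _; rewrite pairing0r.
    - by move=> x y hx hy a al; rewrite pairingDr addr_ge0 ?hx ?hy.
    - by move=> c x c0 hx a al; rewrite pairingZr mulr_ge0 ?hx.
  move=> x h; rewrite (_ : x = 0); first exact: pos0.
  apply/rowP => i; rewrite mxE; apply: le_anti; apply/andP; split.
    have := h (- delta_mx ord0 i); rewrite pairingNl pairingC pairing_deltar oppr_ge0.
    by apply; rewrite mem_cat; apply/orP; right; apply/mapP; exists i => //; rewrite mem_enum.
  have := h (delta_mx ord0 i); rewrite pairingC pairing_deltar.
  by apply; rewrite mem_cat; apply/orP; left; apply/mapP; exists i => //; rewrite mem_enum.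
pose ge0 := [seq a <- l | 0 <= pairing a v].
pose neg := [seq a <- l | pairing a v < 0].
exists (ge0 ++ [seq pairing a v *: b - pairing b v *: a | a <- ge0, b <- neg]).
apply/seteqP; split => x.
  move=> /pos_cons[t t0]; rewrite lE => h a; rewrite mem_cat => /orP[].
    rewrite mem_filter => /andP[av al]; rewrite -[x](subrK (t *: v)) pairingDr.
    by rewrite addr_ge0 ?h// pairingZr mulr_ge0.
  move=> /allpairsP[[b c] /= []]; rewrite !mem_filter => /andP[bv bl] /andP[cv cl] ->.
  have := h _ bl; have := h _ cl; rewrite !pairingBr !pairingZr pairingBl !pairingZl => hc hb.
  rewrite -[X in 0 <= X](_ : pairing b v * (pairing c x - t * pairing c v)
     - pairing c v * (pairing b x - t * pairing b v) = _); last by ring.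
  by rewrite subr_ge0 (@le_trans _ _ 0)// ?mulr_ge0// nmulr_rle0.
move=> h; apply/pos_cons; rewrite lE.
have hge a : a \in l -> 0 <= pairing a v -> 0 <= pairing a x.
  by move=> al av; apply: h; rewrite mem_cat mem_filter av al.
have hlt a b : a \in l -> b \in l -> 0 <= pairing a v -> pairing b v < 0 ->
    pairing b v * pairing a x <= pairing a v * pairing b x.
  move=> al bl av bv; rewrite -subr_ge0.
  have := h (pairing a v *: b - pairing b v *: a).
  rewrite pairingBl !pairingZl; apply; rewrite mem_cat; apply/orP; right.
  by apply/allpairsP; exists (a, b) => /=; rewrite !mem_filter av al bv bl.
(* The inequalities negative on [v] bound the coefficient of [v] from below; [t] is the least value
   allowed by them and by nonnegativity. Each upper bound is then compared with the one lower bound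
   that attains [t]. *)
pose t := \big[Num.max/0]_(b <- neg) (pairing b x / pairing b v).
have t0 : 0 <= t by rewrite /t; elim/big_rec: _ => // i y _ y0; rewrite le_max y0 orbT.
exists t => // a al; rewrite pairingBr pairingZr subr_ge0.
have [av|av] := ltP (pairing a v) 0.
  rewrite -ler_ndivrMr// /t.
  have : a \in neg by rewrite mem_filter av.
  elim: (neg) => // b r IH; rewrite inE big_cons le_max => /orP[/eqP ->|/IH ->].
    by rewrite lexx.
  by rewrite orbT.
have tneg : t = 0 \/ exists2 b, b \in neg & t = pairing b x / pairing b v.
  rewrite /t; elim: (neg) => [|b r IH]; first by left; rewrite big_nil.
  rewrite big_cons; case: leP => _; last by right; exists b => //; exact: mem_head.
  case: IH => [|[c cr]] ->; first by left.
  by right; exists c => //; rewrite inE cr orbT.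
case: tneg => [->|[b]]; first by rewrite mul0r; exact: hge.
rewrite mem_filter => /andP[bv bl] ->.
by rewrite mulrAC ler_ndivrMr// mulrC [leRHS]mulrC; exact: hlt.
Qed.

End pos_conv.

(** * Convex hulls of finite sets *)

Section lift.
Context {R : realType} {d : nat}.
Implicit Types (x y z u v : 'rV[R]_d) (A B K : set 'rV[R]_d) (s : seq 'rV[R]_d).

(* Homogenization: [conv A] is the slice at height 1 of the cone over [A]. *)
Definition homog x : 'rV[R]_(1 + d) := row_mx 1%:M x.

Lemma pairing_homog (a : 'rV[R]_(1 + d)) x :
  pairing a (homog x) = lsubmx a ord0 ord0 + pairing (rsubmx a) x.
Proof.
rewrite -[a in LHS]hsubmxK !pairing_mulmx /homog tr_row_mx mul_row_col mxE trmx1 mulmx1.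
by [].
Qed.

Lemma homog_sum n (a : 'I_n -> R) (v : 'I_n -> 'rV[R]_d) :
  \sum_i a i *: homog (v i) = row_mx (\sum_i a i)%:M (\sum_i a i *: v i).
Proof.
apply/rowP => j; rewrite summxE mxE; case: (fintype.split_ordP j) => k ->.
  rewrite mxE (ord1 k) eqxx mulr1n; apply: eq_bigr => i _.
  by rewrite mxE row_mxEl mxE eqxx mulr1.
by rewrite summxE; apply: eq_bigr => i _; rewrite mxE row_mxEr mxE.
Qed.

Lemma conv_homog A x : conv A x <-> pos (homog @` A) (homog x).
Proof.
split=> [[n [a [v [a0 a1 vA ->]]]]|[n [a [w [a0 wA]]]]].
  exists n, a, (fun i => homog (v i)); split => //.
    by move=> i; exists (v i).
  by rewrite homog_sum a1.
have /boolp.choice[v vP] : forall i, exists v, A v /\ homog v = w i.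
  by move=> i; have [v Av <-] := wA i; exists v.
rewrite (eq_bigr (fun i => a i *: homog (v i))); last first.
  by move=> i _; have [_ ->] := vP i.
rewrite homog_sum => /eq_row_mx[a1 ->]; exists n, a, v; split => //.
  by have /matrixP/(_ ord0 ord0) := a1; rewrite !mxE.
by move=> i; have [] := vP i.
Qed.

Lemma sub_conv A : A `<=` conv A.
Proof. by move=> x Ax; apply/conv_homog; apply: sub_pos; exists x. Qed.

Lemma conv_sub A B : A `<=` conv B -> conv A `<=` conv B.
Proof.
move=> AB x /conv_homog Ax; apply/conv_homog; apply: (pos_sub _ Ax) => w [y Ay <-].
by apply/conv_homog; exact: AB.
Qed.

Lemma convS A B : A `<=` B -> conv A `<=` conv B.
Proof. by move=> AB; apply: conv_sub => x /AB; exact: sub_conv. Qed.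

Lemma conv_ge A u c x : (forall v, A v -> c <= pairing u v) -> conv A x ->
  c <= pairing u x.
Proof.
move=> uA [n [a [v [a0 a1 vA ->]]]]; rewrite pairing_sumr.
rewrite -[c]mul1r -a1 mulr_suml; apply: ler_sum => i _.
by rewrite pairingZr ler_wpM2l// uA.
Qed.

Lemma conv_pos A : conv A `<=` pos A.
Proof. by move=> x [n [a [v [a0 _ vA ->]]]]; exists n, a, v. Qed.

Lemma conv_nonempty A x : conv A x -> A !=set0.
Proof.
move=> [[|n] [a [v [_ a1 vA _]]]]; last by exists (v ord0).
by move: a1; rewrite big_ord0 => /esym/eqP; rewrite oner_eq0.
Qed.

Lemma conv_face A u c : (forall v, A v -> c <= pairing u v) ->
  conv A `&` [set x | pairing u x = c] = conv (A `&` [set x | pairing u x = c]).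
Proof.
move=> uA; apply/seteqP; split => x; last first.
  move=> xA; split; first by apply: convS xA => y [].
  apply: le_anti; rewrite (conv_ge uA (convS (@subIsetl _ _ _) xA)) andbT.
  rewrite -lerN2 -pairingNl; apply: (conv_ge _ xA) => v [_ /= <-].
  by rewrite pairingNl.
move=> [[n [a [v [a0 a1 vA xE]]]] /= ux].
have tight i : a i != 0 -> pairing u (v i) = c.
  move=> ai; apply/eqP; rewrite -subr_eq0.
  have : \sum_i a i * (pairing u (v i) - c) == 0.
    under eq_bigr do rewrite mulrBr.
    rewrite sumrB -mulr_suml a1 mul1r -ux xE pairing_sumr.
    by under eq_bigr do rewrite -pairingZr; rewrite subrr.
  rewrite psumr_eq0; last by move=> j _; rewrite mulr_ge0// subr_ge0 uA.
  by move=> /allP/(_ i (mem_index_enum _)); rewrite mulf_eq0 (negbTE ai).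
have [i0 ai0] : exists i, a i != 0.
  apply: contrapT => /forallNP h; have := a1; rewrite big1.
    by move=> /esym/eqP; rewrite oner_eq0.
  by move=> i _; have [//|ai] := eqVneq (a i) 0; case: (h i).
(* Generators of weight zero may lie off the hyperplane, so they are replaced by one that carries
   weight and hence lies on it. *)
exists n, a, (fun i => if a i == 0 then v i0 else v i); split => //.
  by move=> i; case: eqVneq => ai; split; rewrite /= ?tight.
rewrite xE; apply: eq_bigr => i _; case: eqVneq => // ->.
by rewrite !scale0r.
Qed.

Definition halfspaces (l : seq ('rV[R]_d * R)) : set 'rV[R]_d :=
  [set x | {in l, forall p, 0 <= pairing p.1 x + p.2}].

Lemma conv_finite_halfspaces s : exists l, conv [set` s] = halfspaces l.
Proof.
have [l lE] := pos_finite_halfspaces [seq homog v | v <- s].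
exists [seq (rsubmx a, lsubmx a ord0 ord0) | a <- l].
apply/seteqP; split => x.
  move=> /conv_homog; rewrite (_ : _ @` _ = [set` [seq homog v | v <- s]]).
    rewrite lE => h _ /mapP[a al ->] /=; rewrite addrC -pairing_homog; exact: h.
  by apply/seteqP; split => [_ [v vs <-]|_ /mapP[v vs ->]]; [exact: map_f|exists v].
move=> h; apply/conv_homog; rewrite (_ : _ @` _ = [set` [seq homog v | v <- s]]).
  rewrite lE => a al; rewrite pairing_homog addrC; apply: (h (_, _)).
  by apply/mapP; exists a.
by apply/seteqP; split => [_ [v vs <-]|_ /mapP[v vs ->]]; [exact: map_f|exists v].
Qed.

(** One of the inequalities describing the hull fails at [x], and it separates. *)
Lemma separation s x : ~ conv [set` s] x -> exists u c,
  pairing u x < c /\ forall v, v \in s -> c <= pairing u v.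
Proof.
have [l lE] := conv_finite_halfspaces s.
rewrite lE => /existsNP[[u b]] /not_implyP[pl /negP]; rewrite -ltNge/= => ux.
exists u, (- b); split; first by rewrite -subr_lt0 opprK.
move=> v vs; have : halfspaces l v by rewrite -lE; exact: sub_conv.
by move=> /(_ _ pl) /=; rewrite -lerBlDr sub0r.
Qed.

Lemma vertices_conv A : vertices (conv A) `<=` A.
Proof.
move=> v [u [c [uA]]].
rewrite conv_face; last by move=> w Aw; apply: uA; exact: sub_conv.
move=> vE; have : conv (A `&` [set x | pairing u x = c]) v by rewrite -vE.
move=> /conv_nonempty[w [Aw uw]].
have : [set v] w by rewrite vE; apply: sub_conv.
by move=> <-.
Qed.

(** A functional separating [v] from the hull of the other generators attains its minimum over [s]
    at [v] alone. *)
Lemma exposed_vertex s v : v \in s -> uniq s ->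
  ~ conv [set` rem v s] v -> exists u c,
  [/\ pairing u v = c, forall w, w \in s -> c <= pairing u w &
      forall w, w \in s -> pairing u w = c -> w = v].
Proof.
move=> vs us /separation[u [c [uv uc]]]; exists u, (pairing u v); split => // w ws.
  have [->//|wv] := eqVneq w v.
  by rewrite ltW// (lt_le_trans uv)// uc// mem_rem_uniq// inE wv.
move=> uw; apply: contrapT => /eqP wv.
by have := uc w; rewrite mem_rem_uniq// inE wv uw leNgt uv => /(_ ws).
Qed.

Lemma irredundant_subseq s : exists s', [/\ uniq s', {subset s' <= s},
  conv [set` s'] = conv [set` s] & forall v, v \in s' -> ~ conv [set` rem v s'] v].
Proof.
wlog us : s / uniq s.
  move=> h; have [s' [us' ss' cs' hs']] := h _ (undup_uniq s).
  exists s'; split => //; first by move=> v /ss'; rewrite mem_undup.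
  rewrite cs'; congr conv; apply/seteqP; split => v /=; by rewrite mem_undup.
have [n] := ubnP (size s); elim: n => // n IH in s us * => sn.
have [[v [vs cv]]|h] := pselect (exists v, v \in s /\ conv [set` rem v s] v); last first.
  exists s; split => // v vs cv; apply: h; by exists v.
have [] := IH (rem v s); first exact: rem_uniq.
  by rewrite size_rem// prednK ?(leq_trans _ sn)//; case: (s) vs.
move=> s' [us' ss' cs' hs']; exists s'; split => //.
  by move=> w /ss'/mem_rem.
rewrite cs'; apply/seteqP; split; first by apply: convS => w /= /mem_rem.
apply: conv_sub => w /= ws; have [->//|wv] := eqVneq w v.
by apply: sub_conv; rewrite /= mem_rem_uniq// inE wv.
Qed.

Lemma is_face_vertex s v u c : v \in s -> pairing u v = c ->
  (forall w, w \in s -> c <= pairing u w) ->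
  (forall w, w \in s -> pairing u w = c -> w = v) ->
  vertices (conv [set` s]) v.
Proof.
move=> vs uv us usv; exists u, c; split; first by move=> x; exact: conv_ge.
rewrite conv_face//; apply/seteqP; split => [_ ->|x]; first exact: sub_conv.
move=> [n [a [w [a0 a1 ws ->]]]] /=.
rewrite (eq_bigr (fun i => a i *: v)) ?scaler_suml -?scaler_suml ?a1 ?scale1r//.
by move=> i _; have [wi ui] := ws i; rewrite (usv _ wi ui).
Qed.

(** Once redundant generators are discarded, each remaining one is exposed and thus a vertex. *)
Lemma conv_vertices s : conv (vertices (conv [set` s])) = conv [set` s].
Proof.
have [s' [us' ss' cs' hs']] := irredundant_subseq s.
apply/seteqP; split; first by apply: convS; exact: vertices_conv.
rewrite -cs'; apply: convS => v /= vs.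
have [u [c [uv us usv]]] := exposed_vertex vs us' (hs' _ vs).
exact: is_face_vertex uv us usv.
Qed.

Lemma finite_vertices s : finite_set (vertices (conv [set` s])).
Proof. by apply: sub_finite_set (@vertices_conv _) _. Qed.

Lemma range_codom n (v : 'I_n -> 'rV[R]_d) : range v = [set` codom v].
Proof.
apply/seteqP; split => [_ [i _ <-]|_ /codomP[i ->]]; last by exists i.
exact: codom_f.
Qed.

End lift.

(** * Lattice points *)

Section integer_lemmas.
Context {R : realType}.

Lemma int_gt0_ge1 (x : R) : x \is a Num.int -> 0 < x -> 1 <= x.
Proof.
move=> ix x0; rewrite -(gtr0_norm x0).
by rewrite norm_intr_ge1// gt_eqF.
Qed.

Lemma int_gtN1_ge0 (x : R) : x \is a Num.int -> -1 < x -> 0 <= x.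
Proof.
move=> ix; rewrite -subr_gt0 opprK => x1.
have : 1 <= x + 1 by apply: int_gt0_ge1 => //; exact: (rpredD ix (rpred1 _)).
by rewrite lerDr.
Qed.

Lemma fsum_seq (I : choiceType) (V : nmodType) (A : set I) (r : seq I) (F : I -> V) :
  uniq r -> A = [set` r] -> \sum_(i \in A) F i = \sum_(i <- r) F i.
Proof. by move=> ur ->; rewrite -fsbig_seq. Qed.

Lemma finite_uniq_seq (I : choiceType) (A : set I) : finite_set A ->
  exists2 r : seq I, uniq r & A = [set` r].
Proof.
move=> /finite_seqP[s ->]; exists (undup s); first exact: undup_uniq.
by apply/seteqP; split => x /=; rewrite mem_undup.
Qed.

(** Nonnegative integers with sum 1 are a single 1 and zeros. This is applied to the normals, and
    also to all lattice points of the dual polytope. *)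
Lemma sum_eq0_single_neg (I : choiceType) (A : set I) (f : I -> R) i0 :
  finite_set A -> A i0 -> f i0 = -1 -> (forall i, A i -> f i \is a Num.int) ->
  (forall i, A i -> i <> i0 -> 0 <= f i) ->
  \sum_(i \in A) f i = 0 <->
  exists i1, [/\ A i1, f i1 = 1 & forall i, A i -> i <> i0 -> i <> i1 -> f i = 0].
Proof.
move=> /finite_uniq_seq[r ur AE] Ai0 fi0 fint f0; rewrite (fsum_seq _ ur AE).
have inA i : A i <-> i \in r by rewrite AE.
have i0r : i0 \in r by apply/inA.
rewrite (bigD1_seq i0)//= fi0; split.
  move=> /eqP; rewrite addrC subr_eq0 => /eqP sum1.
  have [i1 [i1r i10 fi1]] : exists i1, [/\ i1 \in r, i1 != i0 & f i1 != 0].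
    apply: contrapT => h; suff : \sum_(i <- r | i != i0) f i = 0.
      by rewrite sum1 => /eqP; rewrite oner_eq0.
    rewrite big_seq_cond big1// => i /andP[ir ii0]; apply/eqP/negPn/negP => fi.
    by apply: h; exists i.
  have fi1_ge1 : 1 <= f i1.
    apply: int_gt0_ge1; first by apply: fint; apply/inA.
    by rewrite lt_neqAle eq_sym fi1 f0//; [exact/inA|exact/eqP].
  move: sum1; rewrite -big_filter (bigD1_seq i1) ?filter_uniq//= ?mem_filter ?i10//.
  rewrite big_filter_cond => sum1.
  have rest_ge0 i : (i != i0) && (i != i1) && (i \in r) -> 0 <= f i.
    by move=> /andP[/andP[ii0 _] ir]; apply: f0; [exact/inA|exact/eqP].
  have sum0 : \sum_(i <- r | (i != i0) && (i != i1)) f i = 0.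
    apply: le_anti; apply/andP; split; last first.
      by rewrite big_seq_cond; apply: sumr_ge0 => i; rewrite andbC; exact: rest_ge0.
    by rewrite -(lerD2l (f i1)) sum1 addr0.
  exists i1; split; first exact/inA.
    by move: sum1; rewrite sum0 addr0.
  move=> i /inA ir /eqP ii0 /eqP ii1.
  move/eqP: sum0; rewrite big_seq_cond psumr_eq0; last first.
    by move=> j; rewrite andbC; exact: rest_ge0.
  by move=> /allP/(_ i ir); rewrite ir ii0 ii1 /= => /eqP.
move=> [i1 [/inA i1r fi1 fr]].
have i10 : i1 != i0.
  apply/eqP => i10; move: fi1; rewrite i10 fi0 => /eqP.
  by rewrite eq_sym -subr_eq0 opprK -mulr2n pnatr_eq0.
rewrite -big_filter (bigD1_seq i1) ?filter_uniq//= ?mem_filter ?i10//.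
rewrite big_filter_cond fi1 big_seq_cond big1 ?addr0 ?addNr//.
move=> i /and3P[ir ii0 ii1]; apply: fr; [exact/inA|exact/eqP|exact/eqP].
Qed.

End integer_lemmas.

Section lattice_sets.
Context {R : realType} {d : nat}.
Implicit Types (x y m v : 'rV[R]_d) (A V : set 'rV[R]_d).

Lemma finite_lattice_box (C : R) :
  finite_set [set m : 'rV[R]_d | lattice m /\ forall i, `|m ord0 i| <= C].
Proof.
pose K := Num.bound C.
pose F (f : {ffun 'I_d -> 'I_(2 * K).+1}) : 'rV[R]_d := \row_i ((f i)%:R - K%:R).
apply: (@sub_finite_set _ _ (F @` setT)); last exact/finite_image/finite_finset.
move=> m [lm mC].
have mK i : exists k : 'I_(2 * K).+1, m ord0 i = k%:R - K%:R.
  have CK : `|m ord0 i| <= K%:R.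
    apply: (le_trans (mC i)); apply/ltW/archi_boundP.
    exact: le_trans (mC i).
  move: CK; rewrite ler_norml => /andP[lo hi].
  have : m ord0 i + K%:R \is a Num.nat.
    by rewrite natrEint rpredD//= -lerBlDr sub0r.
  move=> /natrP[k kE].
  have kK : (k < (2 * K).+1)%N.
    by rewrite ltnS -(ler_nat R) -kE mul2n -addnn natrD lerD2r.
  by exists (Ordinal kK); rewrite -kE addrK.
have [k kE] := boolp.choice mK.
exists [ffun i => k i] => //; apply/rowP => i.
by rewrite mxE ffunE kE.
Qed.

Lemma lattice_mulrn x k : lattice x -> lattice (x *+ k).
Proof. by move=> lx i; rewrite mulmxnE rpredMn. Qed.

(** With [N] the absolute value of a nonzero entry of [v], every lattice point of the ray is [m / N]
    times [v] for some natural [m]. The least positive such numerator [n0] divides all others, by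
    Euclidean division. *)
Lemma exists_primitive v : lattice v -> v != 0 ->
  exists w, pos [set v] `&` lattice = range (fun k : nat => w *+ k).
Proof.
move=> lv v0; have [j vj] : exists j, v ord0 j != 0 by apply/rV0Pn.
have /natrP[N NE] : `|v ord0 j| \is a Num.nat by exact: natr_norm_int.
have N0 : (0 < N)%N by rewrite -(ltr_nat R) -NE normr_gt0.
have NR : N%:R != 0 :> R by rewrite pnatr_eq0 -lt0n.
have exn : exists n, (0 < n)%N && `[< lattice ((n%:R / N%:R) *: v) >].
  by exists N; rewrite N0 divff// scale1r; apply/asboolP.
have [n0 /andP[n00 /asboolP ln0] minn] := ex_minnP exn.
exists ((n0%:R / N%:R) *: v); apply/seteqP; split; last first.
  move=> _ [k _ <-]; split; last exact: lattice_mulrn.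
  by rewrite -scaler_nat; apply: posZ => //; apply: posZ; [rewrite divr_ge0|exact: sub_pos].
move=> x []; rewrite pos1E => -[a a0 <-] lx.
have /natrP[m mE] : `|(a *: v) ord0 j| \is a Num.nat by apply: natr_norm_int; exact: lx.
have aE : a = m%:R / N%:R.
  move: mE; rewrite mxE normrM NE (ger0_norm a0) => <-.
  by rewrite mulfK.
have rE : ((m %% n0)%:R / N%:R) *: v = a *: v - ((n0%:R / N%:R) *: v) *+ (m %/ n0).
  rewrite -scaler_nat scalerA -scalerBl; congr (_ *: _).
  have mE' : m%:R = (m %/ n0)%:R * n0%:R + (m %% n0)%:R :> R.
    by rewrite -natrM -natrD -divn_eq.
  by rewrite aE mE'; ring.
have lr : lattice (((m %% n0)%:R / N%:R) *: v).
  by rewrite rE; apply: latticeB => //; exact: lattice_mulrn.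
have r0 : (m %% n0 = 0)%N.
  have [//|r_gt0] := posnP (m %% n0).
  have := minn (m %% n0)%N; rewrite r_gt0 => /(_ (asboolT lr)).
  by rewrite leqNgt ltn_pmod.
exists (m %/ n0)%N => //; apply/esym/eqP; rewrite -subr_eq0 -rE r0.
by rewrite mul0r scale0r.
Qed.

Lemma lattice_prim_gen A : lattice (prim_gen A).
Proof.
rewrite /prim_gen; case: xgetP => [w _ wE|_]; last exact: lattice0.
have : range (fun k : nat => w *+ k) w by exists 1%N.
by rewrite -wE => -[].
Qed.

Lemma pos_prim_gen v : lattice v -> v != 0 ->
  pos [set v] `<=` pos [set prim_gen (pos [set v])].
Proof.
move=> lv v0; have := xgetPex 0 (exists_primitive lv v0).
rewrite -/(prim_gen _) /=; set p := prim_gen _ => pE.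
have : (pos [set v] `&` lattice) v by split => //; exact: sub_pos.
rewrite pE => -[k _ kE]; apply: pos_sub => _ ->.
by rewrite -kE -scaler_nat; apply: posZ => //; exact: sub_pos.
Qed.

(** Nonnegativity against [m] passes from [A] to the whole cone, in particular to [- m]. *)
Lemma pos_setT_eq0 A m : pos A = setT -> (forall v, A v -> 0 <= pairing v m) -> m = 0.
Proof.
move=> AT Am; apply/eqP/negPn/negP => m0.
have : 0 <= pairing (- m) m.
  have : pos A (- m) by rewrite AT.
  apply: (@pos_min _ _ A (fun z => 0 <= pairing z m)) => //.
  - by rewrite pairing0l.
  - by move=> x y hx hy; rewrite pairingDl addr_ge0.
  - by move=> a x a0 hx; rewrite pairingZl mulr_ge0.
by rewrite pairingNl oppr_ge0 leNgt pairingxx_gt0.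
Qed.

(** Writing plus and minus the unit vectors as nonnegative combinations of [A] bounds every
    coordinate of [m] on both sides, independently of [m]. *)
Lemma finite_lattice_dual A : pos A = setT ->
  finite_set [set m | lattice m /\ forall v, A v -> -1 <= pairing v m].
Proof.
move=> AT.
have bnd (y : 'rV[R]_d) : exists C, forall m, (forall v, A v -> -1 <= pairing v m) ->
    - C <= pairing y m.
  have : pos A y by rewrite AT.
  apply: (@pos_min _ _ A (fun z => exists C, forall m,
      (forall v, A v -> -1 <= pairing v m) -> - C <= pairing z m)) => //.
  - by exists 0 => m _; rewrite pairing0l oppr0.
  - move=> x z [C hC] [D hD]; exists (C + D) => m hm.
    by rewrite pairingDl opprD lerD ?hC ?hD.
  - move=> a x a0 [C hC]; exists (a * C) => m hm.
    by rewrite pairingZl -mulrN ler_wpM2l ?hC.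
  - by move=> v Av; exists 1 => m /(_ v Av).
have [C1 hC1] := boolp.choice (fun i : 'I_d => bnd (delta_mx ord0 i)).
have [C2 hC2] := boolp.choice (fun i : 'I_d => bnd (- delta_mx ord0 i)).
apply: sub_finite_set (finite_lattice_box (\sum_i (`|C1 i| + `|C2 i|))).
move=> m [lm hm]; split => // i.
rewrite (bigD1 i)//=; apply: (@le_trans _ _ (`|C1 i| + `|C2 i|)); last first.
  by rewrite lerDl sumr_ge0// => j _; rewrite addr_ge0.
have := hC1 i m hm; have := hC2 i m hm.
rewrite pairingNl pairingC pairing_deltar lerN2 => h2 h1.
rewrite ler_norml; apply/andP; split.
  by apply: le_trans h1; rewrite lerN2 (le_trans (ler_norm _))// lerDl.
by apply: (le_trans h2); rewrite (le_trans (ler_norm _))// lerDr.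
Qed.

End lattice_sets.

(** * Roots of spanning fans *)

Section roots_of_spanning_fan.
Context {R : realType} {d : nat}.
Variable D : set (set 'rV[R]_d).
(** These two facts are what complete fans and normal fans of reflexive polytopes share here; they
    are established separately for each, so both parts of the theorem draw on this section. *)
Hypothesis finD : finite_set (rays D).
Hypothesis spanD : pos (prim_gen @` rays D) = setT.
Implicit Types (x y m : 'rV[R]_d) (t : set 'rV[R]_d).
Local Notation v := (@prim_gen R d).

Definition root_at t m : Prop :=
  [/\ lattice m, rays D t, pairing (v t) m = -1 &
      forall t', rays D t' -> t' <> t -> 0 <= pairing (v t') m].

Lemma fan_rootsP m : fan_roots D m <-> exists t, root_at t m.
Proof.
split=> [[lm [t [Dt tm h]]]|[t [lm Dt tm h]]]; first by exists t.
by split => //; exists t.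
Qed.

Lemma finite_fan_roots : finite_set (fan_roots D).
Proof.
apply: sub_finite_set (finite_lattice_dual spanD) => m /fan_rootsP[t [lm Dt tm h]].
split => // _ [t' Dt' <-]; have [->|/eqP tt'] := eqVneq t' t; first by rewrite tm.
by apply: le_trans (h _ Dt' tt'); rewrite lerN10.
Qed.

Lemma semisimpleP : semisimple D <-> forall x, fan_roots D x -> fan_roots D (- x).
Proof.
split=> [h x|h].
  by rewrite {1}h => -[y Dy <-]; rewrite opprK.
apply/seteqP; split => [x Dx|_ [x Dx <-]]; last exact: h.
by exists (- x); [exact: h|rewrite opprK].
Qed.

Lemma root_at_int t x t' : root_at t x -> pairing (v t') x \is a Num.int.
Proof. by move=> [lx _ _ _]; apply: pairing_int => //; exact: lattice_prim_gen. Qed.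

Lemma opp_rootP t x : root_at t x ->
  \sum_(t' \in rays D) pairing (v t') x = 0 <-> fan_roots D (- x).
Proof.
move=> rx; have [lx Dt tx h] := rx.
rewrite (sum_eq0_single_neg finD Dt tx)//; last first.
  by move=> t' _; exact: root_at_int rx.
split=> [[t1 [Dt1 tx1 h1]]|/fan_rootsP[t1 [_ Dt1 tx1 h1]]].
  apply/fan_rootsP; exists t1; split => //; first exact: latticeN.
    by rewrite pairingNr tx1.
  move=> t' Dt' tt1; rewrite pairingNr; have [->|/eqP tt] := eqVneq t' t.
    by rewrite tx opprK.
  by rewrite h1// oppr0.
exists t1; split => //; first by apply: oppr_inj; rewrite -pairingNr.
move=> t' Dt' tt tt1; apply: le_anti; rewrite h// andbT.
by rewrite -oppr_ge0 -pairingNr h1.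
Qed.

(** At [t] the value is -1 plus an integer at least 1, and at rays other than [t] and [t'] both
    terms are nonnegative. At [t'] it is -1 plus the nonnegative integer [<v t', x>]; were this
    integer positive, [x + y] would be nonnegative on all generators and hence zero. So it
    vanishes. *)
Lemma rootD t x t' y : root_at t x -> root_at t' y -> 0 < pairing (v t) y ->
  x + y != 0 -> root_at t' (x + y).
Proof.
move=> rx ry ty xy0; have [lx Dt tx hx] := rx; have [ly Dt' ty' hy] := ry.
have ty1 : 1 <= pairing (v t) y by apply: int_gt0_ge1 => //; exact: root_at_int ry.
have tt' : t' <> t by move=> tt; move: ty; rewrite -tt ty' ltr0N1.
have ge0 s : rays D s -> s <> t' -> 0 <= pairing (v s) (x + y).
  move=> Ds st'; rewrite pairingDr; have [->|/eqP st] := eqVneq s t.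
    by rewrite tx addrC subr_ge0.
  by rewrite addr_ge0 ?hx ?hy.
split => //; first exact: latticeD.
rewrite pairingDr ty' -[RHS]add0r; congr (_ + _); apply/eqP.
apply: contraNT xy0 => tx'; apply/eqP/(pos_setT_eq0 spanD) => _ [s Ds <-].
have [->|/eqP st'] := eqVneq s t'; last exact: ge0.
rewrite pairingDr ty' subr_ge0; apply: int_gt0_ge1; first exact: root_at_int rx.
by rewrite lt_neqAle eq_sym tx' hx.
Qed.

Lemma root_neq0 t x : root_at t x -> x != 0.
Proof.
move=> [_ _ tx _]; apply/eqP => x0; move: tx; rewrite x0 pairing0r => /eqP.
by rewrite eq_sym oppr_eq0 oner_eq0.
Qed.

Lemma semisimple_sum_roots : semisimple D -> \sum_(x \in fan_roots D) x = 0.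
Proof.
move=> ss; have [r ur rE] := finite_uniq_seq finite_fan_roots.
rewrite (fsum_seq _ ur rE).
have perm_r : perm_eq r [seq - x | x <- r].
  apply: uniq_perm => //; first by rewrite map_inj_uniq//; exact: oppr_inj.
  have inr x : x \in r = (- x \in r).
    have h y : y \in r -> - y \in r.
      move=> yr; have : fan_roots D y by rewrite rE.
      by move=> /(proj1 semisimpleP ss); rewrite rE.
    by apply/idP/idP => /h//; rewrite opprK.
  move=> x; apply/idP/mapP => [xr|[y yr ->]]; last by rewrite -inr.
  by exists (- x); rewrite ?opprK// -inr.
have : \sum_(x <- r) x = - \sum_(x <- r) x.
  by rewrite {1}(perm_big _ perm_r) big_map sumrN.
move/eqP; rewrite -addr_eq0 -mulr2n -scaler_nat scaler_eq0 pnatr_eq0 /=.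
by move/eqP.
Qed.

(* Were some root not the opposite of a root, [rootD] would produce an infinite
   chain of such roots all of whose consecutive partial sums are roots; two
   equal partial sums would make 0 a root. *)
Lemma sum_roots_semisimple : \sum_(x \in fan_roots D) x = 0 -> semisimple D.
Proof.
move=> sum0; apply/semisimpleP => x0 Dx0; apply: contrapT => nDx0.
have [r ur rE] := finite_uniq_seq finite_fan_roots.
have inr x : x \in r <-> fan_roots D x by rewrite rE.
rewrite (fsum_seq _ ur rE) in sum0.
pose U x := fan_roots D x /\ ~ fan_roots D (- x).
have eta_ex x : exists t, fan_roots D x -> root_at t x.
  have [/fan_rootsP[t rt]|nx] := pselect (fan_roots D x); first by exists t.
  by exists setT.
have [eta etaP] := boolp.choice eta_ex.
(* Pair the zero sum with [v (eta x)]: roots whose opposite is a root cancel, and [x] contributes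
   -1, so some other unpaired root contributes a positive amount. *)
have next_ex x : exists y, U x -> U y /\ 0 < pairing (v (eta x)) y.
  have [[Dx nDx]|nU] := pselect (U x); last by exists x.
  have [lx Dt tx hx] := etaP _ Dx.
  apply: contrapT => /forallNP noy.
  have le0 y : U y -> pairing (v (eta x)) y <= 0.
    move=> Uy; rewrite leNgt; apply/negP => yp; by apply: (noy y) => _; split.
  pose S := [seq y <- r | - y \in r].
  have permS : perm_eq S [seq - y | y <- S].
    apply: uniq_perm; first exact: filter_uniq.
      by rewrite map_inj_uniq ?filter_uniq//; exact: oppr_inj.
    move=> y; rewrite mem_filter; apply/andP/mapP => [[Ny yr]|[z]].
      by exists (- y); rewrite ?opprK// mem_filter opprK yr.
    by rewrite mem_filter => /andP[Nz zr ->]; rewrite opprK.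
  have sumS : \sum_(y <- S) pairing (v (eta x)) y = 0.
    have : \sum_(y <- S) pairing (v (eta x)) y = - \sum_(y <- S) pairing (v (eta x)) y.
      rewrite {1}(perm_big _ permS) big_map -sumrN.
      by apply: eq_bigr => y _; rewrite pairingNr.
    by move/eqP; rewrite -addr_eq0 -mulr2n mulrn_eq0 /= => /eqP.
  have : \sum_(y <- r) pairing (v (eta x)) y = 0 by rewrite -pairing_sumr sum0 pairing0r.
  rewrite (bigID (fun y => - y \in r))/= -big_filter sumS add0r.
  have xr : x \in r by apply/inr.
  have Nxr : - x \notin r by apply/negP => /inr.
  rewrite -big_filter (bigD1_seq x) ?filter_uniq ?mem_filter ?xr ?Nxr//=.
  rewrite big_filter_cond tx => /eqP; rewrite addrC subr_eq0 => /eqP sum1.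
  have : \sum_(i <- r | (- i \notin r) && (i != x)) pairing (v (eta x)) i <= 0.
    rewrite big_seq_cond; apply: sumr_le0 => y /and3P[yr Nyr _]; apply: le0.
    by split; [exact/inr|move=> /inr; exact/negP].
  by rewrite sum1 ler10.
have [next nextP] := boolp.choice next_ex.
pose xs k := iter k next x0.
have Uxs k : U (xs k) by elim: k => //= k IH; have [] := nextP _ IH.
pose psum i n := \sum_(k < n.+1) xs (i + k)%N.
have psum_root i n : root_at (eta (xs (i + n)%N)) (psum i n).
  elim: n => [|n IH].
    by rewrite /psum big_ord1; apply: etaP; have [] := Uxs (i + 0)%N.
  rewrite /psum big_ord_recr /= -/(psum i n) addnS.
  have [Ux [Dx' nDx']] := (Uxs (i + n)%N, Uxs (i + n).+1).
  apply: (rootD IH (etaP _ Dx') (proj2 (nextP _ Ux))).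
  (* If the new partial sum vanished, the last term would be the opposite of the previous partial
     sum, which is a root; terms of the chain have no such opposite. *)
  apply/eqP => /eqP; rewrite addr_eq0 => /eqP pE; apply: nDx'.
  by rewrite -pE; apply/fan_rootsP; exists (eta (xs (i + n)%N)); exact: IH.
have psum_inj : injective (psum 0%N).
  have lt_neq (m n : nat) : (m < n)%N -> psum 0%N m <> psum 0%N n.
    move=> mn pE; have /eqP := root_neq0 (psum_root m.+1 (n - m.+1)%N); apply.
    have E : psum 0%N n = psum 0%N m + psum m.+1 (n - m.+1)%N.
      rewrite /psum; have -> : n.+1 = (m.+1 + (n - m.+1).+1)%N by rewrite addnS subnKC.
      by rewrite big_split_ord/=; congr (_ + _); apply: eq_bigr => k _.
    by apply: (addrI (psum 0%N m)); rewrite addr0 -E pE.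
  move=> m n pE; have [mn|nm|//] := ltngtP m n.
    by case: (lt_neq _ _ mn).
  by case: (lt_neq _ _ nm).
apply: infinite_nat.
have -> : [set: nat] = psum 0%N @^-1` fan_roots D.
  apply/seteqP; split => // n _; apply/fan_rootsP.
  by exists (eta (xs (0 + n)%N)); exact: psum_root.
apply: finite_preimage finite_fan_roots => m n _ _; exact: psum_inj.
Qed.

Lemma fan_semisimple_TFAE :
  [<-> semisimple D;
       \sum_(x \in fan_roots D) x = 0;
       forall x, fan_roots D x -> \sum_(t \in rays D) pairing (v t) x = 0].
Proof.
tfae; first exact: semisimple_sum_roots.
- move=> /sum_roots_semisimple/semisimpleP ss x Dx.
  have /fan_rootsP[t rx] := Dx.
  by apply/(opp_rootP rx); exact: ss.
- move=> h; apply/semisimpleP => x Dx; have /fan_rootsP[t rx] := Dx.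
  by apply/(opp_rootP rx); exact: h.
Qed.

Lemma sum_prim_gen_semisimple :
  \sum_(t \in rays D) v t = 0 -> semisimple D.
Proof.
move=> sum0; apply/semisimpleP => x Dx; have /fan_rootsP[t rx] := Dx.
apply/(opp_rootP rx); have [r ur rE] := finite_uniq_seq finD.
by move: sum0; rewrite !(fsum_seq _ ur rE) -pairing_suml => ->; rewrite pairing0l.
Qed.

End roots_of_spanning_fan.

(** * Linear dimension *)

Section lin_dim_theory.
Context {R : realType} {d : nat}.
Implicit Types (A F : set 'rV[R]_d).

Lemma lin_dim_ge A k (B : 'M[R]_(k, d)) :
  row_free B -> (forall i, A (row i B)) -> (k <= lin_dim A)%N.
Proof.
move=> fB AB; have kd : (k < d.+1)%N by rewrite ltnS -(eqP fB) rank_leq_col.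
rewrite /lin_dim (leq_trans _ (leq_bigmax_cond (Ordinal kd) _))//.
by apply/asboolP; exists B.
Qed.

Lemma lin_dim_le A m :
  (forall k (B : 'M[R]_(k, d)), row_free B -> (forall i, A (row i B)) -> (k <= m)%N) ->
  (lin_dim A <= m)%N.
Proof. by move=> h; apply/bigmax_leqP => k /asboolP[B [fB AB]]; exact: h AB. Qed.

Lemma lin_dim_basis A : exists B : 'M[R]_(lin_dim A, d),
  row_free B /\ forall i, A (row i B).
Proof.
suff [k /asboolP[B hB] ->] : exists2 k : 'I_d.+1,
    `[< exists B : 'M[R]_(k, d), row_free B /\ forall i, A (row i B) >] & lin_dim A = k.
  by exists B.
have P0 : `[< exists B : 'M[R]_((ord0 : 'I_d.+1), d), row_free B /\ forall i, A (row i B) >].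
  apply/asboolP; exists 0; split; last by case.
  by rewrite /row_free mxrank0.
rewrite /lin_dim (bigop.bigmax_eq_arg _ P0)//.
by case: arg_maxnP => // k Pk _; exists k.
Qed.

Lemma lin_dim_pos1 (v : 'rV[R]_d) : v != 0 -> lin_dim (pos [set v]) = 1%N.
Proof.
move=> v0; apply/eqP; rewrite eqn_leq; apply/andP; split.
  apply: lin_dim_le => k B /eqP fB AB; rewrite -[leqLHS]fB.
  have /boolp.choice[a aP] : forall i, exists a, row i B = a *: v.
    by move=> i; have := AB i; rewrite pos1E => -[a _ <-]; exists a.
  have -> : B = (\col_i a i) *m v.
    by apply/row_matrixP => i; rewrite aP; apply/rowP => j; rewrite !mxE big_ord1 mxE.
  by apply: (leq_trans (mxrankM_maxr _ _)); exact: rank_leq_row.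
apply: (@lin_dim_ge _ 1 v); first by rewrite /row_free rank_rV v0.
by move=> i; rewrite (ord1 i) row_id; exact: sub_pos.
Qed.

End lin_dim_theory.

(** * The ray generators of a complete fan span positively *)

Section complete_fans.
Context {R : realType} {d : nat}.
Implicit Types (x y m v u : 'rV[R]_d) (s : seq 'rV[R]_d).

(** Sum all inequalities describing the cone. A generator on which the sum vanishes makes each of
    them vanish, so its opposite lies in the cone too. *)
Lemma pointed_cone_functional s : strongly_convex (pos [set` s]) -> 0 \notin s ->
  exists u, forall v, v \in s -> 0 < pairing u v.
Proof.
move=> sc s0; have [l lE] := pos_finite_halfspaces s.
exists (\sum_(a <- l) a) => v vs.
have vl : nonneg_on l v by rewrite -lE; exact: sub_pos.
rewrite pairing_suml lt_neqAle big_seq sumr_ge0// andbT; apply: contraNN s0.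
rewrite eq_sym psumr_eq0// => /allP h; rewrite (_ : 0 = v)//.
apply/esym/sc; first exact: sub_pos.
rewrite lE => a al; rewrite pairingNr oppr_ge0.
by have := h a al; rewrite al /= => /eqP ->.
Qed.

(** Any point lies in some cone of the fan. That cone is generated by its extreme rays, which are
    faces of it and therefore rays of the fan. *)
Lemma complete_fan_span (D : set (set 'rV[R]_d)) : complete_fan D ->
  pos (prim_gen @` rays D) = setT.
Proof.
move=> [[finD _ Dcone Dface _] DT]; apply/seteqP; split => // x _.
have [c Dc cx] : (\bigcup_(c in D) c) x by rewrite DT.
have [[n [v [lv cE]]] sc] := Dcone _ Dc.
pose s := [seq w <- codom v | w != 0].
have cs : c = pos [set` s].
  rewrite cE range_codom; apply/seteqP; split.
    apply: pos_sub => w /= wv; have [->|w0] := eqVneq w 0; first exact: pos0.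
    by apply: sub_pos; rewrite /= mem_filter w0.
  by apply: pos_sub => w; rewrite /= mem_filter => /andP[_ wv]; exact: sub_pos.
have ls w : w \in s -> lattice w.
  by rewrite mem_filter => /andP[_ /codomP[i ->]].
have [u us] : exists u, forall w, w \in s -> 0 < pairing u w.
  by apply: pointed_cone_functional; [rewrite -cs|rewrite mem_filter eqxx].
(* Normalizing the generators by [u] turns extreme rays into vertices. *)
pose ws := [seq (pairing u w)^-1 *: w | w <- s].
have uws w : w \in ws -> pairing u w = 1.
  by move=> /mapP[z zs ->]; rewrite pairingZr mulVf// gt_eqF ?us.
have [s' [us' ss' cs' hs']] := irredundant_subseq ws.
have cE' : c = pos [set` ws].
  rewrite cs; apply/seteqP; split; apply: pos_sub => w /=.
    move=> sw; rewrite -[w]scale1r -(@divff _ (pairing u w)) ?gt_eqF ?us// -scalerA.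
    by apply: posZ; [rewrite ltW ?us|apply: sub_pos; exact: map_f].
  by move=> /mapP[z zs ->]; apply: posZ; [rewrite invr_ge0 ltW ?us|exact: sub_pos].
have ray w : w \in s' -> pos (prim_gen @` rays D) w.
  move=> ws'; have [a [b [aw bs' as']]] := exposed_vertex ws' us' (hs' _ ws').
  have wws := ss' _ ws'.
  have face : is_cone_face c (pos [set w]).
    (* On the slice where [u] equals 1, [a] has minimum [b], attained at [w] only; subtracting
       [b *: u] makes the functional nonnegative on the cone and zero exactly on the ray of [w]. *)
    exists (a - b *: u).
    have fE z : z \in ws -> pairing (a - b *: u) z = pairing a z - b.
      by move=> zs; rewrite pairingBl pairingZl uws// mulr1.
    have ge0 z : z \in ws -> 0 <= pairing (a - b *: u) z.
      move=> zs; rewrite fE// subr_ge0; apply: (@conv_ge _ _ [set` s']) => //.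
      by rewrite cs'; exact: sub_conv.
    split.
      rewrite cE' => z [k [q [y [q0 ys ->]]]]; rewrite pairing_sumr sumr_ge0// => i _.
      by rewrite pairingZr mulr_ge0// ge0//; exact: ys.
    apply/seteqP; split.
      move=> z; rewrite pos1E => -[t t0 <-]; split.
        by rewrite cE'; apply: posZ => //; exact: sub_pos.
      by rewrite /= pairingZr fE// aw subrr mulr0.
    rewrite cE' => z [[k [q [y [q0 ys ->]]]] /= fz].
    rewrite pos1E; exists (\sum_i q i); first by rewrite /= sumr_ge0.
    rewrite scaler_suml; apply: eq_bigr => i _.
    move/eqP: fz; rewrite pairing_sumr psumr_eq0; last first.
      by move=> j _; rewrite pairingZr mulr_ge0// ge0//; exact: ys.
    move=> /allP/(_ i (mem_index_enum _))/=; rewrite pairingZr mulf_eq0.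
    case: (eqVneq (q i) 0) => [->|_ /=]; first by rewrite !scale0r.
    rewrite fE; last exact: ys.
    rewrite subr_eq0 => /eqP ab.
    have : (conv [set` ws] `&` [set x | pairing a x = b]) (y i).
      by split => //; apply: sub_conv; exact: ys.
    rewrite -cs' conv_face// => -[k' [q' [y' [_ q'1 ys' ->]]]]; congr (_ *: _).
    rewrite (eq_bigr (fun j => q' j *: w)) -?scaler_suml ?q'1 ?scale1r//.
    by move=> j _; have [yj uj] := ys' j; rewrite (as' _ yj uj).
  have [z zs wE] := mapP wws.
  have z0 : z != 0 by move: zs; rewrite mem_filter => /andP[].
  have zu : 0 < (pairing u z)^-1 by rewrite invr_gt0 us.
  have wz : pos [set w] = pos [set z].
    apply/seteqP; split; apply: pos_sub => _ ->; rewrite wE.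
      by apply: posZ; [exact: ltW|exact: sub_pos].
    rewrite -[X in pos _ X](scalerK (lt0r_neq0 zu)).
    by apply: posZ; [rewrite invr_ge0 ltW|exact: sub_pos].
  have Dz : rays D (pos [set z]).
    by split; [rewrite -wz; exact: Dface face|exact: lin_dim_pos1].
  have : pos [set z] w by rewrite -wz; exact: sub_pos.
  move=> /(pos_prim_gen (ls _ zs) z0); apply: pos_sub => _ ->.
  by apply: sub_pos; exists (pos [set z]).
move: cx; rewrite cE'; apply: pos_sub => w /= wws.
have : conv [set` s'] w by rewrite cs'; exact: sub_conv.
by move=> /conv_pos; exact: pos_sub.
Qed.

End complete_fans.

(** * Reflexive polytopes *)

Section linear_algebra.
Context {R : realType} {n : nat}.
Implicit Types (q v w x y : 'rV[R]_n).

Lemma row_free_kernel m k (A : 'M[R]_(m, k)) :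
  (forall z : 'rV_m, z *m A = 0 -> z = 0) -> row_free A.
Proof.
by move=> h; rewrite -kermx_eq0; apply/rowV0P => z /sub_kermxP; exact: h.
Qed.

Lemma spanning_basis (T : seq 'rV[R]_n) :
  (forall q, {in T, forall w, pairing q w = 0} -> q = 0) ->
  exists2 B : 'M[R]_n, B \in unitmx & forall i, row i B \in T.
Proof.
move=> hT; pose M : 'M[R]_(size T, n) := \matrix_(i < size T) T`_i.
have rowM i : row i M \in T by rewrite rowK mem_nth.
have fM : row_full M.
  rewrite /row_full -mxrank_tr; apply: row_free_kernel => q qM.
  apply: hT => w /(nthP 0)[i iT <-].
  move/matrixP: qM => /(_ ord0 (Ordinal iT)); rewrite !mxE => <-.
  by apply: eq_bigr => j _; rewrite !mxE.
exists (rowsub (fullrankfun fM) M); first exact: fullrowsub_unit.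
by move=> i; rewrite row_rowsub.
Qed.

Lemma unitmx_pairing_eq0 (B : 'M[R]_n) q : B \in unitmx ->
  (forall i, pairing q (row i B) = 0) -> q = 0.
Proof.
move=> uB h; have : B *m q^T = 0.
  apply/colP => i; rewrite !mxE -[RHS](h i); apply: eq_bigr => j _.
  by rewrite !mxE mulrC.
by move=> /(congr1 (mulmx (invmx B))); rewrite mulKmx// mulmx0 => /(congr1 trmx); rewrite trmxK trmx0.
Qed.

(** Each pair is the slack of an inequality together with its rate of change. A common step size
    exists as soon as the tight inequalities do not move. *)
Lemma small_perturbation (s : seq (R * R)) :
  {in s, forall p, 0 <= p.1 /\ (p.1 = 0 -> p.2 = 0)} ->
  exists2 e, 0 < e & {in s, forall p, e * `|p.2| <= p.1}.
Proof.
elim: s => [|[a b] s IH] h; first by exists 1.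
have [e e0 he] : exists2 e, 0 < e & {in s, forall p, e * `|p.2| <= p.1}.
  by apply: IH => p ps; apply: h; rewrite inE ps orbT.
have [/= a0 ab] := h _ (mem_head _ _).
have [e' e'0 he'] : exists2 e, 0 < e & e * `|b| <= a.
  have [a_0|an0] := eqVneq a 0.
    by exists 1 => //; rewrite ab// normr0 mulr0.
  exists (a / (1 + `|b|)); first by rewrite divr_gt0 ?ltr_pwDl// lt_neqAle eq_sym an0.
  rewrite mulrAC ler_pdivrMr ?ltr_pwDl//.
  by rewrite ler_wpM2l// lerDr.
exists (Num.min e e'); first by rewrite lt_min e0.
move=> p; rewrite inE => /orP[/eqP ->/=|ps].
  by apply: le_trans he'; rewrite ler_wpM2r// ge_min lexx orbT.
by apply: le_trans (he _ ps); rewrite ler_wpM2r// ge_min lexx.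
Qed.

Lemma interior_box (P : set 'rV[R]_n) (c : 'rV[R]_n) : interior P c ->
  exists2 e, 0 < e & box c e `<=` P.
Proof.
rewrite /interior => /nbhs_ballP[e /= e0 eP]; exists (e / 2); first by rewrite divr_gt0.
move=> x bx; apply: eP; split => // i j; rewrite (ord1 i) /ball /= distrC.
by apply: (le_lt_trans (bx j)); rewrite ltr_pdivrMr// ltr_pMr// ltr1n.
Qed.

Lemma box_scale (e : R) y : 0 < e -> exists2 t, 0 < t & box 0 e (t *: y).
Proof.
move=> e0; pose S := 1 + \sum_i `|y ord0 i|.
have S0 : 0 < S by rewrite ltr_pwDl// sumr_ge0.
exists (e / S); first by rewrite divr_gt0.
move=> i; rewrite mxE [X in _ - X]mxE subr0 normrM.
rewrite (ger0_norm (ltW (divr_gt0 e0 S0))) [leLHS]mulrAC ler_pdivrMr//.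
rewrite ler_wpM2l ?ltW// /S (bigD1 i)//=.
by rewrite addrCA ltrDl ltr_pwDl// sumr_ge0.
Qed.

Lemma box_ge0_eq0 (e : R) u : 0 < e ->
  (forall x, box 0 e x -> 0 <= pairing u x) -> u = 0.
Proof.
move=> e0 h; apply/eqP/negPn/negP => u0.
have [t t0 bt] := box_scale (- u) e0.
have := h _ bt; rewrite pairingZr pairingNr mulrN oppr_ge0 leNgt.
by rewrite mulr_gt0// pairingxx_gt0.
Qed.

Lemma box0 (e : R) : 0 < e -> box (0 : 'rV[R]_n) e 0.
Proof. by move=> e0 i; rewrite subrr normr0 ltW. Qed.

End linear_algebra.

Section reflexive_duality.
Context {R : realType} {d : nat}.
Implicit Types (u v w x y q : 'rV[R]_d).

Lemma reflexive_generators (P : set 'rV[R]_d) : reflexive_polytope P ->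
  exists (s s' : seq 'rV[R]_d) (e : R), [/\ 0 < e, box 0 e `<=` P, {in s, forall w, lattice w} /\
    {in s', forall v, lattice v}, P = conv [set` s] & dual_polytope P = conv [set` s']].
Proof.
move=> [/interior_box[e e0 eP] [n [v [lv PE]]] [n' [v' [lv' P'E]]]].
exists (codom v), (codom v'), e; rewrite -!range_codom; split => //.
by split => w /codomP[i ->].
Qed.

Lemma dual_conv (s : seq 'rV[R]_d) y :
  dual_polytope (conv [set` s]) y <-> {in s, forall w, -1 <= pairing w y}.
Proof.
split=> [h w ws|h x]; first by apply: h; exact: sub_conv.
by rewrite pairingC; apply: conv_ge => w ws; rewrite pairingC; exact: h.
Qed.

Lemma conv_bounded (s : seq 'rV[R]_d) :
  exists2 C, 0 <= C & conv [set` s] `<=` box 0 C.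
Proof.
pose C := \sum_(w <- s) \sum_i `|w ord0 i|.
exists C; first by rewrite sumr_ge0// => w _; rewrite sumr_ge0.
have sC w i : w \in s -> `|w ord0 i| <= C.
  move=> ws; rewrite /C (big_rem w)//= (bigD1 i)//= -addrA lerDl.
  by rewrite addr_ge0 ?sumr_ge0// => *; rewrite sumr_ge0.
move=> x [n [a [v [a0 a1 vs ->]]]] i; rewrite mxE subr0 summxE.
apply: (le_trans (ler_norm_sum _ _ _)).
rewrite -[C]mul1r -a1 mulr_suml; apply: ler_sum => j _.
by rewrite mxE normrM ger0_norm// ler_wpM2l// sC//; exact: vs.
Qed.

Variable P : set 'rV[R]_d.
Hypothesis rP : reflexive_polytope P.
Local Notation Ps := (dual_polytope P).
Local Notation V := (vertices (dual_polytope P)).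

Lemma finite_dual_vertices : finite_set V.
Proof.
by have [s [s' [e [_ _ _ _ ->]]]] := reflexive_generators rP; exact: finite_vertices.
Qed.

Lemma lattice_dual_vertices v : V v -> lattice v.
Proof.
have [s [s' [e [_ _ [_ ls'] _ ->]]]] := reflexive_generators rP.
by move=> /vertices_conv; exact: ls'.
Qed.

Lemma dual_vertex_dual v : V v -> Ps v.
Proof.
have [s [s' [e [_ _ _ _ ->]]]] := reflexive_generators rP.
by move=> /vertices_conv; exact: sub_conv.
Qed.

Lemma dual_conv_vertices : Ps = conv V.
Proof.
have [s [s' [e [_ _ _ _ ->]]]] := reflexive_generators rP.
by rewrite conv_vertices.
Qed.

Lemma dual_box : exists2 e, 0 < e & box 0 e `<=` Ps.
Proof.
have [s [s' [_ [_ _ _ -> _]]]] := reflexive_generators rP.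
have [C C0 sC] := conv_bounded s.
(* For [y] in a box of radius [r], [<w, y>] is at most [d * C * r] in absolute value; the added 1
   keeps the inverse meaningful when [d * C] is zero. *)
exists (1 + d%:R * C)^-1; first by rewrite invr_gt0 ltr_pwDl// mulr_ge0.
move=> y by_; apply/dual_conv => w ws.
have : box 0 C w by apply: sC; exact: sub_conv.
move=> bw; have /ler_normlP[+ _] : `|pairing w y| <= 1; last by rewrite lerNl.
apply: (le_trans (pairing_box w by_)).
rewrite ler_pdivrMr ?ltr_pwDl ?mulr_ge0// mul1r.
rewrite (@le_trans _ _ (d%:R * C)) ?lerDr// -[d in d%:R]card_ord -sum1_card natr_sum mulr_suml.
apply: ler_sum => i _; rewrite mul1r.
by have := bw i; rewrite mxE subr0.
Qed.

Lemma polytope_box : exists2 e, 0 < e & box 0 e `<=` P.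
Proof. by have [s [s' [e [e0 eP _ _ _]]]] := reflexive_generators rP; exists e. Qed.

Lemma polytope0 : P 0.
Proof. by have [e e0] := polytope_box; apply; exact: box0. Qed.

Lemma dual0 : Ps 0.
Proof. by have [e e0] := dual_box; apply; exact: box0. Qed.

(** A functional separating [x] from [P] has a negative lower bound [c] on [P], as 0 is interior.
    Divided by [- c] it lies in the dual, hence in the hull of [V], where no point pairs with [x]
    below -1. *)
Lemma bidual x : P x <-> forall v, V v -> -1 <= pairing v x.
Proof.
split=> [Px v /dual_vertex_dual/(_ x Px)|h]; first by rewrite pairingC.
have [s [_ [e [e0 eP _ PE _]]]] := reflexive_generators rP.
apply: contrapT; rewrite PE => /separation[u [c [ux cs]]].
have cP z : P z -> c <= pairing u z by rewrite PE; exact: conv_ge.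
have c_lt0 : c < 0.
  rewrite lt_neqAle; apply/andP; split; last by rewrite -(pairing0r u); exact: cP polytope0.
  apply/eqP => c0; move: ux; rewrite c0 (_ : u = 0) ?pairing0l ?ltxx//.
  by apply: (box_ge0_eq0 e0) => z /eP/cP; rewrite c0.
have : Ps ((- c)^-1 *: u).
  move=> z Pz; rewrite pairingC pairingZl mulrC ler_pdivlMr ?oppr_gt0//.
  by rewrite mulN1r opprK; exact: cP.
set y := _ *: u => Py; have yV : conv V y by rewrite -dual_conv_vertices.
have : -1 <= pairing x y.
  by apply: conv_ge yV => v /h; rewrite pairingC.
rewrite pairingC /y pairingZl mulrC ler_pdivlMr ?oppr_gt0// mulN1r opprK.
by rewrite leNgt ux.
Qed.

Lemma dual_pos_setT : pos V = setT.
Proof.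
apply/seteqP; split => // y _; have [e e0 eP] := dual_box.
have [t t0 /eP Pty] := box_scale y e0.
have /conv_pos yV : conv V (t *: y) by rewrite -dual_conv_vertices.
rewrite -[y](scalerK (lt0r_neq0 t0)); apply: posZ => //.
by rewrite invr_ge0 ltW.
Qed.

Lemma polytope_finite_lattice : finite_set (P `&` lattice).
Proof.
have [s [_ [_ [_ _ _ -> _]]]] := reflexive_generators rP.
have [C C0 sC] := conv_bounded s.
apply: sub_finite_set (finite_lattice_box C) => x [/sC xC lx]; split => // i.
by have := xC i; rewrite mxE subr0.
Qed.

Lemma dual_finite_lattice : finite_set (Ps `&` lattice).
Proof.
have [_ [s [_ [_ _ _ _ ->]]]] := reflexive_generators rP.
have [C C0 sC] := conv_bounded s.
apply: sub_finite_set (finite_lattice_box C) => x [/sC xC lx]; split => // i.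
by have := xC i; rewrite mxE subr0.
Qed.

End reflexive_duality.

(** * Facets of a reflexive polytope as vertices of its dual *)

Section facets.
Context {R : realType} {d' : nat}.
Local Notation d := d'.+1.
Implicit Types (u v w x y q : 'rV[R]_d).
Variable P : set 'rV[R]_d.
Hypothesis rP : reflexive_polytope P.
Local Notation Ps := (dual_polytope P).
Local Notation V := (vertices (dual_polytope P)).

Lemma delta_neq0 n (i : 'I_n) : delta_mx ord0 i != 0 :> 'rV[R]_n.
Proof. by apply/rV0Pn; exists i; rewrite mxE !eqxx oner_eq0. Qed.

(** The functional exposing [v] is scaled to level -1, which puts it in [P]. Its level is negative:
    level zero would force the functional to vanish and the dual to be the single point [v], but the
    dual contains a box of positive dimension. *)
Lemma vertex_functional v : V v -> exists u,
  [/\ P u, pairing v u = -1 & forall y, Ps y -> pairing u y = -1 -> y = v].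
Proof.
move=> [u [c [uc vE]]]; have [e e0 eP] := dual_box rP.
have Pv : (Ps `&` [set y | pairing u y = c]) v by rewrite -vE.
have uv : pairing u v = c by case: Pv.
have c_lt0 : c < 0.
  rewrite lt_neqAle; apply/andP; split.
    apply/eqP => c0; have u0 : u = 0.
      by apply: (box_ge0_eq0 e0) => z /eP/uc; rewrite c0.
    have onlyv y : Ps y -> y = v.
      move=> Py; have : (Ps `&` [set y | pairing u y = c]) y.
        by split => //; rewrite /= u0 pairing0l c0.
      by rewrite -vE.
    have [t t0 /eP/onlyv tv] := box_scale (delta_mx ord0 ord0 : 'rV[R]_d) e0.
    have := onlyv _ (dual0 rP); rewrite -tv => /esym/eqP.
    by rewrite scaler_eq0 gt_eqF//= (negbTE (delta_neq0 _)).
  by rewrite -(pairing0r u); exact: uc (dual0 rP).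
exists ((- c)^-1 *: u); split.
- apply/(bidual rP) => y /(dual_vertex_dual rP)/uc yc.
  by rewrite pairingZr pairingC mulrC ler_pdivlMr ?oppr_gt0// mulN1r opprK.
- by rewrite pairingZr pairingC uv invrN mulNr mulVf// lt_eqF.
- move=> y Py; rewrite pairingZl => uy.
  have : (Ps `&` [set y | pairing u y = c]) y.
    split => //=; move/(congr1 ( *%R (- c))): uy.
    by rewrite mulVKf ?oppr_eq0 ?lt_eqF// mulrN1 opprK.
  by rewrite -vE.
Qed.

Definition facet_of v : set 'rV[R]_d := P `&` [set x | pairing v x = -1].

Lemma facet_of_conv v (s : seq 'rV[R]_d) : Ps v -> P = conv [set` s] ->
  facet_of v = conv ([set` s] `&` [set x | pairing v x = -1]).
Proof.
move=> Pv PE; rewrite /facet_of PE conv_face// => w ws.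
by rewrite pairingC; apply: Pv; rewrite PE; exact: sub_conv.
Qed.

(** If [q] annihilates all generators of [P] tight at [v], then [v + t *: q] stays in the dual for
    small [t] of either sign, which for a vertex forces [q = 0]. Hence the tight generators, which
    are lattice points of the facet, contain a basis. *)
Lemma facet_spanning v : V v ->
  exists2 B : 'M[R]_d, B \in unitmx &
    forall i, lattice (row i B) /\ facet_of v (row i B).
Proof.
move=> Vv; have [s [_ [_ [_ _ [ls _] PE _]]]] := reflexive_generators rP.
have Pv := dual_vertex_dual rP Vv.
have sv w : w \in s -> -1 <= pairing v w.
  by move=> ws; rewrite pairingC; apply: Pv; rewrite PE; exact: sub_conv.
pose T := [seq w <- s | pairing v w == -1].
have [B uB BT] : exists2 B : 'M[R]_d, B \in unitmx & forall i, row i B \in T.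
  apply: spanning_basis => q qT.
  have [e e0 he] : exists2 e, 0 < e &
      {in [seq (pairing v w + 1, pairing q w) | w <- s], forall p, e * `|p.2| <= p.1}.
    apply: small_perturbation => _ /mapP[w ws ->] /=; split.
      by rewrite -lerBlDr sub0r sv.
    move=> /eqP; rewrite addr_eq0 => vw.
    by apply: qT; rewrite mem_filter vw.
  have near t : `|t| <= e -> Ps (v + t *: q).
    move=> te; rewrite PE; apply/dual_conv => w ws.
    have /= := he _ (map_f _ ws); rewrite pairingDr pairingZr !(pairingC w).
    move=> ewq; have : `|t * pairing q w| <= pairing v w + 1.
      by rewrite normrM; apply: le_trans ewq; rewrite ler_wpM2r.
    by rewrite ler_norml => /andP[tq _]; lra.
  have [u [Pu vu uniq_u]] := vertex_functional Vv.
  have uge t : `|t| <= e -> 0 <= t * pairing u q.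
    move=> /near /(_ u Pu); rewrite pairingDr pairingZr (pairingC u v) vu.
    by rewrite lerDl.
  have uq0 : pairing u q = 0.
    have := uge e; rewrite (gtr0_norm e0) => /(_ (lexx _)).
    have := uge (- e); rewrite normrN (gtr0_norm e0) => /(_ (lexx _)).
    rewrite mulNr oppr_ge0 => h1 h2; apply/eqP.
    by move/eqP: (le_anti (introT andP (conj h1 h2))); rewrite mulf_eq0 gt_eqF.
  have /uniq_u : Ps (v + e *: q) by apply: near; rewrite gtr0_norm.
  rewrite pairingDr pairingZr uq0 mulr0 addr0 pairingC => /(_ vu)/eqP.
  rewrite -subr_eq0 addrAC subrr add0r scaler_eq0 gt_eqF//= => /eqP//.
exists B => // i; have := BT i; rewrite mem_filter => /andP[/eqP vr rs].
by split; [exact: ls|split => //; rewrite PE; exact: sub_conv].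
Qed.

Lemma facet_unique_normal v q : V v ->
  (forall x, lattice x -> facet_of v x -> pairing q x = -1) -> q = v.
Proof.
move=> Vv qF; have [B uB BF] := facet_spanning Vv.
apply/eqP; rewrite -subr_eq0; apply/eqP/(unitmx_pairing_eq0 uB) => i.
have [li Fi] := BF i; rewrite pairingBl qF//.
by have [_ /= ->] := Fi; rewrite subrr.
Qed.

Lemma inner_normal_facet v : V v -> inner_normal (facet_of v) = v.
Proof.
move=> Vv; apply: (facet_unique_normal Vv) => x lx Fx.
move: x lx Fx; rewrite /inner_normal; case: xgetP => [n _ [_ nF] x _|/(_ v) []].
  exact: nF.
by split; [exact: (lattice_dual_vertices rP)|move=> y []].
Qed.

Lemma dual_vertex_neq0 v : V v -> v != 0.
Proof.
move=> /vertex_functional[u [_ vu _]]; apply/eqP => v0.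
by move: vu; rewrite v0 pairing0l => /eqP; rewrite eq_sym oppr_eq0 oner_eq0.
Qed.

Lemma row_free_cons k (u f : 'rV[R]_d) (D : 'M[R]_(k, d)) : pairing u f != 0 ->
  (forall i, pairing u (row i D) = 0) -> row_free D ->
  row_free (col_mx f D).
Proof.
move=> uf uD fD; apply: row_free_kernel => z.
rewrite -[z]hsubmxK mul_row_col => zE.
have DuT : D *m u^T = 0.
  apply/colP => i; rewrite !mxE -[RHS](uD i); apply: eq_bigr => j _.
  by rewrite !mxE mulrC.
have z0 : lsubmx z = 0.
  move: zE => /(congr1 (mulmx^~ u^T)); rewrite mulmxDl -!mulmxA DuT mulmx0 addr0 mul0mx.
  rewrite [lsubmx z]mx11_scalar mul_scalar_mx => /(congr1 (fun A : 'M[R]_1 => A ord0 ord0)).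
  rewrite mxE -pairing_mulmx pairingC [RHS]mxE => /eqP; rewrite mulf_eq0 (negbTE uf) orbF.
  by move=> /eqP ->; rewrite raddf0.
move: zE; rewrite z0 mul0mx add0r => /(congr1 (mulmx^~ (pinvmx D))).
rewrite mul0mx -mulmxA mulmxVp// mulmx1 => ->.
by rewrite row_mx0.
Qed.

Lemma aff_dim_facet v : V v -> aff_dim (facet_of v) = d'.
Proof.
move=> Vv; have [B uB BF] := facet_spanning Vv.
apply/eqP; rewrite eqn_leq; apply/andP; split.
  apply: lin_dim_le => k D fD DF.
  have : D *m v^T = 0.
    apply/colP => i; rewrite !mxE.
    have [x [_ xv] [y [_ yv] xyE]] := DF i.
    have : pairing v (row i D) = 0 by rewrite -xyE pairingBr xv yv subrr.
    by move=> h; rewrite -[RHS]h; apply: eq_bigr => j _; rewrite !mxE mulrC.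
  move=> /mulmx0_rank_max; rewrite (eqP fD) mxrank_tr rank_rV dual_vertex_neq0//.
  by rewrite addn1 ltnS.
pose D : 'M[R]_(d', d) := \matrix_i (row (lift ord0 i) B - row ord0 B).
apply: (@lin_dim_ge _ _ _ _ D).
  apply: row_free_kernel => z zD.
  (* A relation among the differences is a relation among the rows of [B], the first row weighted by
     minus the sum. *)
  pose z' : 'rV[R]_d := row_mx (- \sum_i z ord0 i)%:M z : 'rV[R]_(1 + d').
  have z'B : z' *m B = 0.
    rewrite mulmx_sum_row big_ord_recl.
    have -> : z' ord0 ord0 = - \sum_i z ord0 i.
      rewrite /z' (_ : ord0 = lshift d' ord0 :> 'I_(1 + d')); last exact/val_inj.
      by rewrite (@row_mxEl _ 1 1 d') mxE eqxx mulr1n.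
    rewrite -[RHS]zD mulmx_sum_row scaleNr scaler_suml addrC -sumrB.
    apply: eq_bigr => i _; rewrite rowK scalerBr; congr (_ *: _ - _).
    rewrite /z' (_ : lift ord0 i = rshift 1 i :> 'I_(1 + d')); last exact/val_inj.
    by rewrite (@row_mxEr _ 1 1 d').
  have : z' = 0 by rewrite -[z'](mulmxK uB) z'B mul0mx.
  by move=> /(congr1 (@rsubmx _ 1 1 d')); rewrite row_mxKr linear0.
move=> i; rewrite rowK; exists (row (lift ord0 i) B); first by have [] := BF (lift ord0 i).
by exists (row ord0 B) => //; have [] := BF ord0.
Qed.

(** The vertex attached to a facet is its supporting functional scaled to level -1. The level is
    negative, since level zero makes the functional vanish and [F] all of [P], whose affine
    dimension is too large. *)
Lemma is_facetP F : is_facet P F <-> exists2 v, V v & F = facet_of v.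
Proof.
split; last first.
  move=> [v Vv ->]; split.
  - exists v, (-1); split => // x; rewrite pairingC; exact: (dual_vertex_dual rP Vv).
  - by have [B _ BF] := facet_spanning Vv; exists (row ord0 B); have [] := BF ord0.
  - by rewrite aff_dim_facet.
move=> [[u [c [uc FE]]] [f Ff] [dF]].
have [e e0 eP] := polytope_box rP.
have c_lt0 : c < 0.
  rewrite lt_neqAle; apply/andP; split; last first.
    by rewrite -(pairing0r u); exact: uc (polytope0 rP).
  apply/eqP => c0; have u0 : u = 0 by apply: (box_ge0_eq0 e0) => z /eP/uc; rewrite c0.
  have FP : F = P by rewrite FE; apply/seteqP; split => [x []//|x Px]; split => //=; rewrite u0 pairing0l.
  have : (d <= aff_dim F)%N.
    apply: (@lin_dim_ge _ _ _ _ (e%:M)).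
      by rewrite row_free_unit unitmxE det_scalar unitrX// unitfE gt_eqF.
    move=> i; exists (row i e%:M); last by exists 0; rewrite ?subr0// FP; exact: (polytope0 rP).
    rewrite FP; apply: eP => j; rewrite !mxE subr0; case: eqP => _.
      by rewrite mulr1n gtr0_norm.
    by rewrite mulr0n normr0 ltW.
  by rewrite dF ltnn.
pose v := (- c)^-1 *: u.
have vE x : pairing v x = -1 <-> pairing u x = c.
  rewrite pairingZl; split => [h|->]; last by rewrite invrN mulNr mulVf// lt_eqF.
  move/(congr1 ( *%R (- c))): h.
  by rewrite mulVKf ?oppr_eq0 ?lt_eqF// mulrN1 opprK.
have FvE : F = facet_of v.
  by rewrite FE; apply/seteqP; split => x [Px /= xc]; split => //; apply/vE.
exists v => //.
have Pv : Ps v.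
  move=> x /uc xc; rewrite pairingC pairingZl mulrC ler_pdivlMr ?oppr_gt0//.
  by rewrite mulN1r opprK.
have [D [fD DF]] := lin_dim_basis [set x - y | x in F & y in F].
have {}DF : forall i, exists xy, [/\ F xy.1, F xy.2 & row i D = xy.1 - xy.2].
  by move=> i; have [x Fx [y Fy <-]] := DF i; exists (x, y).
have [xy xyP] := boolp.choice DF.
have Fv x : F x -> pairing v x = -1 by rewrite FvE => -[].
have FP x : F x -> P x by rewrite FE => -[].
have ffree : row_free (col_mx f D).
  apply: (@row_free_cons _ v) => //; first by rewrite Fv// oppr_eq0 oner_eq0.
  by move=> i; have [x1 x2 ->] := xyP i; rewrite pairingBr !Fv// subrr.
(* A sum of points of [F], chosen so that [f] and their differences form a basis. A dual point on
   which [z] is no larger than on [v] takes the value -1 at each of these points, so it agrees with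
   [v] on the basis. *)
pose z := f + \sum_i ((xy i).1 + (xy i).2).
have tight q : Ps q -> pairing z q <= pairing z v -> q = v.
  move=> Pq zq.
  have gef x : F x -> 0 <= pairing x (q - v).
    by move=> Fx; rewrite pairingBr !(pairingC x) Fv// subr_ge0 pairingC; apply: Pq; exact: FP.
  have : pairing z (q - v) = 0.
    apply: le_anti; rewrite pairingBr subr_le0 zq -pairingBr pairingDl pairing_suml.
    by rewrite addr_ge0 ?gef// sumr_ge0// => i _; rewrite pairingDl; have [x1 x2 _] := xyP i; rewrite addr_ge0// gef.
  rewrite pairingDl pairing_suml => /eqP.
  have sum_ge0 i : 0 <= pairing ((xy i).1 + (xy i).2) (q - v).
    by rewrite pairingDl; have [x1 x2 _] := xyP i; rewrite addr_ge0// gef.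
  rewrite paddr_eq0; [|exact: gef|by apply: sumr_ge0 => i _; exact: sum_ge0].
  move=> /andP[/eqP fq].
  rewrite psumr_eq0; last by move=> i _; exact: sum_ge0.
  move=> /allP sq.
  have Mq : col_mx f D *m (q - v)^T = 0.
    rewrite mul_col_mx; apply/colP => i; rewrite [RHS]mxE.
    case: (fintype.split_ordP i) => j ->; rewrite ?col_mxEu ?col_mxEd.
      by rewrite (ord1 j) -pairing_mulmx.
    have [x1 x2 rE] := xyP j.
    have := sq j (mem_index_enum _); rewrite /= pairingDl paddr_eq0 ?gef//.
    move=> /andP[/eqP h1 /eqP h2].
    have : pairing (row j D) (q - v) = 0 by rewrite rE pairingBl h1 h2 subrr.
    by rewrite pairing_mulmx -row_mul mxE.
  have full : row_full (col_mx f D).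
    by rewrite /row_full (eqP ffree) /= -[X in (1 + X)%N]/(aff_dim F) dF.
  have /(row_full_inj full) : col_mx f D *m (q - v)^T = col_mx f D *m 0.
    by rewrite Mq mulmx0.
  by move=> /(congr1 trmx); rewrite trmxK trmx0 => /eqP; rewrite subr_eq0 => /eqP.
exists z, (pairing z v); split => [q Pq|].
  by rewrite leNgt; apply/negP => zq; move: (zq); rewrite (tight q Pq (ltW zq)) ltxx.
apply/seteqP; split => [q -> //|q [Pq /= qz]].
by apply: tight => //; rewrite qz.
Qed.

End facets.

Lemma subset_card_eq (T : choiceType) (A B : set T) : finite_set B -> A `<=` B ->
  (A #= B)%card -> B `<=` A.
Proof.
move=> fB AB cAB; have fA : finite_set A := sub_finite_set AB fB.
have /(fcard_eq fA fB) sAB := cAB.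
have sub : {subset finmap.enum_fset (fset_set A) <= finmap.enum_fset (fset_set B)}.
  by move=> x; rewrite !in_fset_set// !inE; exact: AB.
have [_ eAB] := uniq_min_size (finmap.fset_uniq _) sub (eq_leq (esym sAB)).
move=> x Bx; have : x \in finmap.enum_fset (fset_set B) by rewrite in_fset_set// inE.
by rewrite -eAB in_fset_set// inE.
Qed.

(* If [T] preserves the points of [A] where [phi <= 0], the points whose image
   leaves [A] all have [phi > 0], and the others cancel in pairs. *)
Lemma sum_reflection (R : realType) (T0 : choiceType) (A : set T0) (phi : T0 -> R)
    (T : T0 -> T0) : finite_set A -> involutive T ->
  (forall x, phi (T x) = - phi x) ->
  (forall x, A x -> phi x <= 0 -> A (T x)) ->
  0 <= \sum_(x \in A) phi x /\
  (\sum_(x \in A) phi x = 0 -> forall x, A x -> A (T x)).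
Proof.
move=> /finite_uniq_seq[r ur AE] TT phiT AT; rewrite (fsum_seq _ ur AE).
have inA x : A x <-> x \in r by rewrite AE.
pose S := [seq x <- r | T x \in r].
have permS : perm_eq S [seq T x | x <- S].
  apply: uniq_perm; first exact: filter_uniq.
    by rewrite map_inj_uniq ?filter_uniq//; exact: inv_inj.
  move=> x; rewrite mem_filter; apply/andP/mapP => [[Txr xr]|[y]].
    by exists (T x); rewrite ?TT// mem_filter TT xr.
  by rewrite mem_filter => /andP[Tyr yr ->]; rewrite TT.
have sumS : \sum_(x <- S) phi x = 0.
  have : \sum_(x <- S) phi x = - \sum_(x <- S) phi x.
    rewrite {1}(perm_big _ permS) big_map -sumrN.
    by apply: eq_bigr => x _; rewrite phiT.
  by move/eqP; rewrite -addr_eq0 -mulr2n mulrn_eq0 /= => /eqP.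
have pos x : x \in r -> T x \notin r -> 0 < phi x.
  move=> xr Txr; rewrite ltNge; apply: contraNN Txr => px.
  by apply/inA; apply: AT => //; exact/inA.
rewrite (bigID (fun x => T x \in r))/= -big_filter -/S sumS add0r big_seq_cond.
split; first by apply: sumr_ge0 => x /andP[xr Txr]; rewrite ltW// pos.
move=> /eqP; rewrite psumr_eq0; last by move=> x /andP[xr Txr]; rewrite ltW// pos.
move=> /allP h x /inA xr; apply/inA; apply: contrapT => /negP Txr.
by have := h x xr; rewrite xr Txr/= gt_eqF// pos.
Qed.

(** * Roots of a reflexive polytope *)

Section polytope_roots.
Context {R : realType} {d' : nat}.
Local Notation d := d'.+1.
Implicit Types (u v w x y z m eta q : 'rV[R]_d).
Variable P : set 'rV[R]_d.
Hypothesis rP : reflexive_polytope P.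
Local Notation Ps := (dual_polytope P).
Local Notation V := (vertices (dual_polytope P)).
Local Notation D := (normal_fan P).

(** Some lattice point [w] of the facet has [<v, w> = -1], so [a *: v] can be a lattice point only
    for integral [a]. *)
Lemma pos_dual_vertex_lattice v : V v ->
  pos [set v] `&` lattice = range (fun k : nat => v *+ k).
Proof.
move=> Vv; have lv := lattice_dual_vertices rP Vv.
have [B _ BF] := facet_spanning rP Vv; have [lw [_ /= vw]] := BF ord0.
apply/seteqP; split; last first.
  move=> _ [k _ <-]; split; last exact: lattice_mulrn.
  by rewrite -scaler_nat; apply: posZ => //; exact: sub_pos.
move=> x []; rewrite pos1E => -[a /= a0 <-] lav.
have : a \is a Num.nat.
  rewrite natrEint a0 andbT -[a]opprK rpredN.
  have := pairing_int lav lw; rewrite pairingZl vw mulrN1.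
  by [].
by move=> /natrP[k ->]; exists k => //; rewrite scaler_nat.
Qed.

Lemma prim_gen_dual_vertex v : V v -> prim_gen (pos [set v]) = v.
Proof.
move=> Vv; have VE := pos_dual_vertex_lattice Vv.
have ex_gen : exists w, pos [set v] `&` lattice = range (fun k : nat => w *+ k).
  by exists v.
have := xgetPex 0 ex_gen; rewrite -/(prim_gen _) /= VE; set p := prim_gen _ => rE.
have [k _ kE] : range (fun k : nat => p *+ k) v by rewrite -rE; exists 1%N.
have [l _ lE] : range (fun k : nat => v *+ k) p by rewrite rE; exists 1%N.
have : (l * k)%:R *: v == 1 *: v by rewrite scaler_nat scale1r mulrnA lE kE.
rewrite -subr_eq0 -scalerBl scaler_eq0.
rewrite (negbTE (dual_vertex_neq0 rP Vv)) orbF subr_eq0 pnatr_eq1 muln_eq1.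
by move=> /andP[/eqP l1 _]; rewrite -lE l1.
Qed.

(** Two distinct points of a proper face lie at the same nonzero level, hence are linearly
    independent and span a cone of dimension at least 2. The level is nonzero because level zero
    would give the whole dual polytope. The empty face gives dimension 0. *)
Lemma rays_normal_fan : rays D = (fun v => pos [set v]) @` V.
Proof.
have [e e0 eP] := dual_box rP.
apply/seteqP; split; last first.
  move=> _ [v Vv <-]; split; last by apply: lin_dim_pos1; exact: (dual_vertex_neq0 rP).
  exists [set v] => //; split => // vE.
  have : [set v] 0 by rewrite vE; exact: (dual0 rP).
  by move=> /= /esym/eqP; apply/negP; exact: (dual_vertex_neq0 rP Vv).
move=> _ [[F [[u [c [uc FE]]] FP] <-] dim1].
have [y Fy] : F !=set0.
  apply: contrapT => /set0P/negP/negPn/eqP F0.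
  have [B [fB BF]] := lin_dim_basis (pos F).
  move: B fB BF; rewrite dim1 => B fB BF.
  have [n [a [v [_ vF B0]]]] := BF ord0.
  case: n a v vF B0 => [|n] a v vF B0; last by have := vF ord0; rewrite F0.
  move: B0; rewrite big_ord0 => B0; move: fB; rewrite /row_free (_ : B = 0) ?mxrank0//.
  by apply/rowP => j; move/rowP: B0 => /(_ j); rewrite !mxE.
have uy : pairing u y = c by move: Fy; rewrite FE => -[].
have c_neq0 : c != 0.
  apply/eqP => c0; have u0 : u = 0 by apply: (box_ge0_eq0 e0) => z /eP/uc; rewrite c0.
  apply: FP; rewrite FE; apply/seteqP; split => [z []//|z Pz]; split => //=.
  by rewrite u0 pairing0l.
have F1 z : F z -> z = y.
  move=> Fz; apply/eqP/negPn/negP => zy.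
  have uz : pairing u z = c by move: Fz; rewrite FE => -[].
  suff : (2 <= lin_dim (pos F))%N by rewrite dim1.
  apply: (@lin_dim_ge _ _ _ _ (col_mx y z : 'M[R]_(1 + 1, d))).
    apply: row_free_kernel => q; rewrite -[q]hsubmxK mul_row_col.
    rewrite [lsubmx q]mx11_scalar [rsubmx q]mx11_scalar !mul_scalar_mx.
    set a := lsubmx _ _ _; set b := rsubmx _ _ _ => abE.
    have abc : a + b = 0.
      move: abE => /(congr1 (pairing u)); rewrite pairingDr !pairingZr uy uz pairing0r -mulrDl.
      by move/eqP; rewrite mulf_eq0 (negbTE c_neq0) orbF => /eqP.
    have aE : a = - b by apply/eqP; rewrite -addr_eq0 abc.
    move/eqP: abE; rewrite aE scaleNr addrC -scalerBr scaler_eq0 subr_eq0 (negbTE zy) orbF.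
    by move=> /eqP ->; rewrite oppr0 !raddf0 row_mx0.
  move=> i; case: (fintype.split_ordP i) => j ->; rewrite (ord1 j).
    by rewrite rowKu row_id; exact: sub_pos.
  by rewrite rowKd row_id; exact: sub_pos.
have FE1 : F = [set y] by apply/seteqP; split => [z /F1//|_ ->].
exists y; last by rewrite FE1.
by exists u, c; split => //; rewrite -FE1.
Qed.

Lemma pos1_inj : set_inj V (fun v => pos [set v]).
Proof.
move=> v w /set_mem Vv /set_mem Vw vw.
by rewrite -(prim_gen_dual_vertex Vv) vw prim_gen_dual_vertex.
Qed.

Lemma finite_rays_normal_fan : finite_set (rays D).
Proof. by rewrite rays_normal_fan; apply: finite_image; exact: (finite_dual_vertices rP). Qed.

Lemma prim_gen_rays_normal_fan : prim_gen @` rays D = V.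
Proof.
rewrite rays_normal_fan; apply/seteqP; split => [_ [_ [v Vv <-] <-]|v Vv].
  by rewrite prim_gen_dual_vertex.
by exists (pos [set v]); rewrite ?prim_gen_dual_vertex//; exists v.
Qed.

Lemma span_normal_fan : pos (prim_gen @` rays D) = setT.
Proof. by rewrite prim_gen_rays_normal_fan; exact: (dual_pos_setT rP). Qed.

Lemma sum_rays_normal_fan (W : nmodType) (f : 'rV[R]_d -> W) :
  \sum_(t \in rays D) f (prim_gen t) = \sum_(v \in V) f v.
Proof.
rewrite rays_normal_fan fsbig_image; last exact: pos1_inj.
by apply: eq_fsbigr => v /set_mem Vv; rewrite prim_gen_dual_vertex.
Qed.

Definition polytope_root eta x : Prop :=
  [/\ lattice x, V eta, pairing eta x = -1 &
      forall v, V v -> v != eta -> 0 <= pairing v x].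

Lemma polytope_rootP x : fan_roots D x <-> exists eta, polytope_root eta x.
Proof.
split=> [/fan_rootsP[t [lx Dt tx h]]|[eta [lx Ve ex h]]].
  have : (prim_gen @` rays D) (prim_gen t) by exists t.
  rewrite prim_gen_rays_normal_fan => Vt; exists (prim_gen t); split => // v Vv vt.
  have Dv : rays D (pos [set v]) by rewrite rays_normal_fan; exists v.
  rewrite -(prim_gen_dual_vertex Vv); apply: h => // vE.
  by move: vt; rewrite -vE prim_gen_dual_vertex// eqxx.
apply/fan_rootsP; exists (pos [set eta]); split => //.
- by rewrite rays_normal_fan; exists eta.
- by rewrite prim_gen_dual_vertex.
- rewrite rays_normal_fan => _ [v Vv <-] ve; rewrite prim_gen_dual_vertex//; apply: h => //.
  by apply/eqP => vE; apply: ve; rewrite vE.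
Qed.

Variables (eta x : 'rV[R]_d).
Hypothesis rx : polytope_root eta x.

Lemma root_lattice : lattice x. Proof. by have [] := rx. Qed.
Lemma root_vertex : V eta. Proof. by have [] := rx. Qed.
Lemma root_pairing : pairing eta x = -1. Proof. by have [] := rx. Qed.
Lemma root_ge0 v : V v -> v != eta -> 0 <= pairing v x.
Proof. by have [_ _ _] := rx; apply. Qed.
Local Hint Resolve root_lattice root_vertex root_pairing : core.

Lemma root_int v : V v -> pairing v x \is a Num.int.
Proof. by move=> /(lattice_dual_vertices rP) lv; exact: pairing_int. Qed.

Lemma root_geN1 v : V v -> -1 <= pairing v x.
Proof.
move=> Vv; have [->|ve] := eqVneq v eta; first by rewrite root_pairing.
by apply: (le_trans _ (root_ge0 Vv ve)); rewrite lerN10.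
Qed.

Lemma root_pos_neq v : 0 < pairing v x -> v != eta.
Proof. by apply: contraTneq => ->; rewrite root_pairing ltr0N1. Qed.

Lemma facet_at_root : facet_at P x = facet_of P eta.
Proof.
have Fx : is_facet P (facet_of P eta) /\ facet_of P eta x.
  split; first by apply/(is_facetP rP); exists eta.
  split; last exact: root_pairing.
  by apply/(bidual rP) => v; exact: root_geN1.
rewrite /facet_at; case: xgetP => [F _ [/(is_facetP rP)[v Vv ->] [_ /= vx]]|/(_ (facet_of P eta))//].
have [->//|ve] := eqVneq v eta.
by have := root_ge0 Vv ve; rewrite vx ler0N1.
Qed.

Lemma opp_root_sum_vertices :
  fan_roots D (- x) <-> \sum_(v \in V) pairing v x = 0.
Proof.
rewrite -(sum_rays_normal_fan (fun v => pairing v x)).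
apply: iff_sym; have /fan_rootsP[t rt] : fan_roots D x by apply/polytope_rootP; exists eta.
exact: (opp_rootP finite_rays_normal_fan rt).
Qed.

Lemma opp_root_balanced : fan_roots D (- x) <-> exists v,
  [/\ V v, pairing v x = 1 & forall w, V w -> w != eta -> w != v -> pairing w x = 0].
Proof.
rewrite opp_root_sum_vertices (sum_eq0_single_neg (finite_dual_vertices rP) root_vertex)//.
- split=> -[v [Vv vx h]]; exists v; split => // w Vw.
    by move=> /eqP we /eqP wv; exact: h.
  by move=> /eqP we /eqP wv; exact: h.
- by move=> v; exact: root_int.
- by move=> v Vv /eqP; exact: root_ge0.
Qed.

Lemma exists_positive_vertex : exists2 v, V v & 0 < pairing v x.
Proof.
apply: contrapT => /forall2NP h; have /eqP : - x = 0.
  apply: (pos_setT_eq0 (dual_pos_setT rP)) => v Vv.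
  by rewrite pairingNr oppr_ge0 leNgt; apply/negP; have [|] := h v.
by rewrite oppr_eq0 => /eqP x0; move: root_pairing; rewrite x0 pairing0r => /eqP; rewrite eq_sym oppr_eq0 oner_eq0.
Qed.

(** Along [x] only the constraint of [eta] tightens, and at unit rate, so its slack is the available
    length. *)
Lemma root_translate z t : P z -> 0 <= t <= pairing eta z + 1 -> P (z + t *: x).
Proof.
move=> Pz /andP[t0 te]; apply/(bidual rP) => v Vv.
rewrite pairingDr pairingZr; have [->|ve] := eqVneq v eta.
  by rewrite root_pairing mulrN1; lra.
have vz : -1 <= pairing v z by move/(bidual rP) : Pz; exact.
by apply: (le_trans vz); rewrite lerDl mulr_ge0// root_ge0.
Qed.

(** Common end of three criteria. Flipping a lattice point [z] of the facet of [eta] onto the wall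
    of [v] stays above the wall of [w] only if [<v, z> <= <w, z>]. Exchanging the roles gives
    equality on a basis, so only one normal is positive on [x]. *)
Lemma opp_root_of_flip :
  (forall v, V v -> 0 < pairing v x -> pairing v x = 1 /\
     forall z, lattice z -> facet_of P eta z -> P (z - (pairing v z + 1) *: x)) ->
  fan_roots D (- x).
Proof.
move=> flip; apply/opp_root_balanced; have [v Vv vx0] := exists_positive_vertex.
have [vx1 vflip] := flip v Vv vx0; exists v; split => // w Vw we wv.
apply/eqP/negPn/negP => wx; have wx0 : 0 < pairing w x.
  by rewrite lt_neqAle eq_sym wx root_ge0.
have [wx1 wflip] := flip w Vw wx0; case/eqP: wv.
have [B uB BF] := facet_spanning rP root_vertex.
apply/eqP; rewrite -subr_eq0; apply/eqP/(unitmx_pairing_eq0 uB) => i.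
have [li Fi] := BF i; rewrite pairingBl; apply/eqP; rewrite subr_eq0; apply/eqP.
have /(bidual rP)/(_ _ Vw) := vflip _ li Fi.
have /(bidual rP)/(_ _ Vv) := wflip _ li Fi.
rewrite !pairingBr !pairingZr wx1 vx1 !mulr1; lra.
Qed.

Lemma root_dual_ge y : Ps y -> -1 <= pairing y x.
Proof.
rewrite (dual_conv_vertices rP) pairingC => h; apply: conv_ge h => v Vv.
by rewrite pairingC; exact: root_geN1.
Qed.

Lemma root_dual_min y : Ps y -> pairing y x = -1 -> y = eta.
Proof.
move=> Py yx; have : (conv V `&` [set y | pairing x y = -1]) y.
  by rewrite -(dual_conv_vertices rP); split => //=; rewrite pairingC.
rewrite conv_face; last by move=> v Vv; rewrite pairingC; exact: root_geN1.
move=> [n [a [w [_ a1 wV ->]]]].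
rewrite (eq_bigr (fun i => a i *: eta)) -?scaler_suml ?a1 ?scale1r//.
move=> i _; congr (_ *: _); have [Vw /= wx] := wV i.
apply/eqP/negPn/negP => we; have := root_ge0 Vw we.
by rewrite pairingC wx ler0N1.
Qed.

(** Lattice points of the dual pair with [x] to integers at least -1, and to -1 only at [eta], so
    the same count as for normals applies. If [- x] is a root at [v], the pairing is also at most 1
    on the dual, with value 1 only at [v], so the remaining lattice points pair to 0. *)
Lemma opp_root_sum_lattice :
  fan_roots D (- x) <-> \sum_(y \in Ps `&` lattice) pairing y x = 0.
Proof.
have VPs v : V v -> (Ps `&` lattice) v.
  by move=> Vv; split; [exact: (dual_vertex_dual rP)|exact: (lattice_dual_vertices rP)].
have Psint y : (Ps `&` lattice) y -> pairing y x \is a Num.int.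
  by move=> [_ ly]; exact: pairing_int.
rewrite (sum_eq0_single_neg (dual_finite_lattice rP) (VPs _ root_vertex))//; last first.
  move=> y [Py ly] ye; apply: int_gtN1_ge0; first exact: Psint.
  by rewrite lt_neqAle root_dual_ge// andbT; apply/eqP => /esym/root_dual_min h; exact: ye (h Py).
rewrite opp_root_balanced; split=> -[v [Vv vx h]].
  exists v; split => //; first exact: VPs.
  move=> y [Py ly] ye yv.
  have ge0 : 0 <= pairing y x.
    apply: int_gtN1_ge0; first exact: Psint.
    by rewrite lt_neqAle root_dual_ge// andbT; apply/eqP => /esym/root_dual_min h'; exact: ye (h' Py).
  apply/eqP; rewrite eq_le ge0 andbT leNgt; apply/negP => gt0.
  have ge1 : 1 <= pairing y x by apply: int_gt0_ge1 => //; exact: Psint.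
  have le1 w : V w -> -1 <= pairing (- x) w.
    move=> Vw; rewrite pairingNl pairingC lerN2.
    have [->|we] := eqVneq w eta; first by rewrite root_pairing; lra.
    have [->|wv] := eqVneq w v; first by rewrite vx.
    by rewrite h// ler01.
  have yP : conv V y by rewrite -(dual_conv_vertices rP).
  have : (conv V `&` [set y | pairing (- x) y = -1]) y.
    split => //=; apply: le_anti; rewrite (conv_ge le1 yP) andbT.
    by rewrite pairingNl pairingC lerN2.
  rewrite conv_face// => -[n [a [w [_ a1 wV yE]]]]; apply: yv; rewrite yE.
  rewrite (eq_bigr (fun i => a i *: v)) -?scaler_suml ?a1 ?scale1r//.
  move=> i _; congr (_ *: _); have [Vw /=] := wV i.
  rewrite pairingNl pairingC => /oppr_inj wx.
  apply/eqP/negPn/negP => wv; have [we|we] := eqVneq (w i) eta.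
    by move: wx; rewrite we root_pairing => wx; exfalso; lra.
  by move: wx; rewrite h// => /eqP; rewrite eq_sym oner_eq0.
(* The single positive lattice point is a vertex, since some vertex is positive on [x]. *)
have [w Vw wx] := exists_positive_vertex.
have wv : w = v.
  apply: contrapT => wv; have we : w <> eta by apply/eqP/root_pos_neq.
  by move: wx; rewrite h ?ltxx//; exact: VPs.
exists w; rewrite wv in Vw *; split => // w' Vw' /eqP w'e /eqP w'v.
by apply: h => //; exact: VPs.
Qed.

End polytope_roots.

(** * Criteria by counting and summing lattice points of the polytope *)

Section polytope_root_criteria.
Context {R : realType} {d' : nat}.
Local Notation d := d'.+1.
Implicit Types (u v w x y z m eta q : 'rV[R]_d).
Variable P : set 'rV[R]_d.
Hypothesis rP : reflexive_polytope P.
Local Notation V := (vertices (dual_polytope P)).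
Local Notation D := (normal_fan P).
Variables (eta x : 'rV[R]_d).
Hypothesis rx : polytope_root P eta x.
Let lx : lattice x := root_lattice rx.
Let Veta : V eta := root_vertex rx.
Let eta_x : pairing eta x = -1 := root_pairing rx.

Lemma vertex_int v z : V v -> lattice z -> pairing v z + 1 \is a Num.int.
Proof.
move=> Vv lz.
exact: (rpredD (pairing_int (lattice_dual_vertices rP Vv) lz) (rpred1 _)).
Qed.

Lemma vertex_ge v z : V v -> P z -> 0 <= pairing v z + 1.
Proof. by move=> Vv /(bidual rP)/(_ _ Vv); lra. Qed.

(** Projection along [x] onto the hyperplane of the facet of [eta]; the coefficient is the slack of
    [z], which [x] consumes at unit rate. *)
Definition push z := z + (pairing eta z + 1) *: x.

Lemma push_facet z : P z -> facet_of P eta (push z).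
Proof.
move=> Pz; split; last by rewrite /= /push pairingDr pairingZr eta_x; ring.
by apply: (root_translate rP rx) => //; rewrite lexx andbT vertex_ge.
Qed.

Lemma lattice_push z : lattice z -> lattice (push z).
Proof.
by move=> lz; apply: latticeD => //; apply: latticeZ => //; exact: vertex_int.
Qed.

(** Points of the facet of [v] all start at level -1 for [v], so the level of the image reveals how
    far the point was pushed. *)
Lemma push_inj v z z' : V v -> 0 < pairing v x -> facet_of P v z -> facet_of P v z' ->
  push z = push z' -> z = z'.
Proof.
move=> Vv vx [_ /= vz] [_ /= vz'] pE.
have tE : pairing eta z + 1 = pairing eta z' + 1.
  move/(congr1 (pairing v)): pE; rewrite !pairingDr !pairingZr vz vz'.
  by move=> /addrI; apply: mulIf; rewrite gt_eqF.
by move: pE; rewrite /push tE => /addIr.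
Qed.

(** For each [v] positive on [x], [push] embeds the lattice points of the facet of [v] into those of
    the facet of [eta]. Equal finite cardinalities make it onto, and its inverse is the flip.
    Conversely, if [v] is the only positive normal, sliding back to its wall meets no other
    obstacle. *)
Lemma opp_root_facet_card : fan_roots D (- x) <->
  forall F, is_facet P F -> 0 < pairing (inner_normal F) x ->
    (F `&` lattice #= facet_at P x `&` lattice)%card.
Proof.
rewrite (facet_at_root rP rx); split.
  move=> /(opp_root_balanced rP rx)[v [Vv vx h]] F /(is_facetP rP)[w Vw ->].
  rewrite inner_normal_facet// => wx.
  have wv : w = v.
    apply/eqP/negPn/negP => wv; have we := root_pos_neq rx wx.
    by move: wx; rewrite h ?ltxx.
  subst w; suff -> : facet_of P eta `&` lattice = push @` (facet_of P v `&` lattice).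
    apply: card_esym; apply: inj_card_eq => z z' /set_mem[Fz _] /set_mem[Fz' _].
    exact: push_inj Fz Fz'.
  apply/seteqP; split; last first.
    by move=> _ [z [[Pz _] lz] <-]; split; [exact: push_facet|exact: lattice_push].
  move=> z [[Pz /= ez] lz]; exists (z - (pairing v z + 1) *: x); last first.
    rewrite /push pairingBr pairingZr ez eta_x.
    have -> : -1 - (pairing v z + 1) * -1 + 1 = pairing v z + 1 by ring.
    by rewrite subrK.
  have vint : pairing v z + 1 \is a Num.int.
    exact: vertex_int.
  split; last by apply: latticeB => //; exact: latticeZ.
  split; last by rewrite /= pairingBr pairingZr vx; ring.
  apply/(bidual rP) => u Vu; rewrite pairingBr pairingZr.
  have [->|ue] := eqVneq u eta.
    by rewrite ez eta_x; have := vertex_ge Vv Pz; lra.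
  have [->|uv] := eqVneq u v; first by rewrite vx; lra.
  by rewrite h// mulr0 subr0; move/(bidual rP): Pz; exact.
move=> cardF.
have surj v : V v -> 0 < pairing v x -> forall z, lattice z -> facet_of P eta z ->
    exists2 y, facet_of P v y /\ lattice y & push y = z.
  move=> Vv vx z lz Fz.
  have fc := cardF (facet_of P v) (proj2 (is_facetP rP _) (ex_intro2 _ _ v Vv erefl)).
  rewrite inner_normal_facet// in fc; have {}fc := fc vx.
  have : (facet_of P eta `&` lattice `<=` push @` (facet_of P v `&` lattice)).
    apply: subset_card_eq.
    - apply: sub_finite_set (polytope_finite_lattice rP) => y [[Py _] ly]; by split.
    - by move=> _ [y [[Py _] ly] <-]; split; [exact: push_facet|exact: lattice_push].
    - apply: card_eq_trans fc; apply: inj_card_eq => y y' /set_mem[Fy _] /set_mem[Fy' _].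
      exact: push_inj Fy Fy'.
  by move=> /(_ z (conj Fz lz)) [y Fy yz]; exists y.
have Fx : facet_of P eta x.
  by split => //; apply/(bidual rP) => v; exact: (root_geN1 rx).
apply: (opp_root_of_flip rP rx) => v Vv vx.
(* The point [y] pushed onto [x] satisfies [<eta, y> * <v, x> = 1] in integers. *)
have vx1 : pairing v x = 1.
  have [y [[_ /= vy] ly] yx] := surj v Vv vx x lx Fx.
  have tint : pairing eta y \is a Num.int.
    by apply: pairing_int => //; exact: (lattice_dual_vertices rP).
  have vint := root_int rP rx Vv.
  move/(congr1 (pairing v)): yx; rewrite pairingDr pairingZr vy => yx.
  have : pairing v x * (- pairing eta y) = -1 by lra.
  have : 1 <= pairing v x by exact: int_gt0_ge1.
  have [t0|t0] := ltP 0 (pairing eta y).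
    have := int_gt0_ge1 tint t0.
    nra.
  by nra.
split => // z lz Fz; have [y [[Py /= vy] ly] yz] := surj v Vv vx z lz Fz.
suff -> : z - (pairing v z + 1) *: x = y by [].
rewrite -yz /push pairingDr pairingZr vx1 vy.
have -> : -1 + (pairing eta y + 1) * 1 + 1 = pairing eta y + 1 by ring.
by rewrite addrK.
Qed.

(** [t m] and [g m] count the unit steps from [m] to the wall of [eta] along [x] and to the wall of
    [v] against [x]; [T] exchanges them. The sum of [g - t] is nonnegative by reflection and bounded
    above through the vanishing sum of lattice points, which forces [k = 1] and equality. *)
Lemma opp_root_sum_polytope_lattice :
  \sum_(m \in P `&` lattice) m = 0 -> fan_roots D (- x).
Proof.
move=> sum0; have fA := polytope_finite_lattice rP.
apply: (opp_root_of_flip rP rx) => v Vv vx.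
set k := pairing v x in vx *.
(* On lattice points the floor in [t] changes nothing; it makes [T] an involution of the whole
   space, as [sum_reflection] asks. *)
pose t m : R := (Num.floor (pairing eta m + 1))%:~R.
pose g m : R := (Num.floor ((pairing v m + 1) / k))%:~R.
pose T m := m + (t m - g m) *: x.
have k0 : k != 0 by rewrite gt_eqF.
have floorD (a b : R) : b \is a Num.int -> (Num.floor (a + b))%:~R = (Num.floor a)%:~R + b.
  by move=> ib; rewrite (real_floorDrz (num_real a) ib) intrD (floorK ib).
have itg m : t m - g m \is a Num.int by rewrite /t /g -intrB intr_int.
have igt m : g m - t m \is a Num.int by rewrite /t /g -intrB intr_int.
have tT m : t (T m) = g m.
  rewrite {1}/t (_ : _ + 1 = pairing eta m + 1 + (g m - t m)); last first.
    by rewrite /T pairingDr pairingZr eta_x; ring.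
  by rewrite floorD// -/(t m) addrC subrK.
have gT m : g (T m) = t m.
  rewrite {1}/g (_ : _ / k = (pairing v m + 1) / k + (t m - g m)); last first.
    by rewrite /T pairingDr pairingZr -/k; field.
  by rewrite floorD// -/(g m) addrC subrK.
have TT : involutive T.
  by move=> m; rewrite {1}/T tT gT /T -addrA -scalerDl addrA subrK subrr scale0r addr0.
have etaint m : lattice m -> pairing eta m + 1 \is a Num.int.
  exact: vertex_int.
have tE m : lattice m -> t m = pairing eta m + 1.
  by move=> lm; rewrite /t floorK// etaint.
have g_ge0 m : P m -> 0 <= g m.
  by move=> Pm; rewrite /g ler0z real_floor_ge0 ?num_real// divr_ge0 ?vertex_ge// ltW.
have AT m : (P `&` lattice) m -> g m - t m <= 0 -> (P `&` lattice) (T m).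
  move=> [Pm lm]; rewrite subr_le0 => gt; split; last by apply: latticeD => //; exact: latticeZ.
  apply: (root_translate rP rx) => //; rewrite subr_ge0 gt/= tE// lerBlDr lerDl.
  exact: g_ge0.
have phiT m : g (T m) - t (T m) = - (g m - t m) by rewrite gT tT opprB.
have [ge0 eq0] := sum_reflection fA TT phiT AT.
have [r ur rE] := finite_uniq_seq fA.
rewrite !(fsum_seq _ ur rE) in sum0 ge0 eq0.
have rP' m : m \in r -> (P `&` lattice) m by rewrite rE.
(* Dropping the floor in [g] leaves an affine function of [m], whose linear part sums to zero over
   the lattice points of [P]. *)
have le : \sum_(m <- r) (g m - t m) <= (k^-1 - 1) *+ size r.
  have -> : (k^-1 - 1) *+ size r =
      \sum_(m <- r) ((pairing v m + 1) / k - (pairing eta m + 1)).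
    rewrite sumrB -mulr_suml !big_split/= -!pairing_sumr sum0 !pairing0r !add0r.
    by rewrite !big_const_seq !count_predT !iter_addr_0 mulrnBl mulrnAl mul1r.
  rewrite big_seq [leRHS]big_seq; apply: ler_sum => m /rP'[Pm lm].
  by rewrite tE// lerD2r /g real_floor_le ?num_real.
have r0 : (0 < size r)%N.
  have : 0 \in r by have : (P `&` lattice) 0; [split; [exact: polytope0|exact: lattice0]|rewrite rE].
  by case: (r).
have kint : k \is a Num.int by exact: (root_int rP rx).
have k1 : k = 1.
  apply: le_anti; rewrite int_gt0_ge1// andbT.
  have : 0 <= (k^-1 - 1) *+ size r by exact: le_trans le.
  by rewrite pmulrn_lge0// subr_ge0 invf_ge1.
split => // z lz Fz.
have sum_eq0 : \sum_(m <- r) (g m - t m) = 0.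
  by apply: le_anti; rewrite ge0 andbT (le_trans le)// k1 invr1 subrr mul0rn.
have [Pz /= ez] := Fz.
have [+ _] := eq0 sum_eq0 z (conj Pz lz).
rewrite /T tE// ez addNr sub0r /g k1 divr1 floorK ?scaleNr//.
exact: vertex_int.
Qed.

End polytope_root_criteria.

(** * Reflections of polytopes given by inequalities *)

Section halfspace_polytopes.
Context {R : realType} {n : nat}.
Implicit Types (x y z w u : 'rV[R]_n) (s : seq 'rV[R]_n).
Local Notation mrV := (@mrV R).
Local Notation mu := (@rV_measure R).

Lemma measurable_halfspaces (l : seq ('rV[R]_n * R)) :
  measurable (halfspaces l : set (mrV n)).
Proof.
elim: l => [|[a b] l IH].
  by rewrite (_ : halfspaces _ = setT)//; apply/seteqP; split.
have -> : halfspaces ((a, b) :: l) =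
    [set x : mrV n | 0 <= pairing a x + b] `&` (halfspaces l : set (mrV n)).
  apply/seteqP; split => x.
    by move=> h; split; [exact: (h _ (mem_head _ _))|move=> p pl; apply: h; rewrite inE pl orbT].
  by move=> [h1 h2] p; rewrite inE => /orP[/eqP ->//|]; exact: h2.
apply: measurableI => //; apply: measurable_ler_fun => //.
by apply: measurable_funD => //; exact: measurable_pairing.
Qed.

Lemma halfspaces_box (l : seq ('rV[R]_n * R)) y :
  {in l, forall p, 0 < pairing p.1 y + p.2} ->
  exists2 e, 0 < e & forall x, box y e x -> {in l, forall p, e <= pairing p.1 x + p.2}.
Proof.
elim: l => [|[a b] l IH] h; first by exists 1.
have [e e0 he] : exists2 e, 0 < e &
    forall x, box y e x -> {in l, forall p, e <= pairing p.1 x + p.2}.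
  by apply: IH => p pl; apply: h; rewrite inE pl orbT.
have := h _ (mem_head _ _); rewrite /=; set c := pairing a y + b => c0.
pose S := \sum_i `|a ord0 i|.
have S0 : 0 <= S by rewrite sumr_ge0.
(* On a box of radius [r] the affine function drops by at most [S * r], so it stays at least
   [c - S * e' = e']. *)
pose e' := c / (1 + S); have e'0 : 0 < e' by rewrite divr_gt0// ltr_pwDl.
have e'E : e' * (1 + S) = c by rewrite divfK// gt_eqF// ltr_pwDl.
exists (Num.min e e'); first by rewrite lt_min e0.
move=> x bx p; rewrite inE => /orP[/eqP ->/=|pl]; last first.
  rewrite (@le_trans _ _ e)// ?ge_min ?lexx//; apply: he pl => i.
  by apply: (le_trans (bx i)); rewrite ge_min lexx.
have bd : `|pairing a (x - y)| <= S * Num.min e e'.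
  by apply: pairing_box => i; have := bx i; rewrite !mxE subr0.
have : S * Num.min e e' <= S * e' by rewrite ler_wpM2l// ge_min lexx orbT.
have : Num.min e e' <= e' by rewrite ge_min lexx orbT.
move: bd; rewrite pairingBr ler_norml => /andP[bd _].
move: e'E; rewrite /c; lra.
Qed.

Lemma pairing_mulmxr (w y : 'rV[R]_n) (A : 'M[R]_n) :
  pairing w (y *m A) = pairing (w *m A^T) y.
Proof. by rewrite !pairing_mulmx trmx_mul mulmxA. Qed.

(** Allows a point to be pulled slightly towards 0 without losing a strict inequality, while every
    constraint with constant term 1 becomes strict. *)
Lemma segment_positive (f : 'rV[R]_n -> R) (b : R) u y :
  (forall x, f x = pairing u x + b) -> 0 < f y ->
  exists2 e, 0 < e & forall t, 0 <= t <= e -> 0 < f ((1 - t) *: y).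
Proof.
move=> fE fy.
have [e e0 he] : exists2 e, 0 < e & {in [:: (f y / 2, pairing u y)], forall p, e * `|p.2| <= p.1}.
  apply: small_perturbation => p; rewrite inE => /eqP -> /=; split; first by lra.
  by move=> fy0; exfalso; lra.
exists e => // t /andP[t0 te]; have /= := he _ (mem_head _ _).
have : t * `|pairing u y| <= e * `|pairing u y| by rewrite ler_wpM2r.
rewrite (fE (_ *: _)) pairingZr; have := fE y.
have : t * pairing u y <= t * `|pairing u y| by rewrite ler_wpM2l// ler_norm.
lra.
Qed.

(** Common form of [P], with the vertices of the dual as [s], and of the dual, with generators of
    [P]. *)
Definition unit_halfspaces s : set 'rV[R]_n := [set y | {in s, forall w, -1 <= pairing w y}].

Lemma measurable_unit_halfspaces s : measurable (unit_halfspaces s : set (mrV n)).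
Proof.
rewrite (_ : unit_halfspaces s = halfspaces [seq (w, 1) | w <- s]).
  exact: measurable_halfspaces.
apply/seteqP; split => y h; first by move=> _ /mapP[w ws ->] /=; have := h w ws; lra.
by move=> w ws; have /= := h _ (map_f (fun w => (w, 1)) ws); lra.
Qed.

(** The linear part of an involution squares to the identity, whence the determinant. If [T y]
    violated a constraint, pulling [y] towards 0 would give a box inside [Q], with [phi] bounded
    below, whose image entirely violates that constraint; a vanishing integral excludes such a
    box. *)
Lemma reflection_unit_halfspaces u (b : R) (A : 'M[R]_n) (c : 'rV[R]_n) s e
    (Q := unit_halfspaces s : set (mrV n))
    (phi := fun x : 'rV[R]_n => pairing u x + b)
    (T := fun x : 'rV[R]_n => x *m A + c) :
  0 <= e -> Q `<=` box 0 e ->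
  (forall x, phi (T x) = - phi x) -> (forall x, T (T x) = x) ->
  (forall x, phi x < 0 -> Q x -> Q (T x)) ->
  (0 <= \int[mu n]_x (phi x * \1_Q x)%:E)%E /\
  ((\int[mu n]_x (phi x * \1_Q x)%:E = 0)%E ->
   forall y, Q y -> 0 < phi y -> Q (T y)).
Proof.
move=> e0 Qe phiT TT QT.
have dA : `|\det A| = 1.
  have AA : A *m A = 1%:M.
    apply/row_matrixP => i; have := TT (delta_mx ord0 i); have := TT 0.
    rewrite /T mul0mx add0r => cE; rewrite mulmxDl -addrA cE addr0 -mulmxA.
    by rewrite -!rowE => ->; rewrite rowE mulmx1.
  have : `|\det A| ^+ 2 = 1 by rewrite -normrX expr2 -det_mulmx AA det1 normr1.
  by move=> /eqP; rewrite pexpr_eq1// => /eqP.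
have [int0 strict] := integral_reflection (measurable_unit_halfspaces s) e0 Qe dA phiT TT QT.
split => // I0 y Qy phiy; apply: contrapT => /existsNP[w /not_implyP[ws /negP]].
rewrite -ltNge => wTy.
have fE x : -1 - pairing w (T x) = pairing (- (w *m A^T)) x + (-1 - pairing w c).
  by rewrite /T pairingDr pairing_mulmxr pairingNl; ring.
have fy : 0 < -1 - pairing w (T y) by lra.
have [e1 e10 h1] := segment_positive (fun x => erefl : phi x = _) phiy.
have [e2 e20 h2] := segment_positive fE fy.
(* The bound 1/2 keeps the factor [1 - t] positive; [e1] and [e2] preserve the sign of [phi] and the
   violated constraint. *)
pose t := Num.min (Num.min e1 e2) (1 / 2).
have t0 : 0 < t by rewrite !lt_min e10 e20/= divr_gt0.
have t_e1 : t <= e1 by rewrite !ge_min lexx.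
have t_e2 : t <= e2 by rewrite !ge_min lexx orbT.
have t_1 : t <= 1 / 2 by rewrite !ge_min lexx !orbT.
pose y1 := (1 - t) *: y.
pose l := [:: (u, b); (- (w *m A^T), -1 - pairing w c)] ++ [seq (w, 1) | w <- s].
have [d d0 hd] : exists2 d, 0 < d &
    forall x, box y1 d x -> {in l, forall p, d <= pairing p.1 x + p.2}.
  apply: halfspaces_box => p; rewrite mem_cat !inE => /orP[/orP[/eqP ->|/eqP ->]|] /=.
  - by have := h1 t; rewrite ltW// t_e1; exact.
  - by rewrite -fE; have := h2 t; rewrite ltW// t_e2; exact.
  - move=> /mapP[w' w's ->] /=; rewrite pairingZr; have := Qy w' w's.
    have : 0 <= 1 - t by lra.
    by nra.
have box_in x : box y1 d x -> Q x /\ d <= phi x.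
  move=> bx; split; last by apply: (hd x bx (u, b)); exact: mem_head.
  move=> w' w's; have /= := hd x bx (w', 1).
  by rewrite mem_cat (map_f (fun w => (w, 1)) w's) orbT => /(_ isT); lra.
have [x bx QTx] := strict I0 y1 d d0 box_in.
have := hd x bx (- (w *m A^T), -1 - pairing w c).
rewrite !inE eqxx orbT => /(_ isT) /=; rewrite -fE; have := QTx w ws; lra.
Qed.

End halfspace_polytopes.

(** * Criteria by barycenters *)

Section barycenter_criteria.
Context {R : realType} {d' : nat}.
Local Notation d := d'.+1.
Local Notation mu := (@rV_measure R).
Implicit Types (u v w x y z eta q : 'rV[R]_d).
Variable P : set 'rV[R]_d.
Hypothesis rP : reflexive_polytope P.
Local Notation Ps := (dual_polytope P).
Local Notation V := (vertices (dual_polytope P)).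
Local Notation D := (normal_fan P).

Lemma polytope_unit_halfspaces : exists2 s, P = unit_halfspaces s & [set` s] = V.
Proof.
have [s _ sE] := finite_uniq_seq (finite_dual_vertices rP).
exists s => //; apply/seteqP; split => x.
  by move=> /(bidual rP) h w ws; apply: h; rewrite sE.
by move=> h; apply/(bidual rP) => v; rewrite sE; exact: h.
Qed.

Lemma dual_unit_halfspaces : exists2 s, Ps = unit_halfspaces s & P = conv [set` s].
Proof.
have [s [_ [_ [_ _ _ PE _]]]] := reflexive_generators rP; exists s => //.
by rewrite PE; apply/seteqP; split => y /dual_conv.
Qed.

Lemma polytope_bounded : exists2 C, 0 <= C & P `<=` box 0 C.
Proof. by have [s [_ [_ [_ _ _ -> _]]]] := reflexive_generators rP; exact: conv_bounded. Qed.

Lemma dual_bounded : exists2 C, 0 <= C & Ps `<=` box 0 C.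
Proof. by have [_ [s [_ [_ _ _ _ ->]]]] := reflexive_generators rP; exact: conv_bounded. Qed.

Variables (eta x : 'rV[R]_d).
Hypothesis rx : polytope_root P eta x.
Let lx : lattice x := root_lattice rx.
Let Veta : V eta := root_vertex rx.
Let eta_x : pairing eta x = -1 := root_pairing rx.

Lemma pairing_push_dual y z : Ps y -> P z ->
  -1 <= pairing y z + (pairing eta z + 1) * pairing y x.
Proof.
move=> Py Pz; have := Py _ (proj1 (push_facet rP rx Pz)).
by rewrite pairingC /push pairingDr pairingZr.
Qed.

(** Matrix of [y |-> y + <y, x> (eta - w)]. When [<w, x> = 1] this is the reflection exchanging
    [eta] and [w] and fixing the hyperplane orthogonal to [x]. *)
Definition dual_reflection_mx (w : 'rV[R]_d) : 'M[R]_d := 1%:M + x^T *m (eta - w).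

Section dual_reflection.
Variable v : 'rV[R]_d.
Hypothesis Vv : V v.
Hypothesis vx : 0 < pairing v x.
Local Notation w := ((pairing v x)^-1 *: v).
Local Notation T y := (y *m dual_reflection_mx w + 0).

Lemma dual_reflectionE y : T y = y + pairing y x *: (eta - w).
Proof.
rewrite addr0 mulmxDr mulmx1 mulmxA; congr (_ + _).
by rewrite [y *m x^T]mx11_scalar -pairing_mulmx mul_scalar_mx.
Qed.

Let wx : pairing w x = 1.
Proof. by rewrite pairingZl mulVf// gt_eqF. Qed.

Lemma dual_reflection_odd y : pairing (T y) x = - pairing y x.
Proof. by rewrite dual_reflectionE pairingDl pairingZl pairingBl eta_x wx; ring. Qed.

Lemma dual_reflectionK y : T (T y) = y.
Proof.
rewrite dual_reflectionE dual_reflection_odd dual_reflectionE.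
by rewrite scaleNr addrK.
Qed.

(** At a point [z] of [P] the value of [T y] is that of [y] at [push eta x z], which is at least -1,
    minus [<y, x> * (<w, z> + 1)], which is nonpositive. The bound [<w, z> >= -1] uses that the
    integer [<v, x>] is at least 1. *)
Lemma dual_reflection_in y : pairing y x < 0 -> Ps y -> Ps (T y).
Proof.
move=> yx Py z Pz; have := pairing_push_dual Py Pz.
have vz : -1 <= pairing v z by move/(bidual rP) : Pz; exact.
have vx1 : 1 <= pairing v x by apply: int_gt0_ge1 => //; exact: (root_int rP rx).
have wz : -1 <= pairing w z.
  rewrite pairingZl mulrC ler_pdivlMr//; lra.
rewrite dual_reflectionE pairingDr pairingZr pairingBr !(pairingC z).
have : pairing y x * (1 + pairing w z) <= 0 by rewrite nmulr_rle0//; lra.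
lra.
Qed.

Lemma dual_reflection_integral :
  (0 <= \int[mu d]_y (pairing x y * \1_(Ps : set (mrV d)) y)%:E)%E /\
  ((\int[mu d]_y (pairing x y * \1_(Ps : set (mrV d)) y)%:E = 0)%E ->
   forall y, Ps y -> 0 < pairing y x -> Ps (T y)).
Proof.
have [s PsE _] := dual_unit_halfspaces; have [C C0 PsC] := dual_bounded.
have phiE : (fun y : mrV d => (pairing x y * \1_(Ps : set (mrV d)) y)%:E) =
   (fun y : mrV d => ((pairing x y + 0) * \1_(Ps : set (mrV d)) y)%:E).
  by apply/funext => y; rewrite addr0.
have odd y : pairing x (T y) + 0 = - (pairing x y + 0).
  by rewrite addr0 [in RHS]addr0 !(pairingC x) dual_reflection_odd.
have stay y : pairing x y + 0 < 0 -> unit_halfspaces s y -> unit_halfspaces s (T y).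
  by rewrite -PsE addr0 pairingC; exact: dual_reflection_in.
rewrite phiE PsE; rewrite PsE in PsC.
have [h1 h2] := reflection_unit_halfspaces C0 PsC odd dual_reflectionK stay.
split => // I0 y Py yx; apply: (h2 I0) => //.
by rewrite addr0 pairingC.
Qed.

End dual_reflection.

Lemma dual_barycenterE : exists2 m : R, 0 < m &
  (\int[mu d]_y (pairing x y * \1_(Ps : set (mrV d)) y)%:E =
   (pairing (barycenter Ps) x * m)%:E)%E.
Proof.
have [s PsE _] := dual_unit_halfspaces; have [C C0 PsC] := dual_bounded.
have [e e0 eP] := dual_box rP.
have mPs : measurable (Ps : set (mrV d)) by rewrite PsE; exact: measurable_unit_halfspaces.
have m0 := measure_box_gt0 mPs e0 eP.
exists (fine (mu d Ps)); first by rewrite fine_gt0// m0 (measure_box_lty mPs C0 PsC).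
have := integral_affine_barycenter x 0 mPs C0 PsC m0.
by rewrite addr0 pairingC => <-; apply: eq_integral => y _; rewrite addr0.
Qed.

Lemma root_dual_barycenter_ge0 : 0 <= pairing (barycenter Ps) x.
Proof.
have [v Vv vx] := exists_positive_vertex rP rx; have [m m0 E] := dual_barycenterE.
have [+ _] := dual_reflection_integral Vv vx.
by rewrite E lee_fin pmulr_lge0.
Qed.

End barycenter_criteria.

Section barycenter_criteria2.
Context {R : realType} {d' : nat}.
Local Notation d := d'.+1.
Local Notation mu := (@rV_measure R).
Implicit Types (u v w x y z eta q : 'rV[R]_d).
Variable P : set 'rV[R]_d.
Hypothesis rP : reflexive_polytope P.
Local Notation Ps := (dual_polytope P).
Local Notation V := (vertices (dual_polytope P)).
Local Notation D := (normal_fan P).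
Variables (eta x : 'rV[R]_d).
Hypothesis rx : polytope_root P eta x.

(** The pairing is nonnegative for every root, so two opposite roots force it to vanish. Conversely,
    a vanishing integral puts the reflected positive vertices back in the dual, for the reflection
    built from one vertex [w], and identifies all of them with the same multiple of [w]. *)
Lemma opp_root_dual_barycenter :
  fan_roots D (- x) <-> pairing (barycenter Ps) x = 0.
Proof.
split.
  move=> /(polytope_rootP rP)[eta' rx']; apply: le_anti.
  rewrite (root_dual_barycenter_ge0 rP rx) andbT.
  by have := root_dual_barycenter_ge0 rP rx'; rewrite pairingNr oppr_ge0.
move=> b0; have [w Vw wx] := exists_positive_vertex rP rx.
have [m m0 E] := dual_barycenterE rP x.
have [_ strict] := dual_reflection_integral rP rx Vw wx.
have I0 : (\int[mu d]_y (pairing x y * \1_(Ps : set (mrV d)) y)%:E = 0)%E.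
  by rewrite E b0 mul0r.
have {}strict := strict I0.
have PsN1 y : Ps y -> -1 <= pairing y x.
  by move=> Py; rewrite pairingC; apply: Py; apply/(bidual rP) => v; exact: (root_geN1 rx).
(* Reflecting a vertex with [<v,x> > 0] lands at height -1, i.e. at [eta]. *)
have onlyw v : V v -> 0 < pairing v x -> pairing v x = 1 /\ v = (pairing w x)^-1 *: w.
  move=> Vv vx; have Pv := dual_vertex_dual rP Vv.
  have PTv := strict v Pv vx.
  have vx1 : pairing v x = 1.
    apply: le_anti; rewrite int_gt0_ge1 ?(root_int rP rx)// andbT.
    by have := PsN1 _ PTv; rewrite (dual_reflection_odd rx wx); lra.
  split => //; move: PTv; rewrite dual_reflectionE vx1 scale1r => PTv.
  have TvE : v + (eta - (pairing w x)^-1 *: w) = eta.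
    apply: (root_dual_min rP rx) => //; rewrite pairingDl pairingBl pairingZl vx1.
    by rewrite (root_pairing rx) mulVf ?gt_eqF//; ring.
  by apply/eqP; rewrite -subr_eq0 -(inj_eq (addrI eta)) addr0 addrCA TvE.
apply/(opp_root_balanced rP rx); exists w; split => //.
  by have [] := onlyw w Vw wx.
move=> v Vv ve vw; apply/eqP/negPn/negP => vx0.
have vx : 0 < pairing v x by rewrite lt_neqAle eq_sym vx0 (root_ge0 rx).
have [_ vE] := onlyw v Vv vx; have [_ wE] := onlyw w Vw wx.
by move: vw; rewrite vE -wE eqxx.
Qed.

(** Continuous counterpart of the argument on lattice points: with the barycenter at 0 the integral
    of [phi] is the volume times [k^-1 - 1], and it is nonnegative by reflection, so [k = 1] and
    equality holds. *)
Lemma opp_root_barycenter : barycenter P = 0 -> fan_roots D (- x).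
Proof.
move=> b0; have [s PE sV] := polytope_unit_halfspaces rP.
have [C C0 PC] := polytope_bounded rP; have [e e0 eP] := polytope_box rP.
have mP : measurable (P : set (mrV d)) by rewrite PE; exact: measurable_unit_halfspaces.
have m0 := measure_box_gt0 mP e0 eP.
have mf : 0 < fine (mu d P) by rewrite fine_gt0// m0 (measure_box_lty mP C0 PC).
have eta_x := root_pairing rx.
apply: (opp_root_of_flip rP rx) => v Vv vx.
set k := pairing v x in vx *.
have k0 : k != 0 by rewrite gt_eqF.
(* [<u, y> + b] is [(<v, y> + 1) / k - (<eta, y> + 1)]: the distance from [y] to the wall of [v]
   minus that to the wall of [eta], measured in multiples of [x]. Subtracting this multiple of [x]
   exchanges the two distances. *)
pose u := k^-1 *: v - eta; pose b := k^-1 - 1.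
pose A : 'M[R]_d := 1%:M - u^T *m x; pose c := - b *: x.
have TE y : y *m A + c = y - (pairing u y + b) *: x.
  rewrite mulmxBr mulmx1 mulmxA [y *m u^T]mx11_scalar -pairing_mulmx mul_scalar_mx.
  by rewrite (pairingC y) /c scaleNr -addrA -opprD -scalerDl.
have ux : pairing u x = 2.
  by rewrite pairingBl pairingZl mulVf// eta_x opprK.
have phiT y : pairing u (y *m A + c) + b = - (pairing u y + b).
  by rewrite TE pairingBr pairingZr ux; ring.
have TT y : (y *m A + c) *m A + c = y.
  by rewrite [LHS]TE phiT TE scaleNr opprK subrK.
have Tin y : pairing u y + b < 0 -> P y -> P (y *m A + c).
  move=> phiy Py; rewrite TE -scaleNr; apply: (root_translate rP rx) => //.
  rewrite oppr_ge0 ltW//= /u /b pairingBl pairingZl.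
  have := vertex_ge rP Vv Py.
  have : 0 <= k^-1 by rewrite invr_ge0 ltW.
  by nra.
have phiP : (fun y : mrV d => ((pairing u y + b) * \1_(P : set (mrV d)) y)%:E) =
    (fun y : mrV d => ((pairing u y + b) * \1_(unit_halfspaces s : set (mrV d)) y)%:E).
  by rewrite -PE.
rewrite PE in PC Tin.
have [ge0 strict] := reflection_unit_halfspaces C0 PC phiT TT Tin.
rewrite -phiP in ge0 strict; rewrite -PE in PC strict.
rewrite (integral_affine_barycenter u b mP C0 PC m0) b0 pairing0r add0r in ge0 strict.
have kint : k \is a Num.int by exact: (root_int rP rx).
have k1 : k = 1.
  apply: le_anti; rewrite int_gt0_ge1// andbT.
  by move: ge0; rewrite lee_fin pmulr_lge0// subr_ge0 invf_ge1.
have {}strict := strict (congr1 EFin (_ : b * _ = 0)).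
split => // z lz [Pz /= ez].
have phiz : pairing u z + b = pairing v z + 1.
  by rewrite /u /b k1 invr1 scale1r pairingBl ez; ring.
have [z0|z0] := eqVneq (pairing v z + 1) 0; first by rewrite z0 scale0r subr0.
have := strict _ z Pz; rewrite TE phiz; apply.
  by rewrite /b k1 invr1 subrr mul0r.
by rewrite lt_neqAle eq_sym z0 (vertex_ge rP Vv Pz).
Qed.

End barycenter_criteria2.

(** * Facet volumes *)

Section lattice_bases.
Context {R : realType}.

Definition int_mx m n (A : 'M[R]_(m, n)) := forall i j, A i j \is a Num.int.

Lemma int_mxP m n (A : 'M[R]_(m, n)) : int_mx A -> A = map_mx intr (map_mx Num.floor A).
Proof. by move=> iA; apply/matrixP => i j; rewrite !mxE floorK. Qed.

Lemma det_int_mx n (A : 'M[R]_n) : int_mx A -> \det A \is a Num.int.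
Proof. by move=> /int_mxP ->; rewrite det_map_mx intr_int. Qed.

Lemma int_mx_mul m n p (A : 'M[R]_(m, n)) (B : 'M[R]_(n, p)) :
  int_mx A -> int_mx B -> int_mx (A *m B).
Proof. by move=> iA iB i j; rewrite mxE; apply: rpred_sum => k _; exact: rpredM. Qed.

Lemma int_mx_rows k n (B : 'M[R]_(k, n)) : (forall i, lattice (row i B)) <-> int_mx B.
Proof.
split=> [h i j|h i j]; last by rewrite mxE.
by have := h i j; rewrite mxE.
Qed.

Lemma norm_det_unimodular n (A B : 'M[R]_n) : int_mx A -> int_mx B ->
  A *m B = 1%:M -> `|\det B| = 1.
Proof.
move=> iA iB AB; have dAB : `|\det A| * `|\det B| = 1.
  by rewrite -normrM -det_mulmx AB det1 normr1.
have nz (C : 'M[R]_n) : int_mx C -> `|\det C| != 0 -> 1 <= `|\det C|.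
  by move=> iC; rewrite normr_eq0; apply: norm_intr_ge1; exact: det_int_mx.
have A0 : `|\det A| != 0 by apply/eqP => A0; move/eqP: dAB; rewrite A0 mul0r eq_sym oner_eq0.
have B0 : `|\det B| != 0 by apply/eqP => B0; move/eqP: dAB; rewrite B0 mulr0 eq_sym oner_eq0.
have := nz A iA A0; have := nz B iB B0; nra.
Qed.

(** By the Smith form of the single row [v], it is a multiple of the first row of a unimodular
    matrix [U]. In the dual basis [W] the kernel of [v] consists of the combinations of all rows but
    the first. *)
Lemma kernel_Zbasis n (v : 'rV[R]_n.+1) : lattice v -> v != 0 ->
  exists B : 'M[R]_(n, n.+1), is_Zbasis [set m | lattice m /\ pairing v m = 0] B.
Proof.
move=> lv v0.
have iv : int_mx v by move=> i j; rewrite (ord1 i).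
have [L _ [Q uQ [s _ vE]]] := int_Smith_normal_form (map_mx Num.floor v).
pose a : R := (L ord0 ord0 * s`_0)%:~R.
pose U : 'M[R]_n.+1 := map_mx intr Q; pose W : 'M[R]_n.+1 := (map_mx intr (invmx Q))^T.
have vU : v = a *: row ord0 U.
  rewrite [LHS](int_mxP iv) vE; apply/rowP => j; rewrite !mxE /a -intrM; congr (_%:~R).
  rewrite big_ord_recl mxE big_ord1 !mxE eqxx mulr1n big1 ?addr0// => i _.
  by rewrite mxE big_ord1 !mxE mulr0n mulr0 mul0r.
have UW i k : pairing (row i U) (row k W) = (i == k)%:R.
  have : U *m W^T = 1%:M by rewrite /U /W trmxK -map_mxM mulmxV// map_mx1.
  move=> /matrixP/(_ i k); rewrite !mxE => <-.
  by apply: eq_bigr => j _; rewrite !mxE.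
have WU : U^T *m W = 1%:M.
  by rewrite /U /W -trmx_mul -map_mxM mulVmx// map_mx1 trmx1.
have a0 : a != 0 by apply: contra_neq v0 => a0; rewrite vU a0 scale0r.
pose B : 'M[R]_(n, n.+1) := \matrix_i row (lift ord0 i) W.
have UB (z : 'rV[R]_n) i : pairing (row i U) (z *m B) =
    if unlift ord0 i is Some j then z ord0 j else 0.
  rewrite mulmx_sum_row pairing_sumr.
  rewrite (eq_bigr (fun j => z ord0 j * (i == lift ord0 j)%:R)); last first.
    by move=> j _; rewrite rowK pairingZr UW.
  case: unliftP => [j ->|->]; last first.
    by rewrite big1// => j _; rewrite (negbTE (neq_lift _ _)) mulr0.
  rewrite (bigD1 j)//= eqxx mulr1 big1 ?addr0// => k kj.
  by rewrite (inj_eq lift_inj) eq_sym (negbTE kj) mulr0.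
exists B; split.
  apply: row_free_kernel => z zB; apply/rowP => j; rewrite mxE.
  by have := UB z (lift ord0 j); rewrite zB pairing0r liftK => <-.
have iW : int_mx W by move=> i j; rewrite !mxE intr_int.
apply/seteqP; split => [m [lm vm]|_ [z lz <-]]; last first.
  split; last by rewrite vU pairingZl UB unlift_none mulr0.
  have iB : int_mx B by move=> i j; rewrite !mxE intr_int.
  by move=> i; apply: int_mx_mul => // k l; rewrite (ord1 k).
have mU0 : pairing (row ord0 U) m = 0.
  by move/eqP: vm; rewrite vU pairingZl mulf_eq0 (negbTE a0) => /eqP.
exists (\row_j pairing (row (lift ord0 j) U) m).
  move=> j; rewrite mxE; apply: pairing_int => // k.
  by rewrite !mxE intr_int.
rewrite -[RHS]mulmx1 -WU mulmxA [in RHS]mulmx_sum_row big_ord_recl.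
rewrite (_ : (m *m U^T) ord0 ord0 = 0) ?scale0r ?add0r; last first.
  by rewrite -mU0 mxE; apply: eq_bigr => j _; rewrite !mxE mulrC.
rewrite mulmx_sum_row; apply: eq_bigr => j _; rewrite rowK mxE; congr (_ *: _).
by rewrite [RHS]mxE; apply: eq_bigr => k _; rewrite !mxE mulrC.
Qed.

(** Cramer's rule: [M] sends [v] to minus the first unit vector, so applying the adjugate expresses
    [\det M * v_j] as a cofactor along the first row, which is a minor of [B] up to sign. This is
    the factor by which dropping coordinate [j] scales volume on a facet of normal [v]. *)
Lemma det_delete_col n (v p : 'rV[R]_n.+1) (B : 'M[R]_(n, n.+1)) j :
  pairing v p = -1 -> (forall i, pairing v (row i B) = 0) ->
  `|\det (col' j B)| = `|\det (col_mx p B : 'M[R]_(1 + n, n.+1))| * `|v ord0 j|.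
Proof.
move=> vp vB; set M : 'M[R]_n.+1 := col_mx p B.
have Mv : M *m v^T = - delta_mx ord0 ord0.
  apply/colP => i; rewrite [LHS]mxE.
  transitivity (pairing v (row i M)).
    by apply: eq_bigr => k _; rewrite !mxE mulrC.
  case: (fintype.split_ordP (i : 'I_(1 + n))) => k ->.
    by rewrite /M (@rowKu _ 1 n) row_id vp (ord1 k) !mxE eqxx (_ : _ == _ = true)//; exact/eqP/val_inj.
  by rewrite /M (@rowKd _ 1 n) vB !mxE andbT (_ : _ == _ = false) ?oppr0.
have := mul_adj_mx M => /(congr1 (mulmx^~ v^T)).
rewrite -mulmxA Mv mul_scalar_mx mulmxN => /colP/(_ j).
rewrite mxE -colE !mxE /cofactor => E; rewrite -normrM -E normrN normrM.
rewrite normrX normrN1 expr1n mul1r; congr (`|\det _|).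
apply/matrixP => i k; rewrite !mxE.
case: splitP => [l /= |l]; first by rewrite (ord1 l).
by rewrite /= /bump leq0n !add1n => -[/val_inj <-].
Qed.

End lattice_bases.

Section facet_frames.
Context {R : realType} {d' : nat}.
Local Notation d := d'.+1.
Implicit Types (u v w x y z q p : 'rV[R]_d).
Variable P : set 'rV[R]_d.
Hypothesis rP : reflexive_polytope P.
Local Notation V := (vertices (dual_polytope P)).

(** The frame in [rvol] has [aff_dim Q] rows, a size that cannot be rewritten in place; here it
    becomes a free variable. *)
Lemma rvolE (Q : set 'rV[R]_d) k : aff_dim Q = k ->
  rvol Q = let pB : 'rV[R]_d * 'M[R]_(k, d) :=
    xget (0, 0) [set pB | is_lattice_frame Q pB] in
  volume [set t : 'rV[R]_k | Q (pB.1 + t *m pB.2)].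
Proof. by move=> <-. Qed.

Lemma aff_facet v : V v -> aff (facet_of P v) = [set x | pairing v x = -1].
Proof.
move=> Vv; apply/seteqP; split => x.
  move=> [n [a [y [a1 Fy ->]]]]; rewrite /= pairing_sumr.
  rewrite (eq_bigr (fun i => - a i)) ?sumrN ?a1// => i _.
  by have [_ /= vy] := Fy i; rewrite pairingZr vy mulrN1.
move=> /= vx; have [B uB BF] := facet_spanning rP Vv.
pose z := x *m invmx B; have xE : x = z *m B by rewrite mulmxKV.
exists d, (fun i => z ord0 i), (fun i => row i B); split.
- apply: oppr_inj; rewrite -vx xE mulmx_sum_row pairing_sumr -sumrN.
  by apply: eq_bigr => i _; have [_ [_ /= vr]] := BF i; rewrite pairingZr vr mulrN1.
- by move=> i; have [] := BF i.
- by rewrite {1}xE mulmx_sum_row.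
Qed.

Lemma facet_lattice_translate v p : V v -> lattice p -> pairing v p = -1 ->
  [set m - p | m in aff (facet_of P v) `&` lattice] = [set m | lattice m /\ pairing v m = 0].
Proof.
move=> Vv lp vp; rewrite aff_facet//; apply/seteqP; split => m.
  by move=> [q [/= vq lq] <-]; split; [exact: latticeB|rewrite pairingBr vq vp subrr].
move=> [lm vm]; exists (m + p); last by rewrite addrK.
by split; [rewrite /= pairingDr vm vp add0r|exact: latticeD].
Qed.

Lemma exists_lattice_frame v : V v ->
  exists pB : 'rV[R]_d * 'M[R]_(d', d), is_lattice_frame (facet_of P v) pB.
Proof.
move=> Vv; have [B _ BF] := facet_spanning rP Vv; have [lp [_ /= vp]] := BF ord0.
have [C CB] := kernel_Zbasis (lattice_dual_vertices rP Vv) (dual_vertex_neq0 rP Vv).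
exists (row ord0 B, C); split; first by rewrite aff_facet.
by rewrite facet_lattice_translate.
Qed.

(** Adding [<v, m> *: p] to a lattice vector [m] brings it into the kernel of [v]. So [p] and the
    rows of [B] generate the lattice, and an integral matrix with an integral inverse has
    determinant of absolute value 1. *)
Lemma lattice_frame_det v p (B : 'M[R]_(d', d)) : V v ->
  is_lattice_frame (facet_of P v) (p, B) ->
  [/\ pairing v p = -1, forall i, pairing v (row i B) = 0 &
      `|\det (col_mx p B : 'M[R]_(1 + d', d))| = 1].
Proof.
move=> Vv [/= []]; rewrite aff_facet// => /= vp lp [_].
rewrite -(aff_facet Vv) facet_lattice_translate// => kerE.
have rowB i : lattice (row i B) /\ pairing v (row i B) = 0.
  suff : [set m | lattice m /\ pairing v m = 0] (row i B) by [].
  rewrite kerE; exists (delta_mx ord0 i); last by rewrite rowE.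
  by move=> j; rewrite mxE eqxx /= natr_int.
split => //; first by move=> i; have [] := rowB i.
set M : 'M[R]_d := col_mx p B.
have iM : int_mx M.
  apply/int_mx_rows => i; case: (fintype.split_ordP (i : 'I_(1 + d'))) => k ->.
    by rewrite /M (@rowKu _ 1 d') row_id.
  by rewrite /M (@rowKd _ 1 d'); have [] := rowB k.
have combo (m : 'rV[R]_d) : exists z : 'rV[R]_d, lattice m -> lattice z /\ z *m M = m.
  have [lm|nm] := pselect (lattice m); last by exists 0.
  have : [set m | lattice m /\ pairing v m = 0] (m + pairing v m *: p).
    have iv : pairing v m \is a Num.int.
      by apply: pairing_int => //; exact: (lattice_dual_vertices rP).
    split; first by apply: latticeD => //; exact: latticeZ.
    by rewrite pairingDr pairingZr vp mulrN1 subrr.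
  rewrite kerE => -[z lz zB].
  exists (row_mx (- pairing v m)%:M z : 'rV[R]_(1 + d')) => _; split.
    move=> i; case: (fintype.split_ordP (i : 'I_(1 + d'))) => k ->.
      rewrite (@row_mxEl _ 1 1 d') mxE (ord1 k) eqxx mulr1n rpredN.
      by apply: pairing_int => //; exact: (lattice_dual_vertices rP).
    by rewrite (@row_mxEr _ 1 1 d').
  by rewrite /M (@mul_row_col _ 1 1 d') mul_scalar_mx zB scaleNr addrC addrK.
have [Z ZP] := boolp.choice combo.
pose A : 'M[R]_d := \matrix_i Z (delta_mx ord0 i).
have ld i : lattice (delta_mx ord0 i : 'rV[R]_d).
  by move=> j; rewrite mxE eqxx /= natr_int.
apply: (@norm_det_unimodular _ _ A) => //.
  by apply/int_mx_rows => i; rewrite rowK; have [] := ZP _ (ld i).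
apply/row_matrixP => i; rewrite row_mul rowK row1.
by have [] := ZP _ (ld i).
Qed.

End facet_frames.

Lemma seq_argmax (R : realType) (T : eqType) (f : T -> R) (r : seq T) x0 : x0 \in r ->
  exists2 x, x \in r & {in r, forall y, f y <= f x}.
Proof.
elim: r => // a r IH in x0 *; rewrite inE.
case: r IH => [|b r] IH _; first by exists a; rewrite ?mem_head// => y; rewrite inE => /eqP ->.
have [x xr hx] := IH b (mem_head _ _).
have [ax|xa] := leP (f a) (f x).
  by exists x; [rewrite inE xr orbT|move=> y; rewrite inE => /orP[/eqP ->//|]; exact: hx].
exists a; rewrite ?mem_head// => y; rewrite inE => /orP[/eqP ->//|/hx].
by move=> /le_trans; apply; exact: ltW.
Qed.

Lemma ae_in_seq d (T : measurableType d) (R : realType) (mu : {measure set T -> \bar R})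
    (I : eqType) (H : I -> T -> Prop) (l : seq I) :
  {in l, forall p, {ae mu, forall z, H p z}} ->
  {ae mu, forall z, {in l, forall p, H p z}}.
Proof.
elim: l => [|a l IH] h; first by apply: aeW.
have h1 := h a (mem_head _ _).
have h2 : {ae mu, forall z, {in l, forall p, H p z}}.
  by apply: IH => p pl; apply: h; rewrite inE pl orbT.
apply: filterS2 h1 h2 => z hz1 hz2 p.
by rewrite inE => /orP[/eqP ->//|]; exact: hz2.
Qed.

Section coordinate_insertion.
Context {R : realType} {d' : nat}.
Local Notation d := d'.+1.
Implicit Types (j : 'I_d) (t : R) (z : 'rV[R]_d') (v w y : 'rV[R]_d).

Definition ins j t z : 'rV[R]_d :=
  \row_i (if unlift j i is Some k then z ord0 k else t).

Lemma pairing_delete j w y :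
  pairing w y = w ord0 j * y ord0 j + pairing (col' j w) (col' j y).
Proof.
rewrite /pairing (bigD1_ord j)//=; congr (_ + _).
by apply: eq_bigr => i _; rewrite !mxE.
Qed.

Lemma insE j t z : ins j t z ord0 j = t.
Proof. by rewrite mxE unlift_none. Qed.

Lemma delete_ins j t z : col' j (ins j t z) = z.
Proof. by apply/rowP => i; rewrite !mxE liftK. Qed.

Lemma ins_delete j y : ins j (y ord0 j) (col' j y) = y.
Proof.
apply/rowP => i; rewrite !mxE; case: unliftP => [k ->|->//].
by rewrite mxE.
Qed.

Lemma pairing_ins j w t z :
  pairing w (ins j t z) = w ord0 j * t + pairing (col' j w) z.
Proof. by rewrite (pairing_delete j) insE delete_ins. Qed.

End coordinate_insertion.

(** * Projections of facets along a coordinate *)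

Section minkowski.
Context {R : realType} {d' : nat}.
Local Notation d := d'.+1.
Local Notation mu := (@rV_measure R).
Local Notation mrV := (@mrV R).
Implicit Types (u v w x y q p : 'rV[R]_d) (z t : 'rV[R]_d').
Variable P : set 'rV[R]_d.
Hypothesis rP : reflexive_polytope P.
Local Notation V := (vertices (dual_polytope P)).

Section projection.
Variable j : 'I_d.

(* [ins j (height v z) z] is the point of the hyperplane [<v,.> = -1] over [z],
   so [shadow v] is the projection of the facet of [v] along coordinate [j]. *)
Definition height v z : R := (-1 - pairing (col' j v) z) / v ord0 j.

Definition shadow v : set 'rV[R]_d' := [set z | P (ins j (height v z) z)].

Lemma constraintE w (t : R) z : w ord0 j != 0 ->
  pairing w (ins j t z) + 1 = w ord0 j * (t - height w z).
Proof. by move=> wj; rewrite pairing_ins /height; field. Qed.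

Lemma facet_shadow v y : v ord0 j != 0 -> pairing v y = -1 ->
  facet_of P v y <-> shadow v (col' j y).
Proof.
move=> vj vy; have yE : ins j (height v (col' j y)) (col' j y) = y.
  rewrite (_ : height _ _ = y ord0 j) ?ins_delete// /height.
  by rewrite -vy (pairing_delete j) addrK mulrC mulKf.
by rewrite /shadow /= yE; split=> [[]|].
Qed.

Lemma measurable_shadow v : measurable (shadow v : set (mrV d')).
Proof.
have [s _ sE] := finite_uniq_seq (finite_dual_vertices rP).
pose c w := w ord0 j / v ord0 j.
rewrite (_ : shadow v = halfspaces [seq (col' j w - c w *: col' j v, 1 - c w) | w <- s]).
  exact: measurable_halfspaces.
have E w z : pairing w (ins j (height v z) z) + 1 =
    pairing (col' j w - c w *: col' j v) z + (1 - c w).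
  by rewrite pairing_ins pairingBl pairingZl /height /c; ring.
apply/seteqP; split => z h.
  move=> _ /mapP[w ws ->] /=; rewrite -E; apply: (vertex_ge rP) => //.
  by rewrite sE.
apply/(bidual rP) => w; rewrite sE => /= ws.
by have /= := h _ (map_f _ ws); rewrite -E; lra.
Qed.

Lemma shadow_bounded v : exists2 C, 0 <= C & shadow v `<=` box 0 C.
Proof.
have [C C0 PC] := polytope_bounded rP; exists C => // z /PC bz i.
by have := bz (lift j i); rewrite !mxE liftK.
Qed.

(** Deleting coordinate [j] turns the parametrization of the facet into an affine bijection onto the
    shadow, with linear part [col' j B]. The frame may be any one, integral or not, which also
    covers simplices in the facet. *)
Lemma facet_coordinates_volume v p (B : 'M[R]_(d', d)) : v ord0 j != 0 ->
  pairing v p = -1 -> (forall i, pairing v (row i B) = 0) ->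
  \det (col_mx p B : 'M[R]_(1 + d', d)) != 0 ->
  measurable ([set t | facet_of P v (p + t *m B)] : set (mrV d')) /\
  (mu d' (shadow v) = (`|\det (col_mx p B : 'M[R]_(1 + d', d))| * `|v ord0 j|)%:E *
    volume [set t : 'rV[R]_d' | facet_of P v (p + t *m B)%R])%E.
Proof.
move=> vj vp vB dM; have mS := measurable_shadow v.
have dC := det_delete_col j vp vB.
have dC0 : \det (col' j B) != 0 by rewrite -normr_eq0 dC mulf_neq0 ?normr_eq0.
have colE t : col' j (p + t *m B) = t *m col' j B + col' j p.
  rewrite addrC; apply/rowP => i; rewrite !mxE; congr (_ + _).
  by apply: eq_bigr => k _; rewrite !mxE.
have FE : [set t | facet_of P v (p + t *m B)] =
    [set t | shadow v (t *m col' j B + col' j p)].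
  apply/seteqP; split => t /=; rewrite -colE => h.
    apply/facet_shadow => //; rewrite pairingDr vp mulmx_sum_row pairing_sumr.
    by rewrite big1 ?addr0// => i _; rewrite pairingZr vB mulr0.
  apply/(facet_shadow vj) => //; rewrite pairingDr vp mulmx_sum_row pairing_sumr.
  by rewrite big1 ?addr0// => i _; rewrite pairingZr vB mulr0.
have mF : measurable ([set t | facet_of P v (p + t *m B)] : set (mrV d')).
  rewrite FE -[X in measurable X]setTI.
  exact: (measurableT_comp (measurable_translate (col' j p)) (measurable_mulmx (col' j B)) measurableT mS).
split => //; rewrite volumeE//.
rewrite (measure_integral_indic mS) (ge0_integral_affine_mx (col' j p) dC0)//; last first.
  exact: measurable_indic_EFin.
rewrite dC; congr (_ * _)%E; rewrite FE measure_integral_indic; last by rewrite -FE.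
by apply: eq_integral => t _; rewrite !indicE; congr (_%:R%:E).
Qed.

(** On the line over [z], the normals with positive entry at [j] bound [t] from below and those with
    negative entry from above; [sg] selects a side. When the line meets [P], the tightest bound on
    that side is attained, and distinct heights make it the only one. *)
Lemma shadow_count (r : seq 'rV[R]_d) (sg : R) z : uniq r -> V = [set` r] -> sg != 0 ->
  {in r &, forall v w, v ord0 j != 0 -> w ord0 j != 0 -> v != w -> height v z <> height w z} ->
  \sum_(v <- r | 0 < sg * v ord0 j) (\1_(shadow v) z : R) =
  (`[< exists t : R, P (ins j t z) >])%:R.
Proof.
move=> ur rE sg0 hz.
have inr v : V v <-> v \in r by rewrite rE.
have nz v : 0 < sg * v ord0 j -> v ord0 j != 0.
  by apply: contraTneq => ->; rewrite mulr0 ltxx.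
have constraint v (t : R) : v \in r -> 0 < sg * v ord0 j -> P (ins j t z) ->
    sg * height v z <= sg * t.
  move=> vr vj Pt; have := vertex_ge rP (proj2 (inr v) vr) Pt.
  rewrite constraintE ?nz// => h.
  have : 0 <= sg ^+ 2 * (v ord0 j * (t - height v z)) by rewrite mulr_ge0// sqr_ge0.
  rewrite (_ : _ * _ = (sg * v ord0 j) * (sg * (t - height v z))); last by ring.
  by rewrite pmulr_rge0// mulrBr subr_ge0.
have uniq_shadow v w : v \in r -> w \in r -> 0 < sg * v ord0 j -> 0 < sg * w ord0 j ->
    shadow v z -> shadow w z -> v = w.
  move=> vr wr vj wj sv sw; apply/eqP/negPn/negP => vw.
  apply: (hz v w vr wr (nz _ vj) (nz _ wj) vw); apply: (mulfI sg0).
  by apply: le_anti; rewrite (constraint v _ vr vj sw) (constraint w _ wr wj sv).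
case: asboolP => [[t Pt]|noP]; last first.
  rewrite big1// => v _; rewrite indicE memNset// => sv; apply: noP.
  by exists (height v z).
have [v0 v0r] : exists v0, v0 \in [seq v : 'rV[R]_d <- r | 0 < sg * v ord0 j].
  apply: contrapT => /forallNP no; have : - (sg *: delta_mx ord0 j) = 0 :> 'rV[R]_d.
    apply: (pos_setT_eq0 (dual_pos_setT rP)) => v /inr vr.
    rewrite pairingNr pairingZr pairing_deltar oppr_ge0 leNgt; apply/negP => vj.
    by apply: (no v); rewrite mem_filter vj.
  by apply/eqP; rewrite oppr_eq0 scaler_eq0 (negbTE sg0) (negbTE (delta_neq0 _)).
have [v vr vmax] := seq_argmax (fun v => sg * height v z) v0r.
move: vr; rewrite mem_filter => /andP[vj vr].
have sv : shadow v z.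
  apply/(bidual rP) => w /inr wr; have Pw := vertex_ge rP (proj2 (inr w) wr) Pt.
  have htv : sg * height v z <= sg * t by exact: constraint.
  have [wj|wj] := ltP 0 (sg * w ord0 j).
    have := vmax w; rewrite mem_filter wj wr => /(_ isT) hwv.
    have : 0 <= (sg * w ord0 j) * (sg * (height v z - height w z)).
      by apply: mulr_ge0; [exact: ltW|rewrite mulrBr subr_ge0].
    rewrite (_ : _ * _ = sg ^+ 2 * (w ord0 j * (height v z - height w z))); last by ring.
    by rewrite pmulr_rge0 ?exprn_even_gt0// -constraintE ?nz//; lra.
  (* Moving from [t] down to the tightest bound of the chosen side can only relax the constraints of
     normals that are not on that side. *)
  have : 0 <= - (sg * w ord0 j) * (sg * (t - height v z)).
    by apply: mulr_ge0; [rewrite oppr_ge0|rewrite mulrBr subr_ge0].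
  rewrite [leRHS](_ : _ = sg ^+ 2 * (w ord0 j * (height v z - t))); last by ring.
  rewrite pmulr_rge0 ?exprn_even_gt0// mulrBr.
  move: Pw; rewrite !pairing_ins; lra.
rewrite -big_filter (bigD1_seq v) ?filter_uniq ?mem_filter ?vj//=.
rewrite big_filter_cond big_seq_cond big1 ?addr0.
  by rewrite indicE mem_set.
move=> w /and3P[wr wj wv]; rewrite indicE memNset// => sw.
by case/eqP: wv; exact: uniq_shadow.
Qed.

(** Equality of the heights is an affine equation in [z]. If its linear part vanishes the walls are
    parallel, and equal heights would then give [v = w]. *)
Lemma ae_height_neq v w : v ord0 j != 0 -> w ord0 j != 0 -> v != w ->
  {ae mu d', forall z : mrV d', height v z <> height w z}.
Proof.
move=> vj wj vw.
pose a := (w ord0 j)^-1 *: col' j w - (v ord0 j)^-1 *: col' j v.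
pose b := (v ord0 j)^-1 - (w ord0 j)^-1.
have E z : height v z = height w z -> pairing a z = b.
  by rewrite /height pairingBl !pairingZl /b => h; have := h; lra.
have [a0|a0] := eqVneq a 0.
  apply: aeW => z /E; rewrite a0 pairing0l => /esym b0.
  have vwj : v ord0 j = w ord0 j by apply: invr_inj; apply/eqP; rewrite -subr_eq0 -/b b0.
  case/eqP: vw; rewrite -[v](ins_delete j) -[w](ins_delete j) vwj; congr ins.
  move/eqP: a0; rewrite /a vwj -scalerBr scaler_eq0 invr_eq0 (negbTE wj)/= subr_eq0.
  by move=> /eqP ->.
exists [set z | pairing a z = b]; split; first exact: measurable_hyperplane.
  exact: measure_hyperplane.
by move=> z /= /contrapT/E.
Qed.

Definition on_side (sg : R) (r : seq 'rV[R]_d) : seq 'rV[R]_d :=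
  [seq v : 'rV[R]_d <- r | 0 < sg * v ord0 j].

Lemma sum_shadows (r : seq 'rV[R]_d) : uniq r -> V = [set` r] ->
  (\sum_(v <- on_side 1%R r) mu d' (shadow v) =
   \sum_(v <- on_side (-1)%R r) mu d' (shadow v))%E.
Proof.
move=> ur rE.
have sumE (s : seq 'rV[R]_d) : (\sum_(v <- s) mu d' (shadow v) =
    \int[mu d']_z (\sum_(v <- s) (\1_(shadow v) z)%:E))%E.
  rewrite ge0_integral_sum//; last first.
    by move=> v; apply: measurable_indic_EFin; exact: measurable_shadow.
  by apply: eq_bigr => v _; rewrite -measure_integral_indic//; exact: measurable_shadow.
have mS (s : seq 'rV[R]_d) : measurable_fun setT
    (fun z : mrV d' => (\sum_(v <- s) (\1_(shadow v) z : R)%:E)%E).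
  apply: emeasurable_sum => v.
  by apply: measurable_indic_EFin; exact: measurable_shadow.
rewrite !sumE; apply: ge0_ae_eq_integral => //.
- by move=> z _; apply: sume_ge0 => v _; rewrite lee_fin.
- by move=> z _; apply: sume_ge0 => v _; rewrite lee_fin.
pose apart (vw : 'rV[R]_d * 'rV[R]_d) (z : mrV d') := vw.1 ord0 j != 0 ->
  vw.2 ord0 j != 0 -> vw.1 != vw.2 -> height vw.1 z <> height vw.2 z.
have ae_gen : {ae mu d', forall z : mrV d',
    {in [seq (v, w) | v <- r, w <- r], forall vw, apart vw z}}.
  apply: ae_in_seq; rewrite /apart.
  move=> [v w] _ /=.
  have [vj|vj] := eqVneq (v ord0 j) 0; first by apply: aeW.
  have [wj|wj] := eqVneq (w ord0 j) 0; first by apply: aeW.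
  have [vw|vw] := eqVneq v w; first by apply: aeW.
  by apply: filterS (ae_height_neq vj wj vw).
apply: filterS ae_gen => z hz _.
rewrite !sumEFin /on_side !big_filter; congr EFin.
by rewrite !shadow_count ?oppr_eq0 ?oner_eq0// => v w vr wr; apply: (hz (v, w));
  apply/allpairsP; exists (v, w).
Qed.

End projection.

End minkowski.

(** * Minkowski's relation and the volume criteria *)

Section facet_volumes.
Context {R : realType} {d' : nat}.
Local Notation d := d'.+1.
Local Notation mu := (@rV_measure R).
Local Notation mrV := (@mrV R).
Implicit Types (u v w x y q p : 'rV[R]_d) (z t : 'rV[R]_d').
Variable P : set 'rV[R]_d.
Hypothesis rP : reflexive_polytope P.
Local Notation V := (vertices (dual_polytope P)).
Local Notation D := (normal_fan P).

Lemma rvol_shadow v j : V v -> v ord0 j != 0 ->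
  (mu d' (shadow P j v) = `|v ord0 j|%:E * rvol (facet_of P v))%E.
Proof.
move=> Vv vj; rewrite (rvolE (aff_dim_facet rP Vv)) /=.
have := xgetPex (0, 0) (exists_lattice_frame rP Vv).
set pB := xget _ _; case: pB => p B /= fr.
have [vp vB dM] := lattice_frame_det rP Vv fr.
have dM0 : \det (col_mx p B : 'M[R]_(1 + d', d)) != 0.
  by rewrite -normr_eq0 dM oner_eq0.
by have [_] := facet_coordinates_volume rP vj vp vB dM0; rewrite dM mul1r.
Qed.

(* The edges from the first vertex of the simplex spanned by the rows of [B]. *)
Definition simplex_edges (B : 'M[R]_(1 + d', d)) : 'M[R]_(d', d) :=
  const_mx (-1) *m usubmx B + dsubmx B.

Definition bary_coord z : 'rV[R]_(1 + d') := row_mx (1 - \sum_i z ord0 i)%:M z.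

Lemma simplex_point (B : 'M[R]_(1 + d', d)) z :
  usubmx B + z *m simplex_edges B = bary_coord z *m B.
Proof.
rewrite -[B in RHS]vsubmxK /bary_coord mul_row_col /simplex_edges mulmxDr addrA.
congr (_ + _); rewrite mulmxA mul_scalar_mx scalerBl scale1r; congr (_ + _).
rewrite [z *m _]mx11_scalar mul_scalar_mx -scaleNr; congr (_ *: _).
by rewrite mxE -sumrN; apply: eq_bigr => i _; rewrite mxE mulrN1.
Qed.

Lemma det_simplex (B : 'M[R]_(1 + d', d)) :
  \det (col_mx (usubmx B) (simplex_edges B) : 'M[R]_(1 + d', d)) = \det B.
Proof.
rewrite -[RHS]mul1r -(det_shear_out (const_mx (-1) : 'cV[R]_d')) -det_mulmx.
congr (\det _); rewrite -[B in RHS]vsubmxK /shear_out (@mul_block_col _ 1 d' 1 d').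
by rewrite !mul1mx mul0mx addr0.
Qed.

Lemma sum_bary_coord z : \sum_i bary_coord z ord0 i = 1.
Proof.
rewrite big_split_ord /= big_ord1 row_mxEl mxE eqxx mulr1n.
by rewrite (eq_bigr (fun i => z ord0 i)) ?subrK// => i _; rewrite row_mxEr.
Qed.

Lemma facet_combination v (B : 'M[R]_d) (c : 'rV[R]_d) :
  (forall i, facet_of P v (row i B)) -> (forall i, 0 <= c ord0 i) ->
  \sum_i c ord0 i = 1 -> facet_of P v (c *m B).
Proof.
move=> BF c0 c1; have cE : \sum_i c ord0 i * -1 = -1 by rewrite -mulr_suml c1 mul1r.
rewrite mulmx_sum_row; split.
  apply/(bidual rP) => w Vw; rewrite pairing_sumr -cE.
  apply: ler_sum => i _; rewrite pairingZr ler_wpM2l//.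
  by have [Pi _] := BF i; move/(bidual rP): Pi => /(_ _ Vw).
rewrite /= pairing_sumr -[RHS]cE; apply: eq_bigr => i _.
by have [_ /= vi] := BF i; rewrite pairingZr vi.
Qed.

(** Coordinates adapted to a simplex in the facet. They serve to show that facets have positive
    volume, and to compare the facets of a smooth Fano polytope. *)
Lemma simplex_volume v j (B : 'M[R]_(1 + d', d)) : V v -> v ord0 j != 0 ->
  \det B != 0 -> (forall i, facet_of P v (row i B)) ->
  measurable ([set z | facet_of P v (bary_coord z *m B)] : set (mrV d')) /\
  (mu d' (shadow P j v) = (`|\det B| * `|v ord0 j|)%:E *
     volume [set z : 'rV[R]_d' | facet_of P v (bary_coord z *m B)])%E.
Proof.
move=> Vv vj dB BF.
have vp : pairing v (usubmx B) = -1.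
  rewrite (_ : usubmx B = row (lshift d' ord0) B); first by have [_] := BF (lshift d' ord0).
  by apply/rowP => k; rewrite !mxE.
have vB i : pairing v (row i (simplex_edges B)) = 0.
  rewrite (_ : row i _ = row (rshift 1 i) B - row (lshift d' ord0) B).
    have [_ /= h1] := BF (rshift 1 i); have [_ /= h2] := BF (lshift d' ord0).
    by rewrite pairingBr h1 h2 subrr.
  by apply/rowP => k; rewrite !mxE big_ord1 !mxE mulN1r addrC.
have := facet_coordinates_volume rP vj vp vB; rewrite det_simplex => /(_ dB).
have -> : [set t | facet_of P v (usubmx B + t *m simplex_edges B)] =
    [set z | facet_of P v (bary_coord z *m B)].
  by apply/seteqP; split => z /=; rewrite simplex_point.
by [].
Qed.

Lemma vertex_coord v : V v -> exists j, v ord0 j != 0.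
Proof. by move=> /(dual_vertex_neq0 rP)/rV0Pn. Qed.

Lemma shadow_measure_gt0 v j : V v -> v ord0 j != 0 -> (0 < mu d' (shadow P j v))%E.
Proof.
move=> Vv vj; have [B uB BF] := facet_spanning rP Vv.
have dB : \det B != 0 by move: uB; rewrite unitmxE unitfE.
have [mF ->] := simplex_volume (B := B) Vv vj dB (fun i => proj2 (BF i)).
rewrite volumeE//; apply: mule_gt0; first by rewrite lte_fin mulr_gt0 ?normr_gt0.
(* A box with center and radius [e] has coordinates between 0 and [2 * e], and [d'] of them add up
   to at most [2 * e * d = 1], so all barycentric coordinates are nonnegative. *)
pose e : R := (2 * d%:R)^-1; have e0 : 0 < e by rewrite invr_gt0 mulr_gt0.
have eE : 2 * e * d%:R = 1 by rewrite /e; field; rewrite addrC natr1 pnatr_eq0.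
apply: (measure_box_gt0 (c := const_mx e) mF e0) => z bz /=.
have ze i : 0 <= z ord0 i <= 2 * e.
  have := bz i; rewrite mxE ler_norml => /andP[h1 h2]; apply/andP; split; lra.
apply: facet_combination; [by move=> i; have [] := BF i| |exact: sum_bary_coord].
move=> i; case: (fintype.split_ordP (i : 'I_(1 + d'))) => k ->.
  rewrite (@row_mxEl _ 1 1 d') mxE (ord1 k) eqxx mulr1n subr_ge0.
  rewrite -eE (@le_trans _ _ (\sum_(i < d') 2 * e))//.
    by apply: ler_sum => l _; have /andP[] := ze l.
  rewrite sumr_const card_ord -[leLHS]mulr_natr; apply: ler_wpM2l.
    by rewrite mulr_ge0// ltW.
  by rewrite ler_nat.
by rewrite (@row_mxEr _ 1 1 d'); have /andP[] := ze k.
Qed.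

Lemma rvol_facet_real v : V v -> exists2 r : R, 0 < r & rvol (facet_of P v) = r%:E.
Proof.
move=> Vv; have [j vj] := vertex_coord Vv.
have := rvol_shadow Vv vj; have := shadow_measure_gt0 Vv vj.
have [C C0 sC] := shadow_bounded rP j v.
have := measure_box_lty (measurable_shadow rP j v) C0 sC.
have vj0 : 0 < `|v ord0 j| by rewrite normr_gt0.
case: (rvol _) => [r| |] + + E; rewrite E.
- by rewrite -EFinM lte_fin pmulr_rgt0// => _ r0; exists r.
- by rewrite gt0_muley ?lte_fin// ltxx.
- by rewrite gt0_muleNy ?lte_fin.
Qed.

Definition facet_weight v : R := fine (rvol (facet_of P v)).

Lemma rvol_facetE v : V v -> rvol (facet_of P v) = (facet_weight v)%:E.
Proof. by move=> /rvol_facet_real[r _ rE]; rewrite /facet_weight rE. Qed.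

Lemma facet_weight_gt0 v : V v -> 0 < facet_weight v.
Proof. by move=> /rvol_facet_real[r r0 rE]; rewrite /facet_weight rE. Qed.

Lemma minkowski_relation : \sum_(v \in V) facet_weight v *: v = 0.
Proof.
have [r ur rE] := finite_uniq_seq (finite_dual_vertices rP).
rewrite (fsum_seq _ ur rE); apply/rowP => j; rewrite summxE [RHS]mxE.
have sideE (sg : R) : sg != 0 -> (\sum_(v <- on_side j sg r) mu d' (shadow P j v) =
    (\sum_(v <- on_side j sg r) facet_weight v * `|v ord0 j|)%:E)%E.
  move=> sg0; rewrite -sumEFin big_seq [RHS]big_seq; apply: eq_bigr => v.
  rewrite mem_filter => /andP[vj vr].
  have Vv : V v by rewrite rE.
  rewrite rvol_shadow//; first by rewrite rvol_facetE// -EFinM mulrC.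
  by apply: contraTneq vj => ->; rewrite mulr0 ltxx.
have := sum_shadows rP j ur rE.
rewrite !sideE ?oppr_eq0 ?oner_eq0// => -[] sidesE.
rewrite (eq_bigr (fun v => (if 0 < 1 * v ord0 j then facet_weight v * `|v ord0 j| else 0) -
    (if 0 < -1 * v ord0 j then facet_weight v * `|v ord0 j| else 0))); last first.
  move=> v _; rewrite mxE mul1r mulN1r oppr_gt0; case: ltgtP => [vj|vj|<-].
  - by rewrite gtr0_norm// subr0.
  - by rewrite ltr0_norm// mulrN opprK add0r.
  - by rewrite mulr0 subr0.
move: sidesE; rewrite /on_side !big_filter !(big_mkcond (fun v : 'rV[R]_d => 0 < _ * v ord0 j)).
by rewrite sumrB => ->; rewrite subrr.
Qed.

Lemma minkowski_pairing x : \sum_(v \in V) facet_weight v * pairing v x = 0.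
Proof.
have [r ur rE] := finite_uniq_seq (finite_dual_vertices rP).
rewrite (fsum_seq _ ur rE) -[RHS](pairing0l x) -minkowski_relation (fsum_seq _ ur rE).
by rewrite pairing_suml; apply: eq_bigr => v _; rewrite pairingZl.
Qed.

(** Paired with [x], Minkowski's relation says that the weight of [eta] is the sum of
    [facet_weight v * <v, x>] over the other normals. A single term with [<v, x> = 1] means equal
    weights; conversely, equal weights can be divided out, leaving pairings that sum to zero. *)
Lemma opp_root_facet_volume eta x : polytope_root P eta x ->
  fan_roots D (- x) <->
  forall F, is_facet P F -> 0 < pairing (inner_normal F) x ->
    rvol F = rvol (facet_at P x).
Proof.
move=> rx; rewrite (facet_at_root rP rx).
have Veta := root_vertex rx; have eta_x := root_pairing rx.
have [r ur rE] := finite_uniq_seq (finite_dual_vertices rP).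
have inr v : V v <-> v \in r by rewrite rE.
have etar : eta \in r by apply/inr.
have := minkowski_pairing x; rewrite (fsum_seq _ ur rE) (bigD1_seq eta)//= eta_x mulrN1.
move=> /eqP; rewrite addrC subr_eq0 => /eqP mink; split.
  move=> /(opp_root_balanced rP rx)[v [Vv vx h]] F /(is_facetP rP)[w Vw ->].
  rewrite inner_normal_facet// => wx; have we := root_pos_neq rx wx.
  have wv : w = v.
    by apply/eqP/negPn/negP => wv; move: wx; rewrite h ?ltxx.
  rewrite wv !rvol_facetE// -mink; congr EFin.
  have vr : v \in r by apply/inr.
  have ve : v != eta by rewrite -wv.
  rewrite -big_filter (bigD1_seq v) ?filter_uniq ?mem_filter ?ve//= vx mulr1.
  rewrite big_filter_cond big_seq_cond big1 ?addr0// => u /and3P[ur' ue uv].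
  by rewrite h ?mulr0//; apply/inr.
move=> volF; apply/(opp_root_sum_vertices rP rx).
rewrite (fsum_seq _ ur rE) (bigD1_seq eta)//= eta_x.
have w0 := facet_weight_gt0 Veta.
have : \sum_(i <- r | i != eta) facet_weight eta * pairing i x = facet_weight eta.
  rewrite -[RHS]mink big_seq_cond [RHS]big_seq_cond; apply: eq_bigr => v /andP[vr ve].
  have Vv : V v by apply/inr.
  have [->|vx0] := eqVneq (pairing v x) 0; first by rewrite !mulr0.
  have vx : 0 < pairing v x by rewrite lt_neqAle eq_sym vx0 (root_ge0 rx).
  have := volF (facet_of P v); rewrite inner_normal_facet// /facet_weight => ->//.
  by apply/(is_facetP rP); exists v.
rewrite -mulr_sumr => /eqP; rewrite -[X in _ == X]mulr1.
rewrite (inj_eq (mulfI (lt0r_neq0 w0))) => /eqP ->.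
by rewrite addNr.
Qed.

Lemma equal_volumes_sum_vertices :
  (forall F F', is_facet P F -> is_facet P F' -> rvol F = rvol F') ->
  \sum_(v \in V) v = 0.
Proof.
move=> eqvol; have [r ur rE] := finite_uniq_seq (finite_dual_vertices rP).
have := minkowski_relation; rewrite !(fsum_seq _ ur rE).
case: r ur rE => [|v0 r'] ur rE; first by rewrite !big_nil.
set r := v0 :: r' in ur rE *.
have inr v : v \in r -> V v by rewrite rE.
have V0 : V v0 by apply: inr; exact: mem_head.
rewrite big_seq (eq_bigr (fun v => facet_weight v0 *: v)); last first.
  move=> v /inr Vv; rewrite /facet_weight (eqvol _ (facet_of P v0))//.
    by apply/(is_facetP rP); exists v.
  by apply/(is_facetP rP); exists v0.
rewrite -big_seq -scaler_sumr => /eqP.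
by rewrite scaler_eq0 gt_eqF ?facet_weight_gt0// => /eqP.
Qed.

(** A smooth facet is the image of the standard simplex under a unimodular matrix. The right-hand
    side is independent of [F], so any two facets can be compared through it. *)
Lemma smooth_facet_volume F : smooth_Fano_polytope P -> is_facet P F ->
  rvol F = volume [set z : 'rV[R]_d' | forall i, 0 <= bary_coord z ord0 i].
Proof.
move=> [_ _ smooth] FF; have [B [[_ latB] vertB]] := smooth F FF.
have /(is_facetP rP)[v Vv FE] := FF.
have [s [_ [_ [_ _ _ PE _]]]] := reflexive_generators rP.
have Fconv : F = conv (range (fun i => row i B)).
  rewrite -vertB FE (facet_of_conv (dual_vertex_dual rP Vv) PE).
  have -> : [set` s] `&` [set x | pairing v x = -1] = [set` [seq w <- s | pairing v w == -1]].
    apply/seteqP; split => w /=; rewrite mem_filter.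
      by move=> [ws /eqP vw]; rewrite vw ws.
    by move=> /andP[/eqP vw ws].
  by rewrite conv_vertices.
have BF i : facet_of P v (row i B).
  by rewrite -FE Fconv; apply: sub_conv; exists i.
have ld i : lattice (delta_mx ord0 i : 'rV[R]_d).
  by move=> j; rewrite mxE eqxx /= natr_int.
have iB : int_mx B.
  apply/int_mx_rows => i; rewrite latB; exists (delta_mx ord0 i) => //.
  by rewrite rowE.
have [Z ZP] : exists Z : 'I_d -> 'rV[R]_d, forall i, lattice (Z i) /\ Z i *m B = delta_mx ord0 i.
  suff /boolp.choice[Z ZP] : forall i, exists z : 'rV[R]_d,
    lattice z /\ z *m B = delta_mx ord0 i by exists Z.
  by move=> i; have := ld i; rewrite {1}latB => -[z lz zB]; exists z.
have ZB : (\matrix_i Z i) *m B = 1%:M.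
  by apply/row_matrixP => i; rewrite row_mul rowK row1; have [] := ZP i.
have dB1 : `|\det B| = 1.
  apply: (norm_det_unimodular _ iB ZB).
  by apply/int_mx_rows => i; rewrite rowK; have [] := ZP i.
have uB : B \in unitmx by have [_ ->] := mulmx1_unit ZB.
have dB : \det B != 0 by rewrite -normr_eq0 dB1 oner_eq0.
have [j vj] := vertex_coord Vv.
have := rvol_shadow Vv vj.
have [_ ->] := simplex_volume (B := B) Vv vj dB BF.
rewrite dB1 mul1r -FE.
have -> : [set z | F (bary_coord z *m B)] =
    [set z : 'rV[R]_d' | forall i, 0 <= bary_coord z ord0 i].
  apply/seteqP; split => z /= h; last first.
    by rewrite FE; exact: facet_combination BF h (sum_bary_coord z).
  move: h; rewrite Fconv => -[n [a [y [a0 a1 yB zE]]]] i.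
  have /boolp.choice[f fE] : forall k, exists i, y k = row i B.
    by move=> k; have [i' _ <-] := yB k; exists i'.
  have -> : bary_coord z = \sum_k a k *: delta_mx ord0 (f k).
    rewrite -[LHS](mulmxK uB) zE -[RHS](mulmxK uB); congr (_ *m _).
    by rewrite mulmx_suml; apply: eq_bigr => k _; rewrite -scalemxAl -rowE fE.
  by rewrite summxE sumr_ge0// => k _; rewrite !mxE mulr_ge0.
have vj0 : 0 < `|v ord0 j| by rewrite normr_gt0.
have [m _ ->] : exists2 m : R, 0 < m & rvol F = m%:E by rewrite FE; exact: rvol_facet_real.
case: (volume _) => [w| |].
- by rewrite -!EFinM => -[] /(mulfI (lt0r_neq0 vj0)) ->.
- by rewrite gt0_muley ?lte_fin.
- by rewrite gt0_muleNy ?lte_fin.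
Qed.

End facet_volumes.

(** * Dimension zero *)

Section dimension_zero.
Context {R : realType}.

Lemma rV0_eq (x y : 'rV[R]_0) : x = y.
Proof. by apply/rowP => -[]. Qed.

Lemma fan_roots_rV0 (D : set (set 'rV[R]_0)) x : ~ fan_roots D x.
Proof.
move=> [_ [t [_ + _]]]; rewrite /pairing big_ord0 => /eqP.
by rewrite eq_sym oppr_eq0 oner_eq0.
Qed.

Lemma semisimple_rV0 (D : set (set 'rV[R]_0)) : semisimple D.
Proof. by apply/semisimpleP => x /fan_roots_rV0. Qed.

Lemma is_facet_rV0 (P F : set 'rV[R]_0) : ~ is_facet P F.
Proof. by move=> [_ _]. Qed.

End dimension_zero.

(** * From single roots to semisimplicity *)

Section reflexive_criteria.
Context {R : realType} {d' : nat}.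
Local Notation d := d'.+1.
Variable P : set 'rV[R]_d.
Hypothesis rP : reflexive_polytope P.
Local Notation D := (normal_fan P).

Lemma semisimple_criterion (Q : 'rV[R]_d -> Prop) :
  (forall eta x, polytope_root P eta x -> fan_roots D (- x) <-> Q x) ->
  semisimple D <-> forall x, fan_roots D x -> Q x.
Proof.
move=> QP; rewrite semisimpleP; split=> h x Dx.
  by have /(polytope_rootP rP)[eta /QP <-] := Dx; exact: h.
by have /(polytope_rootP rP)[eta /QP ->] := Dx; exact: h.
Qed.

Lemma semisimple_of_opp_root :
  (forall eta x, polytope_root P eta x -> fan_roots D (- x)) -> semisimple D.
Proof. by move=> h; apply/semisimpleP => x /(polytope_rootP rP)[eta /h]. Qed.

Lemma reflexive_sum_roots : semisimple D <-> \sum_(x \in fan_roots D) x = 0.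
Proof.
split; first exact: (semisimple_sum_roots (span_normal_fan rP)).
exact: (sum_roots_semisimple (span_normal_fan rP)).
Qed.

End reflexive_criteria.

Theorem theorem4p2 (R : realType) (d : nat) :
  (forall D : set (set 'rV[R]_d), complete_fan D ->
     [<-> semisimple D;
          \sum_(x \in fan_roots D) x = 0;
          forall x, fan_roots D x ->
            \sum_(t \in rays D) pairing (prim_gen t) x = 0] /\
     (\sum_(t \in rays D) prim_gen t = 0 -> semisimple D))
  /\
  (forall P : set 'rV[R]_d, reflexive_polytope P ->
     [<-> semisimple (normal_fan P);
          \sum_(x \in fan_roots (normal_fan P)) x = 0;
          forall x, fan_roots (normal_fan P) x ->
            \sum_(v \in vertices (dual_polytope P)) pairing v x = 0;
          forall x, fan_roots (normal_fan P) x ->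
            \sum_(y \in dual_polytope P `&` lattice) pairing y x = 0;
          forall x, fan_roots (normal_fan P) x ->
            pairing (barycenter (dual_polytope P)) x = 0;
          forall x, fan_roots (normal_fan P) x ->
            forall F', is_facet P F' -> 0 < pairing (inner_normal F') x ->
              rvol F' = rvol (facet_at P x);
          forall x, fan_roots (normal_fan P) x ->
            forall F', is_facet P F' -> 0 < pairing (inner_normal F') x ->
              F' `&` lattice #= facet_at P x `&` lattice] /\
     [/\ barycenter P = 0 -> semisimple (normal_fan P),
         \sum_(m \in P `&` lattice) m = 0 -> semisimple (normal_fan P),
         barycenter (dual_polytope P) = 0 -> semisimple (normal_fan P),
         \sum_(y \in dual_polytope P `&` lattice) y = 0 -> semisimple (normal_fan P) &
         \sum_(v \in vertices (dual_polytope P)) v = 0 -> semisimple (normal_fan P)] /\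
     ((forall F F', is_facet P F -> is_facet P F' -> rvol F = rvol F') ->
        semisimple (normal_fan P)) /\
     ((forall F F', is_facet P F -> is_facet P F' ->
         F `&` lattice #= F' `&` lattice) ->
        semisimple (normal_fan P)) /\
     ((forall F F', is_facet P F -> is_facet P F' -> rvol F = rvol F') ->
        \sum_(v \in vertices (dual_polytope P)) v = 0) /\
     (smooth_Fano_polytope P ->
        (forall F F', is_facet P F -> is_facet P F' -> rvol F = rvol F') /\
        \sum_(v \in vertices (dual_polytope P)) v = 0)).
Proof.
split=> [D cD|P rP].
  have finD : finite_set (rays D).
    by have [[fD _ _ _ _] _] := cD; apply: sub_finite_set fD => t [].
  have spanD := complete_fan_span cD.
  split; first exact: (fan_semisimple_TFAE finD spanD).
  exact: (sum_prim_gen_semisimple finD).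
(* In dimension zero there are neither roots nor facets, and all vectors are equal; the arguments on
   facets are made in dimension [d'.+1]. *)
case: d P rP => [|d'] P rP.
  have ss := semisimple_rV0 (normal_fan P).
  have nF F : ~ is_facet P F := @is_facet_rV0 R P F.
  split.
    tfae.
    - by move=> _; exact: rV0_eq.
    - by move=> _ x /fan_roots_rV0.
    - by move=> _ x /fan_roots_rV0.
    - by move=> _ x /fan_roots_rV0.
    - by move=> _ x /fan_roots_rV0.
    - by move=> _ x /fan_roots_rV0.
    - by move=> _; exact: ss.
  split; first by split=> _; exact: ss.
  split; first by move=> _; exact: ss.
  split; first by move=> _; exact: ss.
  split; first by move=> _; exact: rV0_eq.
  by move=> _; split; [move=> F F' /nF|exact: rV0_eq].
have cb := reflexive_sum_roots rP.
have cc := semisimple_criterion rP (opp_root_sum_vertices rP).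
have cd := semisimple_criterion rP (opp_root_sum_lattice rP).
have ce := semisimple_criterion rP (opp_root_dual_barycenter rP).
have cf := semisimple_criterion rP (opp_root_facet_volume rP).
have cg := semisimple_criterion rP (opp_root_facet_card rP).
have fV := finite_dual_vertices rP.
have vol_vertices := equal_volumes_sum_vertices rP.
have sum_vertices : \sum_(v \in vertices (dual_polytope P)) v = 0 ->
    semisimple (normal_fan P).
  have [r ur rE] := finite_uniq_seq fV.
  rewrite (fsum_seq _ ur rE) => sum0; apply/cc => x _.
  by rewrite (fsum_seq _ ur rE) -pairing_suml sum0 pairing0l.
(* Each implication of the cycle passes through semisimplicity, to which every condition has been
   shown equivalent. *)
split.
  tfae.
  - by move=> /cb.
  - by move=> /cb/cc.
  - by move=> /cc/cd.
  - by move=> /cd/ce.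
  - by move=> /ce/cf.
  - by move=> /cf/cg.
  - by move=> /cg.
split.
  split=> [b0|s0|b0|s0|//].
  - by apply: (semisimple_of_opp_root rP) => eta x rx; exact: (opp_root_barycenter rP rx b0).
  - by apply: (semisimple_of_opp_root rP) => eta x rx; exact: (opp_root_sum_polytope_lattice rP rx s0).
  - by apply/ce => x _; rewrite b0 pairing0l.
  - have [r ur rE] := finite_uniq_seq (dual_finite_lattice rP).
    apply/cd => x _; rewrite (fsum_seq _ ur rE).
    by rewrite (fsum_seq _ ur rE) in s0; rewrite -pairing_suml s0 pairing0l.
have FxP x : fan_roots (normal_fan P) x -> is_facet P (facet_at P x).
  move=> /(polytope_rootP rP)[eta rx]; rewrite (facet_at_root rP rx).
  by apply/(is_facetP rP); exists eta => //; exact: root_vertex rx.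
split; first by move=> /vol_vertices/sum_vertices.
split; first by move=> card; apply/cg => x /FxP Fx F FF _; exact: card.
split; first exact: vol_vertices.
move=> smooth.
have vol F F' : is_facet P F -> is_facet P F' -> rvol F = rvol F'.
  by move=> FF FF'; rewrite !(smooth_facet_volume rP smooth).
by split => //; exact: vol_vertices.
Qed.
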